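(* Let $n\ge1$, $p,q\ge2$, $s_1,s_2\in(0,1)$, $C\ge0$, and let $u\in C(\bar B_2)\cap L^{p-1}_{s_1p}(\mathbb{R}^n)\cap L^{q-1}_{s_2q}(\mathbb{R}^n)$ be a viscosity solution to $$-C\le(-\Delta_p)^{s_1}u+(-\Delta_q)^{s_2}u\le C\quad\text{in }B_2.$$ Put $\varpi=\min\bigl\{1,\max\{\frac{s_1p}{p-1},\frac{s_2q}{q-1}\}\bigr\}$. Then $u\in C^{0,\gamma}(B_1)$ for any $\gamma\in(0,\varpi)$. Furthermore, if $$\sup_{B_2}|u|+\int_{\mathbb{R}^n}\frac{|u(z)|^{p-1}}{(1+|z|)^{n+s_1p}}\,dz+\int_{\mathbb{R}^n}\frac{|u(z)|^{q-1}}{(1+|z|)^{n+s_2q}}\,dz\le A_0,$$ then $\|u\|_{C^{0,\gamma}(B_1)}$ is bounded above by a constant dependent only on $\gamma, C,A_0,n,p,q,s_1,s_2$. In addition, when $\max\{\frac{s_1p}{p-1},\frac{s_2q}{q-1}\}\neq1$, $u$ is locally $\varpi$-Hölder continuous in $B_2$.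
   Context: $B_r(x_0)$ is the open ball of radius $r$ centred at $x_0$ and $B_r=B_r(0)$. For $p>1$, $s\in(0,1)$, $(-\Delta_p)^su(x)=-(1-s)\,\mathrm{PV}\int_{\mathbb{R}^n}|u(y)-u(x)|^{p-2}(u(y)-u(x))\frac{dy}{|x-y|^{n+sp}}$, and $L^{p-1}_{sp}(\mathbb{R}^n)=\{v\in L^{p-1}_{\rm loc}(\mathbb{R}^n):\int_{\mathbb{R}^n}\frac{|v(z)|^{p-1}}{(1+|z|)^{n+sp}}dz<\infty\}$. $\|\cdot\|_{C^{0,\gamma}(B_1)}$ is the sup norm plus the $\gamma$-Hölder seminorm on $B_1$. Viscosity solutions. Let $\mathscr{M}v=(-\Delta_p)^{s_1}v+(-\Delta_q)^{s_2}v$. A function $u\in C(\bar B_2)\cap L^{p-1}_{s_1p}(\mathbb{R}^n)\cap L^{q-1}_{s_2q}(\mathbb{R}^n)$ is a viscosity solution to $-C\le\mathscr{M}u\le C$ in $B_2$ if for every ball $B_r(x_0)\subset B_2$ and every $\eta\in C^2(B_r(x_0))$ with $\eta(x_0)=u(x_0)$, denoting by $\eta_r$ the function equal to $\eta$ in $B_r(x_0)$ and to $u$ elsewhere: if $\eta\ge u$ in $B_r(x_0)$ then $\mathscr{M}\eta_r(x_0)\le C$, and if $\eta\le u$ in $B_r(x_0)$ then $\mathscr{M}\eta_r(x_0)\ge-C$. (Since $p,q\ge2$, no restriction on the test functions is needed.) *)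

(* Defs.v *)
From HB Require Import structures.
From mathcomp Require Import all_boot all_order all_algebra.
From mathcomp Require Import all_classical all_reals all_analysis.
From mathcomp Require Import measurable_realfun.

Set Implicit Arguments.
Unset Strict Implicit.
Unset Printing Implicit Defensive.

Import Order.TTheory GRing.Theory Num.Theory.
Import numFieldNormedType.Exports.

Local Open Scope classical_set_scope.
Local Open Scope ring_scope.

(* The norm of the library's normed module ['rV[R]_n] is the sup norm: it gives
   the right topology, but balls, principal values and Hoelder quotients below
   use the Euclidean norm. *)
Definition enorm (R : realType) (n : nat) (x : 'rV[R]_n) : R :=
  Num.sqrt (\sum_(i < n) x ord0 i ^+ 2).

Definition eball (R : realType) (n : nat) (x0 : 'rV[R]_n) (r : R) :
    set 'rV[R]_n :=
  [set x | enorm (x - x0) < r].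

Definition ecball (R : realType) (n : nat) (x0 : 'rV[R]_n) (r : R) :
    set 'rV[R]_n :=
  [set x | enorm (x - x0) <= r].

(* Product sigma-algebra on [R^n], generated by the coordinates (the same
   construction as the library's for [n.-tuple R]); it is the Borel one. *)
Section measurable_rV.
Context {R : realType} {n : nat}.

Let coord (i : 'I_n) (v : 'rV[R]_n) : measurableTypeR R := v ord0 i.

Let rV_set0 : g_sigma_preimage coord set0.
Proof. exact: sigma_algebra0. Qed.

Let rV_setC A : g_sigma_preimage coord A -> g_sigma_preimage coord (~` A).
Proof. exact: sigma_algebraC. Qed.

Let rV_bigcup (F : _^nat) : (forall i, g_sigma_preimage coord (F i)) ->
  g_sigma_preimage coord (\bigcup_i (F i)).
Proof. exact: sigma_algebra_bigcup. Qed.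

HB.instance Definition _ := @isMeasurable.Build
  (measure_tuple_display default_measure_display)
  'rV[R]_n (g_sigma_preimage coord) rV_set0 rV_setC rV_bigcup.

End measurable_rV.

(* Lebesgue measure on [R^n], with [R^(n+1)] identified with [R^n * R] by
   splitting off the first coordinate. *)
Fixpoint lebesgue_rV (R : realType) (n : nat) : set 'rV[R]_n -> \bar R :=
  match n with
  | 0 => dirac (0 : 'rV[R]_0)
  | m.+1 => pushforward (@lebesgue_rV R m \x lebesgue_measure)%E
      (fun z : 'rV[R]_m * measurableTypeR R =>
         row_mx (const_mx z.2 : 'rV[R]_1) z.1 : 'rV[R]_m.+1)
  end.

Lemma measurable_coord (R : realType) (n : nat) (i : 'I_n) :
  measurable_fun setT (fun v : 'rV[R]_n => v ord0 i : measurableTypeR R).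
Proof.
move=> _ Y mY; rewrite setTI; apply: sub_sigma_algebra => /=.
rewrite -bigcup_seq/=; exists i; first by rewrite /= mem_index_enum.
by exists Y; rewrite ?setTI.
Qed.

Lemma measurable_fun_rV d (T : measurableType d) (R : realType) (n : nat)
    (f : T -> 'rV[R]_n) :
  (forall i, measurable_fun setT (fun x => f x ord0 i : measurableTypeR R)) ->
  measurable_fun setT f.
Proof.
move=> mf _ Y mY; rewrite setTI.
move: Y mY; apply: smallest_sub.
  split; first by rewrite /= preimage_set0.
  - by move=> A /= mA; rewrite setTD preimage_setC; exact: measurableC.
  - by move=> F /= mF; rewrite preimage_bigcup; exact: bigcupT_measurable.
rewrite -bigcup_seq => A [i _ [B mB <-]] /=.
by have := mf i measurableT B mB; rewrite !setTI.
Qed.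

Lemma measurable_row_mx (R : realType) (m : nat) :
  measurable_fun setT (fun z : 'rV[R]_m * measurableTypeR R =>
    row_mx (const_mx z.2 : 'rV[R]_1) z.1 : 'rV[R]_m.+1).
Proof.
apply: measurable_fun_rV => i.
case: (splitP (i : 'I_(1 + m))) => j ij.
  rewrite (_ : (fun _ => _) = snd) //; apply/funext => z /=.
  have -> : i = lshift m j by apply/val_inj.
  by rewrite (row_mxEl (const_mx z.2 : 'rV_1) z.1) mxE.
rewrite (_ : (fun _ => _) = (fun v : 'rV[R]_m => v ord0 j) \o fst); last first.
  apply/funext => z /=.
  have -> : i = rshift 1 j by apply/val_inj.
  by rewrite (row_mxEr (const_mx z.2 : 'rV_1) z.1).
by apply: measurableT_comp => //; exact: measurable_coord.
Qed.

Arguments lebesgue_rV {R} n _.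

Section lebesgue_rV_measure.
Context {R : realType} {n : nat}.
Local Open Scope ereal_scope.

Let lebesgue_rV_spec :
  exists nu : {measure set 'rV[R]_n -> \bar R}, lebesgue_rV n = nu.
Proof.
elim: n => [|m [nu nuE]]; first by exists (dirac (0%R : 'rV[R]_0)).
unshelve eexists.
  refine (pushforward (nu \x lebesgue_measure)
    (fun z : 'rV[R]_m * measurableTypeR R =>
      row_mx (const_mx z.2 : 'rV[R]_1) z.1 : 'rV[R]_m.+1)
    : {measure set 'rV[R]_m.+1 -> \bar R}).
  exact: measurable_row_mx.
by rewrite /= nuE.
Qed.

Let lebesgue_rV0 : lebesgue_rV n set0 = 0 :> \bar R.
Proof. by have [nu ->] := lebesgue_rV_spec; exact: measure0. Qed.

Let lebesgue_rV_ge0 (A : set 'rV[R]_n) : 0 <= lebesgue_rV n A.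
Proof. by have [nu ->] := lebesgue_rV_spec; exact: measure_ge0. Qed.

Let lebesgue_rV_additive : semi_sigma_additive (@lebesgue_rV R n).
Proof.
by have [nu ->] := lebesgue_rV_spec; exact: measure_semi_sigma_additive.
Qed.

HB.instance Definition _ := isMeasure.Build _ _ _ (@lebesgue_rV R n)
  lebesgue_rV0 lebesgue_rV_ge0 lebesgue_rV_additive.

End lebesgue_rV_measure.

(* [f] is measurable for the completion of the Borel sigma-algebra, i.e.
   Lebesgue measurable.  The library integral is a supremum over Borel simple
   functions, so for such [f] it is the usual Lebesgue integral even when [f]
   is not Borel. *)
Definition Lebesgue_measurable (R : realType) (n : nat) (f : 'rV[R]_n -> R) :
    Prop :=
  measurable_fun setT
    (f : g_sigma_algebraType (completed_algebra_gen (@lebesgue_rV R n)) ->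
         measurableTypeR R).

Definition tail_integral (R : realType) (n : nat) (p s : R)
    (v : 'rV[R]_n -> R) : \bar R :=
  (\int[lebesgue_rV n]_z
    (`|v z| `^ (p - 1) / (1 + enorm z) `^ (n%:R + s * p))%:E)%E.

Definition Lloc (R : realType) (n : nat) (a : R) (v : 'rV[R]_n -> R) : Prop :=
  Lebesgue_measurable v /\
  forall K : set 'rV[R]_n, compact K ->
    (\int[lebesgue_rV n]_(z in K) (`|v z| `^ a)%:E < +oo)%E.

Definition tail_space (R : realType) (n : nat) (p s : R)
    (v : 'rV[R]_n -> R) : Prop :=
  Lloc (p - 1) v /\ (tail_integral p s v < +oo)%E.

(* The principal value is a limit in [\bar R]; for the test functions [eta_r]
   below (with [2 <= p]) it always exists, with an infinite value possible when
   [eta] is not integrable near the boundary of its ball. *)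
Definition PV (R : realType) (n : nat) (x : 'rV[R]_n) (F : 'rV[R]_n -> R) :
    \bar R :=
  lim ((fun e : R => \int[lebesgue_rV n]_(y in ~` ecball x e) (F y)%:E)%E
         @ 0^'+).

Definition frac_plaplacian (R : realType) (n : nat) (p s : R)
    (u : 'rV[R]_n -> R) (x : 'rV[R]_n) : \bar R :=
  ((- (1 - s))%:E *
   PV x (fun y => `|u y - u x| `^ (p - 2) * (u y - u x)
                    / enorm (x - y) `^ (n%:R + s * p))%R)%E.

Definition mixed_op (R : realType) (n : nat) (p q s1 s2 : R)
    (v : 'rV[R]_n -> R) (x : 'rV[R]_n) : \bar R :=
  (frac_plaplacian p s1 v x + frac_plaplacian q s2 v x)%E.

(* For an open set [A]: the partial derivatives exist and are continuous. *)
Definition C1_on (R : realType) (n : nat) (A : set 'rV[R]_n)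
    (f : 'rV[R]_n -> R) : Prop :=
  forall (i : 'I_n) x, A x ->
    derivable f x (delta_mx ord0 i) /\
    {for x, continuous ('D_(delta_mx ord0 i) f)}.

Definition C2_on (R : realType) (n : nat) (A : set 'rV[R]_n)
    (f : 'rV[R]_n -> R) : Prop :=
  C1_on A f /\ forall i : 'I_n, C1_on A ('D_(delta_mx ord0 i) f).

(* [patch u A eta] equals [eta] on [A] and [u] elsewhere. *)
Definition viscosity_solution (R : realType) (n : nat) (p q s1 s2 C : R)
    (u : 'rV[R]_n -> R) : Prop :=
  [/\ {within ecball 0 2, continuous u},
      tail_space p s1 u,
      tail_space q s2 u &
      forall (x0 : 'rV[R]_n) (r : R) (eta : 'rV[R]_n -> R),
        0 < r -> eball x0 r `<=` eball 0 2 ->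
        C2_on (eball x0 r) eta -> eta x0 = u x0 ->
        ((forall x, eball x0 r x -> u x <= eta x) ->
           (mixed_op p q s1 s2 (patch u (eball x0 r) eta) x0 <= C%:E)%E) /\
        ((forall x, eball x0 r x -> eta x <= u x) ->
           ((- C)%:E <= mixed_op p q s1 s2 (patch u (eball x0 r) eta) x0)%E)].

Definition sup_norm (R : realType) (n : nat) (A : set 'rV[R]_n)
    (u : 'rV[R]_n -> R) : \bar R :=
  ereal_sup [set (`|u x|)%:E | x in A].

(* This is [-oo] on a set with at most one point, where [hoelder_on] below is
   trivially true, as it should be. *)
Definition hoelder_seminorm (R : realType) (n : nat) (gamma : R)
    (A : set 'rV[R]_n) (u : 'rV[R]_n -> R) : \bar R :=
  ereal_sup [set (`|u z.1 - u z.2| / enorm (z.1 - z.2) `^ gamma)%:E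
            | z in [set z | [/\ A z.1, A z.2 & z.1 != z.2]]].

Definition hoelder_norm (R : realType) (n : nat) (gamma : R)
    (A : set 'rV[R]_n) (u : 'rV[R]_n -> R) : \bar R :=
  (sup_norm A u + hoelder_seminorm gamma A u)%E.

Definition hoelder_on (R : realType) (n : nat) (gamma : R)
    (A : set 'rV[R]_n) (u : 'rV[R]_n -> R) : Prop :=
  (hoelder_norm gamma A u < +oo)%E.

Definition locally_hoelder_in (R : realType) (n : nat) (gamma : R)
    (A : set 'rV[R]_n) (u : 'rV[R]_n -> R) : Prop :=
  forall K : set 'rV[R]_n, compact K -> K `<=` A -> hoelder_on gamma K u.

(* Main.v *)
Require Import Defs.
From mathcomp Require Import all_boot all_order all_algebra.
From mathcomp Require Import ring lra.
From mathcomp Require Import all_classical all_reals all_analysis.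
From mathcomp Require Import measurable_realfun.

(** The estimate is proved by doubling the variables and comparing the two
    operators at the two points (the method of Ishii and Lions), and then by
    bootstrapping.

    Let [u] be bounded by [A0] in [B_2], with tails bounded by [A0], and let
    [phi] be a concave modulus, [phi t = t^gam] or, for the Lipschitz estimate,
    [phi t = t - t^(1+alf) / 4].  If [u x - u y <= L phi(|x - y|)] fails near a
    point [x0] of a smaller ball, then
      [u x - u y - L phi(|x - y|) - m |x - x0|^2]
    has a positive maximum at some [(xb, yb)] ([doubling_max]), and
    [t = |xb - yb|] is small when [L] is large.  Maximality yields three
    inequalities between the increments of [u] at [xb] and at [yb], collected
    in [configuration].

    First, [u] is touched from above at [xb] and from below at [yb] by
    paraboloids, so both equations may be tested there.  By oddness, the linear
    part of a paraboloid does not contribute to the principal value, and on the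
    ball of radius [t^(1+sig)] the rest is a small error ([paraboloid_pv_le],
    [viscosity_touching]).  What remains is to compare the integrals
    over [|z| >= t^(1+sig)] of the nonlinearity [J] applied to the increments.

    Second, on a small cube around [(xb - yb) / 4] the strict concavity of [phi]
    separates the two increments by a multiple of [L t^(gam+alf)], at a height of
    order [L t^gam] ([profile_gain]).  Integrating over the cube gives the gain
    [- L^(p-1) t^g], [g = gam (p-1) - s p + alf (n+1)], up to a factor.

    Third, elsewhere near the origin the increment at [xb] exceeds the one at
    [yb] by at most the drift [m (2 (xb - x0) . z + |z|^2)].  By the mean value
    theorem for [J], the resulting error is of order
    [Lam^(p-2) t^Gx], where [Lam |z|^m], with [m] now an exponent, bounds the
    increments ([nonlocal_error]); the tails contribute a constant.

    If [gam <= s p / (p-1)] and [alf = 0], or if this inequality is strict and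
    [alf] is small, then [g <= 0], so the gain is at least a multiple of [L], and
    all errors of that operator are absorbed for large [L].  The other operator
    also has a gain of the right sign; its errors are either absorbed in the same
    way, or bounded through a Hoelder estimate for [u] that is already known.
    Together the two equations bound [L]
    ([improvement]).

    The lemma [improvement] is used at most three times in a row.  Starting from
    mere boundedness it reaches every [gam < 1] that exceeds neither of the two
    critical exponents ([uniform_hoelder_subcritical]).  Using the critical exponent of the smaller
    one as known regularity, it reaches the larger one, as long as it stays
    below [1] ([uniform_hoelder_between]); and if the larger exceeds [1], a known
    exponent close to [1] gives the Lipschitz bound ([uniform_lipschitz_left]).
    Both the critical exponent itself and [gam = 1] are thus attained.

    Solutions are only Lebesgue measurable.  As the integral is blind to null
    sets, they can be replaced by a Borel function that agrees with them on the
    closed ball ([viscosity_borel]). *)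

Set Implicit Arguments.
Unset Strict Implicit.
Unset Printing Implicit Defensive.

Import Order.TTheory GRing.Theory Num.Theory.
Import numFieldNormedType.Exports.

Local Open Scope classical_set_scope.
Local Open Scope ring_scope.

(** * Real powers and the nonlinearity *)

Section real_powers.
Context {R : realType}.
Implicit Types a b c p r s x y : R.

Lemma ler_powRl r x y : 0 <= r -> 0 <= x -> x <= y -> x `^ r <= y `^ r.
Proof.
by move=> r0 x0 xy; apply: ge0_ler_powR => //; rewrite nnegrE// (le_trans x0).
Qed.

Lemma ler_powRl_neg r x y : r <= 0 -> 0 < x -> x <= y -> y `^ r <= x `^ r.
Proof.
move=> r0 x0 xy; rewrite -[r]opprK !(powRN _ (- r)).
rewrite lef_pV2 ?posrE ?powR_gt0 ?(lt_le_trans x0)//.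
by apply: ler_powRl => //; rewrite ?oppr_ge0// ltW.
Qed.

Lemma powR_le1 r x : 0 <= r -> 0 <= x <= 1 -> x `^ r <= 1.
Proof.
move=> r0 /andP[x0 x1]; have := ler_powRl r0 x0 x1; by rewrite powR1.
Qed.

Lemma powRBn r s x : 0 < x -> x `^ r / x `^ s = x `^ (r - s).
Proof. by move=> x0; rewrite powRB// (gt_eqF x0) implybT. Qed.

Lemma powRDn r s x : 0 < x -> x `^ r * x `^ s = x `^ (r + s).
Proof. by move=> x0; rewrite powRD// (gt_eqF x0) implybT. Qed.

Lemma powR_addl_le r x y : 0 <= r -> 0 <= x -> 0 <= y ->
  (x + y) `^ r <= 2 `^ r * (x `^ r + y `^ r).
Proof.
move=> r0 x0 y0; have [xy|yx] := lerP x y.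
- apply: (@le_trans _ _ ((2 * y) `^ r)); first by apply: ler_powRl; lra.
  by rewrite powRM// ler_wpM2l ?powR_ge0// lerDr powR_ge0.
- apply: (@le_trans _ _ ((2 * x) `^ r)); first by apply: ler_powRl; lra.
  by rewrite powRM// ler_wpM2l ?powR_ge0// lerDl powR_ge0.
Qed.

Lemma powR_amgm a x y : 0 < a < 1 -> 0 <= x -> 0 <= y ->
  x `^ a * y `^ (1 - a) <= a * x + (1 - a) * y.
Proof.
move=> /andP[a0 a1] x0 y0.
have a1' : 0 < 1 - a by rewrite subr_gt0.
have := @conjugate_powR R (x `^ a) (y `^ (1 - a)) a^-1 (1 - a)^-1
  (powR_ge0 _ _) (powR_ge0 _ _).
rewrite !invr_gt0 !invrK -!powRrM !divff ?gt_eqF// !powRr1// => /(_ a0 a1').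
rewrite addrCA subrr addr0 => /(_ erefl) /le_trans; apply.
by rewrite mulrC lerD2l mulrC.
Qed.

Lemma powR_le_tangent a x : 0 <= a <= 1 -> 0 <= x -> x `^ a <= 1 + a * (x - 1).
Proof.
move=> /andP[]; rewrite le_eqVlt => /predU1P[<- _ _|a0].
  by rewrite powRr0 mul0r addr0.
rewrite le_eqVlt => /predU1P[-> x0|a1 x0].
  by rewrite powRr1// mul1r addrC subrK.
have := @powR_amgm a x 1; rewrite a0 a1 powR1 => /(_ isT x0 ler01).
by rewrite mulr1 => /le_trans; apply; lra.
Qed.

(** Bernoulli's inequality, obtained by inverting the concave one. *)
Lemma powR_ge_tangent a x : 1 <= a -> 0 <= x -> 1 + a * (x - 1) <= x `^ a.
Proof.
move=> a1 x0; have a0 : 0 < a by lra.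
have := @powR_le_tangent a^-1 (x `^ a).
rewrite invr_ge0 (ltW a0) invf_le1// a1 -powRrM divff ?gt_eqF// powRr1//.
move=> /(_ isT (powR_ge0 _ _)) => h.
have -> : x `^ a = 1 + a * (a^-1 * (x `^ a - 1)).
  by rewrite mulVKf ?gt_eqF// addrC subrK.
by rewrite lerD2l ler_pM2l//; lra.
Qed.

(** Passes from the square-root deficit of [powR_le_tangent_sqrt] to a quadratic one
    on a bounded range. *)
Lemma sqrt_sub1_sqr_ge x : 0 <= x <= 4 ->
  (x - 1) ^+ 2 / 9 <= (Num.sqrt x - 1) ^+ 2.
Proof.
move=> /andP[x0 x3].
have s0 := sqrtr_ge0 x; have sq := sqr_sqrtr x0.
have s2 : Num.sqrt x <= 2.
  by rewrite -(ler_pXn2r (n := 2)) ?nnegrE// sq; lra.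
have -> : (x - 1) ^+ 2 = (Num.sqrt x - 1) ^+ 2 * (Num.sqrt x + 1) ^+ 2.
  by rewrite -{1}sq; ring.
rewrite -mulrA ler_piMr ?sqr_ge0// ler_pdivrMr// mul1r.
by nra.
Qed.

(** Strict concavity without derivatives.  For [a <= 1/2] the tangent inequality
    with the exponent [2 a] at [sqrt x] already contains the square; for
    [a > 1/2], [x^a] is a weighted geometric mean of [x] and [sqrt x]. *)
Lemma powR_le_tangent_sqrt a x : 0 < a < 1 -> 0 <= x ->
  x `^ a <= 1 + a * (x - 1) - Num.min a (1 - a) * (Num.sqrt x - 1) ^+ 2.
Proof.
move=> /andP[a0 a1] x0.
have s0 := sqrtr_ge0 x; have sq := sqr_sqrtr x0.
have [al|al] := lerP a (1 - a).
  have := @powR_le_tangent (2 * a) (Num.sqrt x).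
  rewrite -powR12_sqrt// -powRrM mulrA mulVf// mul1r.
  have -> : 0 <= 2 * a <= 1 by apply/andP; split; lra.
  move=> /(_ isT (powR_ge0 _ _)); rewrite powR12_sqrt// => /le_trans; apply.
  by rewrite -{2}sq; lra.
have [a12|a12] := eqVneq a (2^-1); first by lra.
have [->|xn0] := eqVneq x 0.
  by rewrite powR0 ?gt_eqF// sqrtr0; lra.
have xp : 0 < x by rewrite lt_neqAle eq_sym xn0.
have := @powR_amgm (2 * a - 1) x (Num.sqrt x).
have -> : 0 < 2 * a - 1 < 1 by apply/andP; split; lra.
move=> /(_ isT x0 s0).
rewrite -{1}powR12_sqrt// -powRrM powRDn//.
have -> : 2 * a - 1 + 2^-1 * (1 - (2 * a - 1)) = a by field.
move=> /le_trans; apply.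
by move: sq s0; set t := Num.sqrt x => <- t0; lra.
Qed.

Lemma powR_le_tangent_sqr a x : 0 < a < 1 -> 0 <= x <= 4 ->
  x `^ a <= 1 + a * (x - 1) - Num.min a (1 - a) / 9 * (x - 1) ^+ 2.
Proof.
move=> /[dup] a01 /andP[a0 a1] /[dup] x01 /andP[x0 x1].
apply: le_trans (powR_le_tangent_sqrt a01 x0) _.
rewrite lerD2l lerN2 mulrAC -mulrA ler_wpM2l//; last exact: sqrt_sub1_sqr_ge.
by rewrite le_min; apply/andP; split; lra.
Qed.

(** The concave case for the exponent [1/b] at the point [x^b]. *)
Lemma powR_ge_tangent_sqr b x : 1 < b -> 0 <= x <= 4 ->
  1 + b * (x - 1) + Num.min 1 (b - 1) / 9 * (x - 1) ^+ 2 <= x `^ b.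
Proof.
move=> b1 /[dup] x01 /andP[x0 x1]; have b0 : 0 < b by lra.
have bi : 0 < b^-1 < 1 by rewrite invr_gt0 b0 invf_lt1.
have := powR_le_tangent_sqrt bi (powR_ge0 x b).
rewrite -{1}powRrM divff ?gt_eqF// powRr1//; set y := x `^ b => h.
have yE : y = 1 + b * (b^-1 * (y - 1)).
  by rewrite mulVKf ?gt_eqF// addrC subrK.
have bm : Num.min 1 (b - 1) = b * Num.min b^-1 (1 - b^-1).
  by rewrite minr_pMr ?ltW// mulrBr mulr1 divff// gt_eqF.
have m0 : 0 <= Num.min 1 (b - 1) by rewrite le_min ler01 subr_ge0 ltW.
have sqm : (x - 1) ^+ 2 / 9 <= (Num.sqrt y - 1) ^+ 2.
  apply: le_trans (sqrt_sub1_sqr_ge x01) _.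
  have [x1l|x1l] := lerP 1 x.
    have xy : Num.sqrt x <= Num.sqrt y by rewrite ler_wsqrtr// le1r_powR// ltW.
    have : 1 <= Num.sqrt x by rewrite -{1}sqrtr1 ler_wsqrtr.
    by nra.
  have xy : Num.sqrt y <= Num.sqrt x.
    rewrite ler_wsqrtr// /y; have [->|xn0] := eqVneq x 0.
      by rewrite powR0 ?gt_eqF.
    by rewrite ge1r_powR// ?(ltW b1)// lt_neqAle eq_sym xn0 x0 (ltW x1l).
  have : Num.sqrt x <= 1 by rewrite -{1}sqrtr1 ler_wsqrtr// ltW.
  by nra.
have h2 := ler_wpM2l m0 sqm.
have h1 := ler_wpM2l (ltW b0) h.
rewrite -mulrA [_^-1 * _]mulrC.
rewrite [leRHS]yE -addrA lerD2l.
apply: le_trans (lerD (lexx _) h2) _; rewrite bm -mulrA -mulrDr.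
by rewrite (ler_pM2l b0); lra.
Qed.

End real_powers.

(** The nonlinearity of the fractional [p]-Laplacian. *)
Definition signed_power {R : realType} (p x : R) : R := `|x| `^ (p - 2) * x.

Section signed_power.
Context {R : realType}.
Implicit Types p A B M x b delta : R.
Local Notation J p := (signed_power p).

Lemma signed_powerN p x : J p (- x) = - J p x.
Proof. by rewrite /signed_power normrN mulrN. Qed.

Lemma signed_power_ge0E p x : 2 <= p -> 0 <= x -> J p x = x `^ (p - 1).
Proof.
move=> p2 x0; rewrite /signed_power ger0_norm// mulrC.
have -> : p - 2 = p - 1 - 1 by ring.
by rewrite mulr_powRB1//; lra.
Qed.

Lemma normr_signed_power p x : 2 <= p -> `|J p x| = `|x| `^ (p - 1).
Proof.
move=> p2; rewrite /signed_power normrM norm_powR// normr_id.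
have := signed_power_ge0E p2 (normr_ge0 x).
by rewrite /signed_power normr_id.
Qed.

Lemma signed_power_ge0 p x : 0 <= x -> 0 <= J p x.
Proof. by move=> x0; rewrite mulr_ge0// powR_ge0. Qed.

Lemma le_signed_power p A B : 2 <= p -> A <= B -> J p A <= J p B.
Proof.
move=> p2 AB; have [A0|A0] := lerP 0 A.
  rewrite !signed_power_ge0E ?(le_trans A0)//.
  by apply: ler_powRl => //; lra.
have [B0|B0] := lerP 0 B.
  apply: le_trans (signed_power_ge0 p B0).
  by rewrite -oppr_ge0 -signed_powerN signed_power_ge0//; lra.
rewrite -lerN2 -!signed_powerN.
rewrite !signed_power_ge0E//; [|lra|lra].
by apply: ler_powRl; lra.
Qed.

Let sub_le_pos p A B M : 2 <= p -> 0 <= B -> B <= A -> A <= M ->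
  J p A - J p B <= (p - 1) * M `^ (p - 2) * (A - B).
Proof.
move=> p2 B0 BA AM; rewrite !signed_power_ge0E//; last exact: le_trans BA.
have [A0|A0] := eqVneq A 0.
  have -> : B = A by lra.
  by rewrite !subrr mulr0.
have Ap : 0 < A by rewrite lt_neqAle eq_sym A0 (le_trans B0).
have h := @powR_ge_tangent _ (p - 1) (B / A).
have /h {}h : 1 <= p - 1 by lra.
have /h {}h : 0 <= B / A by rewrite divr_ge0// ltW.
have {h} := ler_wpM2l (powR_ge0 A (p - 1)) h.
rewrite -[A `^ _ * (B / A) `^ _]powRM ?divr_ge0// ?(ltW Ap)//.
rewrite [A * (B / A)]mulrCA divff// mulr1.
have E : A `^ (p - 1) = A * A `^ (p - 2).
  have -> : p - 2 = p - 1 - 1 by ring.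
  by rewrite mulr_powRB1//; lra.
rewrite {1}E => h.
have h2 : A * A `^ (p - 2) * (1 + (p - 1) * (B / A - 1)) =
    A * A `^ (p-2) - (p - 1) * A `^ (p - 2) * (A - B) by field.
rewrite h2 -E in h.
apply: (@le_trans _ _ ((p - 1) * A `^ (p - 2) * (A - B))); first lra.
rewrite ler_wpM2r ?subr_ge0// ler_wpM2l//; first lra.
by apply: ler_powRl; lra.
Qed.

(** A mean value inequality.  For increments of one sign it is Bernoulli's
    inequality with the exponent [p - 1]; otherwise the two terms are estimated
    separately. *)
Lemma signed_power_sub_le p A B M : 2 <= p -> B <= A -> `|A| <= M -> `|B| <= M ->
  J p A - J p B <= (p - 1) * M `^ (p - 2) * (A - B).
Proof.
move=> p2 BA; rewrite !ler_norml => /andP[A1 A2] /andP[B1 B2].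
have [B0|B0] := lerP 0 B; first exact: sub_le_pos.
have [A0|A0] := lerP A 0.
  have := @sub_le_pos p (- B) (- A) M p2; rewrite !signed_powerN !opprK.
  rewrite [- B + A]addrC [- J p B + _]addrC; apply; lra.
have M0 : 0 <= M by lra.
have Mp := powR_ge0 M (p - 2).
have HA : J p A <= M `^ (p - 2) * A.
  by rewrite ler_wpM2r ?(ltW A0)// ler_powRl//; [lra|rewrite ler_norml; lra].
have HB : - J p B <= M `^ (p - 2) * - B.
  rewrite /signed_power -mulrN ler_wpM2r//; first lra.
  by rewrite ler_powRl//; [lra|rewrite ler_norml; lra].
apply: (@le_trans _ _ (1 * M `^ (p - 2) * (A - B))); first lra.
rewrite ler_wpM2r ?subr_ge0// ler_wpM2r//; lra.
Qed.

(** Quantifies the monotonicity away from the degenerate point [0]: the height [b]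
    enters through the factor [b^(p-2)]. *)
Lemma signed_power_sub_gain p A B b delta : 2 <= p ->
  0 <= delta -> delta <= b -> b <= B -> A <= B - delta ->
  J p A - J p B <= - (b `^ (p - 2) * delta).
Proof.
move=> p2 d0 db bB AB.
have /(le_signed_power p2) h := AB.
apply: (@le_trans _ _ (J p (B - delta) - J p B)); first lra.
rewrite /signed_power ger0_norm; last lra.
rewrite ger0_norm; last lra.
have h1 : (B - delta) `^ (p - 2) <= B `^ (p - 2) by apply: ler_powRl; lra.
have h2 : b `^ (p - 2) <= B `^ (p - 2) by apply: ler_powRl; lra.
have h3 : (B - delta) `^ (p - 2) * (B - delta) <= B `^ (p - 2) * (B - delta).
  by rewrite ler_wpM2r//; lra.
have h4 : b `^ (p - 2) * delta <= B `^ (p - 2) * delta by rewrite ler_wpM2r.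
lra.
Qed.

Lemma normr_signed_power_sub_le p A B : 2 <= p ->
  `|J p (A - B)| <= 2 `^ (p - 1) * (`|A| `^ (p - 1) + `|B| `^ (p - 1)).
Proof.
move=> p2; rewrite normr_signed_power//; apply: (@le_trans _ _ ((`|A| + `|B|) `^ (p - 1))).
  by apply: ler_powRl => //; [lra|exact: ler_normB].
by apply: powR_addl_le => //; lra.
Qed.

End signed_power.

(** * Euclidean norm and Lebesgue measure on R^n *)

Definition edot {R : realType} {n : nat} (x y : 'rV[R]_n) : R :=
  \sum_(i < n) x ord0 i * y ord0 i.

Section euclidean_norm.
Context {R : realType} {n : nat}.
Implicit Types (x y z : 'rV[R]_n) (c b : R).

Lemma enorm_sqr x : enorm x ^+ 2 = edot x x.
Proof.
rewrite sqr_sqrtr; last by apply: sumr_ge0 => i _; rewrite sqr_ge0.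
by apply: eq_bigr => i _; rewrite expr2.
Qed.

Lemma enorm_ge0 x : 0 <= enorm x. Proof. exact: sqrtr_ge0. Qed.

Lemma edotC x y : edot x y = edot y x.
Proof. by apply: eq_bigr => i _; rewrite mulrC. Qed.

Lemma edotDl x y z : edot (x + y) z = edot x z + edot y z.
Proof. by rewrite -big_split; apply: eq_bigr => i _; rewrite mxE mulrDl. Qed.

Lemma edotZl c x y : edot (c *: x) y = c * edot x y.
Proof. by rewrite mulr_sumr; apply: eq_bigr => i _; rewrite mxE mulrA. Qed.

Lemma edotDr x y z : edot z (x + y) = edot z x + edot z y.
Proof. by rewrite !(edotC z) edotDl. Qed.

Lemma edotZr c x y : edot x (c *: y) = c * edot x y.
Proof. by rewrite !(edotC x) edotZl. Qed.

Lemma edotNr x y : edot x (- y) = - edot x y.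
Proof. by rewrite -scaleN1r edotZr mulN1r. Qed.

Lemma edotNl x y : edot (- x) y = - edot x y.
Proof. by rewrite -scaleN1r edotZl mulN1r. Qed.

Lemma enorm_le_sqr x c : 0 <= c -> edot x x <= c ^+ 2 -> enorm x <= c.
Proof.
by move=> c0 h; rewrite -(ler_pXn2r (n := 2)) ?nnegrE ?enorm_ge0// enorm_sqr.
Qed.

Lemma enormN x : enorm (- x) = enorm x.
Proof. by rewrite /enorm; congr Num.sqrt; apply: eq_bigr => i _; rewrite mxE sqrrN. Qed.

Lemma enormB x y : enorm (x - y) = enorm (y - x).
Proof. by rewrite -enormN opprB. Qed.

Lemma enormZ c x : enorm (c *: x) = `|c| * enorm x.
Proof.
apply/eqP; rewrite -(eqrXn2 (n := 2)) ?mulr_ge0 ?enorm_ge0//.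
by rewrite exprMn !enorm_sqr edotZl edotZr mulrA -expr2 real_normK ?num_real.
Qed.

Lemma enorm0 : enorm (0 : 'rV[R]_n) = 0.
Proof. by rewrite -(scale0r (0 : 'rV[R]_n)) enormZ normr0 mul0r. Qed.

Lemma ler_coord_enorm x i : `|x ord0 i| <= enorm x.
Proof.
rewrite -(ler_pXn2r (n := 2)) ?nnegrE ?enorm_ge0// enorm_sqr real_normK ?num_real//.
rewrite /edot (bigD1 i)//= expr2 lerDl.
by apply: sumr_ge0 => j _; rewrite -expr2 sqr_ge0.
Qed.

Lemma enorm_eq0 x : (enorm x == 0) = (x == 0).
Proof.
apply/eqP/eqP => [x0|->]; last exact: enorm0.
apply/rowP => i; rewrite mxE; apply/eqP; rewrite -normr_le0 -x0.
exact: ler_coord_enorm.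
Qed.

Lemma enorm_gt0 x : (0 < enorm x) = (x != 0).
Proof. by rewrite lt_neqAle enorm_ge0 andbT eq_sym enorm_eq0. Qed.

Lemma enorm_le_coord x b : 0 <= b -> (forall i, `|x ord0 i| <= b) ->
  enorm x <= n%:R * b.
Proof.
move=> b0 xb; have [n0|n0] := eqVneq n 0%N.
  rewrite /enorm big1 ?sqrtr0 ?mulr_ge0// => -[i Hi]; exfalso.
  by move: Hi; rewrite n0.
apply: enorm_le_sqr; first by rewrite mulr_ge0.
apply: (@le_trans _ _ (\sum_(i < n) b ^+ 2)).
  apply: ler_sum => i _; rewrite -expr2 -(real_normK (num_real _)).
  by rewrite ler_pXn2r ?nnegrE.
rewrite sumr_const card_ord -[leLHS]mulr_natl exprMn ler_wpM2r ?sqr_ge0//.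
by rewrite expr2 ler_peMl// ler1n lt0n.
Qed.

Lemma edot_le x y : edot x y <= enorm x * enorm y.
Proof.
have [x0|x0] := eqVneq x 0.
  rewrite x0 enorm0 mul0r /edot big1// => i _; by rewrite mxE mul0r.
have nx : 0 < enorm x by rewrite enorm_gt0.
have : 0 <= edot (enorm y *: x - enorm x *: y) (enorm y *: x - enorm x *: y).
  by rewrite -enorm_sqr sqr_ge0.
rewrite !(edotDl, edotDr, edotNl, edotNr, edotZl, edotZr) -!enorm_sqr.
rewrite (edotC y x); set a := enorm x; set b := enorm y; set d := edot x y.
have [y0|y0] := eqVneq y 0.
  rewrite /d /b y0 enorm0 mulr0 /edot big1// => i _; by rewrite mxE mulr0.
have nb : 0 < b by rewrite enorm_gt0.
set e := (X in 0 <= X); have -> : e = 2 * (a * b) * (a * b - d).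
  by rewrite /e; ring.
by rewrite pmulr_rge0 ?subr_ge0// !mulr_gt0.
Qed.

Lemma normr_edot_le x y : `|edot x y| <= enorm x * enorm y.
Proof.
by rewrite ler_norml edot_le andbT lerNl -edotNl -(enormN x) edot_le.
Qed.

Lemma enormD_sqr x y :
  enorm (x + y) ^+ 2 = enorm x ^+ 2 + 2 * edot x y + enorm y ^+ 2.
Proof. by rewrite !enorm_sqr edotDl !edotDr (edotC y x); ring. Qed.

Lemma ler_enormD x y : enorm (x + y) <= enorm x + enorm y.
Proof.
rewrite -(ler_pXn2r (n := 2)) ?nnegrE ?addr_ge0 ?enorm_ge0// enormD_sqr.
by have := edot_le x y; lra.
Qed.

Lemma ler_dist_enorm x y : `|enorm x - enorm y| <= enorm (x - y).
Proof.
have h1 := ler_enormD (x - y) y; have h2 := ler_enormD (y - x) x.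
rewrite !subrK (enormB y) in h1 h2.
by rewrite ler_norml; apply/andP; split; lra.
Qed.

End euclidean_norm.

Section euclidean_topology.
Context {R : realType} {n : nat}.
Implicit Types (x y z : 'rV[R]_n).

Lemma coord_le_mx_norm x i : `|x ord0 i| <= `|x|.
Proof.
rewrite [leRHS]/Num.norm/= mx_normrE.
by apply: (le_bigmax _ (fun ij => `|x ij.1 ij.2|) (ord0, i)).
Qed.

Lemma enorm_le_mx_norm x : enorm x <= n%:R * `|x|.
Proof. by apply: enorm_le_coord => // i; exact: coord_le_mx_norm. Qed.

Lemma mx_norm_le_enorm x : `|x| <= enorm x.
Proof.
rewrite [leLHS]/Num.norm/= mx_normrE; apply: bigmax_le; first exact: enorm_ge0.
by move=> [i j] _ /=; rewrite (ord1 i) ler_coord_enorm.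
Qed.

Lemma continuous_enorm : continuous (@enorm R n).
Proof.
move=> x; apply/(@cvgrPdist_lt _ _ _ (nbhs x) (nbhs_filter x)) => e e0.
near=> y; apply: le_lt_trans (ler_dist_enorm _ _) _.
apply: le_lt_trans (enorm_le_mx_norm _) _.
apply: (@le_lt_trans _ _ (n.+1%:R * `|x - y|)).
  by rewrite ler_wpM2r// ler_nat.
rewrite -ltr_pdivlMl//.
near: y; apply: cvgr_dist_lt => //; by rewrite mulr_gt0// invr_gt0.
Unshelve. all: by end_near. Qed.

End euclidean_topology.

Section measurability.
Context {R : realType} {n : nat}.

Lemma measurable_edot (c : 'rV[R]_n) :
  measurable_fun setT (fun v => edot c v : measurableTypeR R).
Proof.
apply: (@measurable_sum _ _ R setT _ (index_enum 'I_n)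
  (fun i (v : 'rV[R]_n) => c ord0 i * v ord0 i)) => i.
by apply: measurable_funM => //; exact: measurable_coord.
Qed.

Lemma measurable_enorm : measurable_fun setT (@enorm R n).
Proof.
rewrite (_ : @enorm R n = (fun t => t `^ (2^-1)) \o
   (fun v : 'rV[R]_n => \sum_(i < n) v ord0 i ^+ 2)); last first.
  apply/funext => v /=; rewrite powR12_sqrt// sumr_ge0// => i _.
  exact: sqr_ge0.
apply: measurableT_comp; first exact: measurable_powR.
apply: (@measurable_sum _ _ R setT _ (index_enum 'I_n)
  (fun i (v : 'rV[R]_n) => v ord0 i ^+ 2)) => i.
by apply: measurable_funX; exact: measurable_coord.
Qed.

Lemma measurable_addv (x : 'rV[R]_n) :
  measurable_fun setT (fun z : 'rV[R]_n => x + z).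
Proof.
apply: measurable_fun_rV => i.
rewrite (_ : (fun _ => _) = (fun v : 'rV[R]_n => x ord0 i + v ord0 i)).
  by apply: measurable_funD => //; exact: measurable_coord.
by apply/funext => z; rewrite mxE.
Qed.

Lemma measurable_oppv : measurable_fun setT (fun z : 'rV[R]_n => - z).
Proof.
apply: measurable_fun_rV => i.
rewrite (_ : (fun _ => _) = (fun v : 'rV[R]_n => - v ord0 i)).
  by apply: measurableT_comp => //; exact: measurable_coord.
by apply/funext => z; rewrite mxE.
Qed.

Definition box (a b : 'rV[R]_n) : set 'rV[R]_n :=
  [set z | forall i, a ord0 i <= z ord0 i <= b ord0 i].

Lemma measurable_box a b : measurable (box a b).
Proof.
rewrite (_ : box a b = \bigcap_(i in [set: 'I_n])
   ((fun v : 'rV[R]_n => v ord0 i : measurableTypeR R) @^-1` `[a ord0 i, b ord0 i])).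
  apply: fin_bigcap_measurable => // i _.
  by rewrite -[X in measurable X]setTI; apply: measurable_coord.
apply/seteqP; split => [z h i _ /=|z h i]; first by rewrite in_itv/= h.
by have /= := h i I; rewrite in_itv.
Qed.

(** Countably many rational boxes exhaust an open set. *)
Lemma open_measurable_rV (U : set 'rV[R]_n) : open U -> measurable U.
Proof.
move=> oU.
pose bx (c : 'rV[rat]_n * nat) : set 'rV[R]_n :=
  box (\row_i (ratr (c.1 ord0 i) - c.2.+1%:R^-1))
      (\row_i (ratr (c.1 ord0 i) + c.2.+1%:R^-1)).
have -> : U = \bigcup_(c in [set c | bx c `<=` U]) bx c.
  apply/seteqP; split => [x Ux|x [c cU cx]]; last exact: cU.
  have /nbhs_ballP[e /= e0 eU] : nbhs x U by exact: open_nbhs_nbhs.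
  have [k ke] : exists k, 2 * k.+1%:R^-1 < e.
    have e20 : 0 < e / 2 by rewrite divr_gt0.
    have [k _ /(_ _ (leqnn _))] := near_infty_natSinv_lt (PosNum e20).
    by move=> h; exists k; rewrite mulrC -ltr_pdivlMr.
  have kx i : x ord0 i - k.+1%:R^-1 < x ord0 i + k.+1%:R^-1.
    by rewrite ltrBlDr -addrA ltrDl addr_gt0// invr_gt0.
  pose c : 'rV[rat]_n := \row_i
    sval (cid (@rat_in_itvoo R (x ord0 i - k.+1%:R^-1) (x ord0 i + k.+1%:R^-1)
      (kx i))).
  have ck i : `|x ord0 i - ratr (c ord0 i)| <= k.+1%:R^-1.
    rewrite mxE; case: cid => q /=; rewrite in_itv/= => /andP[h1 h2].
    rewrite ler_norml; move: (k.+1%:R^-1) h1 h2 => w h1 h2.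
    by apply/andP; split; lra.
  exists (c, k).
    move=> y /= yc; apply: eU; split=> // i j.
    rewrite (_ : i = ord0); last exact: ord1.
    have := yc j; have := ck j; rewrite !mxE ler_norml => /andP[h1 h2] /andP[h3 h4].
    rewrite /ball/= ltr_norml; move: ke h1 h2 h3 h4 => /=.
    move: (ratr _ : R) => rr; move: (k.+1%:R^-1) => w *; apply/andP; split; lra.
  move=> i; have := ck i; rewrite !mxE ler_norml => /andP[].
  move: (ratr _ : R) => rr /=; move: (k.+1%:R^-1) => w *.
  by apply/andP; split; lra.
rewrite bigcup_mkcond; apply: countable_bigcupT_measurable => [//|c].
by case: ifPn => // _; exact: measurable_box.
Qed.

Lemma subspace_continuous_measurable_fun_rV (D : set 'rV[R]_n)
    (f : 'rV[R]_n -> R) :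
  measurable D -> {within D, continuous f} -> measurable_fun D f.
Proof.
move=> mD /continuousP cf; apply: (measurability _ (RGenOpens.measurableE R)).
move=> _ [_ [a [b ->] <-]].
have oab : open (`]a, b[%classic : set R) by exact: interval_open.
have /(@open_subspaceP _ D)[V oV VE] := cf _ oab.
rewrite setIC -VE; apply: measurableI => //; exact: open_measurable_rV.
Qed.

End measurability.

Section row_cons.
Context {R : realType} {m : nat}.

(** The identification of [R^m * R] with [R^(m+1)] in the definition of
    [lebesgue_rV]. *)
Definition row_cons (z : 'rV[R]_m * measurableTypeR R) : 'rV[R]_m.+1 :=
  row_mx (const_mx z.2 : 'rV[R]_1) z.1.

Lemma row_cons0 z : row_cons z ord0 ord0 = z.2.
Proof.
have E : @ord0 m = lshift m (@ord0 0) by exact: val_inj.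
by rewrite /row_cons E (row_mxEl (const_mx z.2 : 'rV_1)) mxE.
Qed.

Lemma row_consS z i : row_cons z ord0 (lift ord0 i) = z.1 ord0 i.
Proof.
have E : lift ord0 i = rshift 1 i by exact: val_inj.
by rewrite /row_cons E (row_mxEr (const_mx z.2 : 'rV_1)).
Qed.

End row_cons.

(** Translations and the central symmetry both act on each coordinate separately,
    so that one induction on the dimension, whose step is Tonelli's theorem,
    covers them. *)
Lemma lebesgue_rV_preserved {R : realType} (n : nat)
    (g : 'I_n -> measurableTypeR R -> measurableTypeR R)
    (mg : forall i, measurable_fun setT (g i))
    (pg : forall i A, measurable A -> lebesgue_measure (g i @^-1` A) =
       lebesgue_measure A :> \bar R)
    (A : set 'rV[R]_n) : measurable A ->
  lebesgue_rV n ((fun z : 'rV[R]_n => \row_i g i (z ord0 i)) @^-1` A) =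
  lebesgue_rV n A.
Proof.
elim: n g mg pg A => [|n IH] g mg pg A mA.
  congr lebesgue_rV; apply/funext => z /=; congr A.
  by apply/rowP => -[].
pose G (v : 'rV[R]_n) : 'rV[R]_n := \row_i g (lift ord0 i) (v ord0 i).
have mG : measurable_fun setT G.
  apply: measurable_fun_rV => i.
  rewrite (_ : (fun _ => _) = g (lift ord0 i) \o
    (fun v : 'rV[R]_n => v ord0 i : measurableTypeR R)); last first.
    by apply/funext => v; rewrite /= mxE.
  by apply: measurableT_comp => //; exact: measurable_coord.
have mFA : measurable (row_cons @^-1` A).
  by rewrite -[X in measurable X]setTI; exact: measurable_row_mx.
have gE v t : \row_i g i (row_cons (v, t) ord0 i) = row_cons (G v, g ord0 t).
  apply/rowP => i; rewrite mxE; case: (unliftP ord0 i) => [j|] ->.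
    by rewrite !row_consS mxE.
  by rewrite !row_cons0.
rewrite [LHS]/= [RHS]/= /pushforward /product_measure1.
transitivity (\int[lebesgue_rV n]_v
    ((lebesgue_measure \o xsection (row_cons @^-1` A)) \o G) v)%E.
  apply: eq_integral => v _ /=.
  rewrite -(pg ord0 (xsection (row_cons @^-1` A) (G v))).
    congr (lebesgue_measure _); apply/funext => t.
    by rewrite /xsection/= /preimage/= !inE/= -gE.
  exact: measurable_xsection.
transitivity (\int[pushforward (lebesgue_rV n) G]_v
    (lebesgue_measure \o xsection (row_cons @^-1` A)) v)%E.
  by rewrite ge0_integral_pushforward ?preimage_setT//; exact: measurable_fun_xsection.
apply: eq_measure_integral => // B mB.
by move=> _; exact: (IH (fun i => g (lift ord0 i)) (fun i => mg _) (fun i => pg _) B mB).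
Qed.

Section invariance.
Context {R : realType} {n : nat}.
Local Notation mu := (@lebesgue_rV R n).

Lemma lebesgue_measure_shift (c : R) (A : set (measurableTypeR R)) :
  measurable A -> lebesgue_measure ((fun t => c + t) @^-1` A) =
    lebesgue_measure A :> \bar R.
Proof.
move=> mA.
have mc : measurable_fun setT (fun t : measurableTypeR R => c + t).
  by apply: measurable_funD.
apply/esym.
apply: (@lebesgue_measure_unique _ (pushforward lebesgue_measure
   (fun t : measurableTypeR R => c + t : measurableTypeR R))) => //= _ [[a b]] _ <-.
rewrite /pushforward.
have -> : (fun t => c + t) @^-1` `]a, b] = `]a - c, b - c]%classic.
  apply/seteqP; split => t /=; rewrite !in_itv/=; lra.
rewrite !lebesgue_measure_itv/= !lte_fin ltrD2r.
by case: ifP => // _; rewrite -!EFinB; congr EFin; lra.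
Qed.

Lemma lebesgue_rV_shift (x : 'rV[R]_n) A : measurable A ->
  pushforward mu (fun z => x + z) A = mu A.
Proof.
move=> mA; rewrite -[RHS](@lebesgue_rV_preserved _ _ (fun i t => x ord0 i + t))//.
- set f := (fun z => \row_i _); rewrite (_ : f = (fun z => x + z))//.
  by apply/funext => z; apply/rowP => i; rewrite !mxE.
- by move=> i; apply: measurable_funD.
- by move=> i B mB; exact: lebesgue_measure_shift.
Qed.

Lemma lebesgue_rV_opp A : measurable A ->
  pushforward mu (fun z : 'rV[R]_n => - z) A = mu A.
Proof.
move=> mA; rewrite -[RHS](@lebesgue_rV_preserved _ _ (fun i t => - t))//.
- set f := (fun z => \row_i _); rewrite (_ : f = -%R)//.
  by apply/funext => z; apply/rowP => i; rewrite !mxE.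
- by move=> i; apply: measurableT_comp.
- by move=> i B mB; exact: lebesgue_measureN.
Qed.

End invariance.

Lemma lebesgue_rV_cube {R : realType} (n : nat) (a : 'rV[R]_n) (l : R) :
  0 <= l -> lebesgue_rV n (box a (a + const_mx l)) = (l ^+ n)%:E.
Proof.
elim: n a => [|n IH] a l0.
  rewrite /= diracE mem_set ?expr0//; by case.
rewrite /= /pushforward.
pose a' : 'rV[R]_n := \row_i a ord0 (lift ord0 i).
rewrite (_ : _ @^-1` _ = row_cons @^-1` box a (a + const_mx l))//.
have -> : row_cons @^-1` box a (a + const_mx l) =
    box a' (a' + const_mx l) `*` `[a ord0 ord0, a ord0 ord0 + l]%classic.
  apply/seteqP; split => -[v t] /=.
    move=> h; split.
      by move=> i; have := h (lift ord0 i); rewrite row_consS !mxE.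
    by have := h ord0; rewrite row_cons0 !mxE in_itv.
  rewrite in_itv/= => -[h1 h2] i; case: (unliftP ord0 i) => [j|] ->.
    by have := h1 j; rewrite row_consS !mxE.
  by rewrite row_cons0 !mxE.
rewrite product_measure1E; [|exact: measurable_box|exact: measurable_itv].
rewrite exprSr EFinM; congr (_ * _)%E; first exact: IH.
rewrite [LHS](@lebesgue_measure_itv R `[a ord0 ord0, a ord0 ord0 + l]) /= lte_fin ltrDl.
case: ltP => [_|l0']; first by rewrite -EFinB; congr EFin; lra.
by congr EFin; apply/eqP; rewrite eq_le l0 l0'.
Qed.

(** * Integrals of powers of the norm *)

Definition shell {R : realType} (n : nat) (a b : R) : set 'rV[R]_n :=
  [set z | a < enorm z <= b].

Definition outside {R : realType} (n : nat) (a : R) : set 'rV[R]_n :=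
  [set z | a < enorm z].

Arguments shell {R} n a b _.
Arguments outside {R} n a _.

Section power_integrals.
Context {R : realType} {n : nat}.
Local Notation mu := (@lebesgue_rV R n).
Implicit Types (a b r e x beta : R).

Lemma measurable_enorm_preimage (A : set R) : measurable (A : set (measurableTypeR R)) ->
  measurable (@enorm R n @^-1` A).
Proof. by move=> mA; rewrite -[X in measurable X]setTI; exact: measurable_enorm. Qed.

Lemma measurable_shell a b : measurable (@shell R n a b).
Proof.
rewrite (_ : shell _ _ _ = @enorm R n @^-1` `]a, b]).
  exact: measurable_enorm_preimage.
by apply/seteqP; split => z; rewrite /shell/= in_itv.
Qed.

Lemma measurable_outside a : measurable (@outside R n a).
Proof.
rewrite (_ : outside _ _ = @enorm R n @^-1` `]a, +oo[).
  exact: measurable_enorm_preimage.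
by apply/seteqP; split => z; rewrite /outside/= in_itv/= andbT.
Qed.

Lemma measurable_enorm_powR e : measurable_fun setT (fun z : 'rV[R]_n => enorm z `^ e).
Proof.
apply: (measurableT_comp (f := (@powR R ^~ e))); first exact: measurable_powR.
exact: measurable_enorm.
Qed.

Lemma lebesgue_rV_ball_le r : 0 <= r ->
  (mu [set z | (enorm z <= r)%R] <= ((2 * r) ^+ n)%:E)%E.
Proof.
move=> r0; rewrite -(@lebesgue_rV_cube R n (const_mx (- r))); last by rewrite mulr_ge0.
apply: le_measure; rewrite ?inE.
- rewrite (_ : [set z | _] = @enorm R n @^-1` `]-oo, r]).
    exact: measurable_enorm_preimage.
  by apply/seteqP; split => z /=; rewrite in_itv.
- exact: measurable_box.
move=> z /= zr i; have := le_trans (ler_coord_enorm z i) zr.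
rewrite ler_norml !mxE; lra.
Qed.

Lemma powR_half_shell e r x : 0 < r -> r / 2 < x <= r ->
  x `^ e <= 2 `^ `|e| * r `^ e.
Proof.
move=> r0 /andP[x1 x2]; have x0 : 0 < x by apply: lt_trans x1; rewrite divr_gt0.
have [e0|e0] := lerP 0 e.
  apply: (@le_trans _ _ (r `^ e)); first by rewrite ler_powRl// ltW.
  rewrite ler_peMl ?powR_ge0//.
  by have := @ler_powR R 2 (ler1n _ _) 0 `|e| (normr_ge0 e); rewrite powRr0.
have h : x `^ e <= (r / 2) `^ e.
  by apply: ler_powRl_neg; rewrite ?divr_gt0// ltW.
apply: le_trans h _; rewrite powRM ?invr_ge0 ?(ltW r0)//.
by rewrite ltr0_norm// mulrC -powR_inv1 ?ler0n// -powRrM mulN1r.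
Qed.

(** On a dyadic shell a power of the norm is comparable to that of the outer
    radius, so that an upper bound for the volume of balls suffices and polar
    coordinates are avoided. *)
Lemma half_shell_integral_le e r : 0 < r ->
  (\int[mu]_(z in shell n (r / 2) r) (enorm z `^ e)%:E <=
     (2 `^ `|e| * 2 ^+ n * r `^ (e + n%:R))%:E)%E.
Proof.
move=> r0.
apply: (@le_trans _ _ (\int[mu]_(z in shell n (r / 2) r)
    (2 `^ `|e| * r `^ e)%:E)%E).
  apply: ge0_le_integral => //=.
  - exact: measurable_shell.
  - by move=> z _; rewrite lee_fin powR_ge0.
  - by apply/measurable_EFinP; apply: measurable_funTS; exact: measurable_enorm_powR.
  - by move=> z /= zr; rewrite lee_fin powR_half_shell.
rewrite integral_cst; last exact: measurable_shell.
have := @lebesgue_rV_ball_le r (ltW r0); set w := (X in (_ <= X)%E) => hw.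
have hs : (mu (shell n (r / 2) r) <= w)%E.
  apply: le_trans hw; apply: le_measure; rewrite ?inE.
  - exact: measurable_shell.
  - rewrite (_ : [set z | _] = @enorm R n @^-1` `]-oo, r]).
      exact: measurable_enorm_preimage.
    by apply/seteqP; split => z /=; rewrite in_itv.
  by move=> z /andP[].
apply: le_trans (lee_pmul _ _ (lexx _) hs) _ => //.
  by rewrite lee_fin mulr_ge0 ?powR_ge0.
rewrite /w -EFinM lee_fin exprMn -!mulrA ler_wpM2l ?powR_ge0//.
rewrite mulrCA ler_wpM2l ?exprn_ge0//.
by rewrite -powR_mulrn ?(ltW r0)// powRDn.
Qed.

Lemma shell_integral_split e a b c :
  (\int[mu]_(z in shell n a c) (enorm z `^ e)%:E <=
    \int[mu]_(z in shell n a b) (enorm z `^ e)%:E +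
    \int[mu]_(z in shell n b c) (enorm z `^ e)%:E)%E.
Proof.
rewrite -ge0_integral_setU.
- apply: ge0_subset_integral.
  + exact: measurable_shell.
  + by apply: measurableU; exact: measurable_shell.
  + by apply/measurable_EFinP; apply: measurable_funTS; exact: measurable_enorm_powR.
  + by move=> z _; rewrite lee_fin powR_ge0.
  + move=> z /andP[az zc]; have [zb|bz] := lerP (enorm z) b.
      by left; rewrite /shell/= az.
    by right; rewrite /shell/= bz.
- exact: measurable_shell.
- exact: measurable_shell.
- by apply/measurable_EFinP; apply: measurable_funTS; exact: measurable_enorm_powR.
- by move=> z _; rewrite lee_fin powR_ge0.
- rewrite disj_set2E; apply/eqP/seteqP; split => // z [/andP[_ h1] /andP[h2 _]].
  by have := le_lt_trans h1 h2; rewrite ltxx.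
Qed.

Lemma pow2_large x : exists k, x <= 2 ^+ k.
Proof.
exists (Num.bound `|x|); apply: le_trans (ler_norm x) _.
apply: le_trans (ltW (archi_boundP (normr_ge0 x))) _.
have : (Num.bound `|x| <= 2 ^ (Num.bound `|x|))%N by exact/ltnW/ltn_expl.
by rewrite -(ler_nat R) natrX.
Qed.

Lemma powR2N_lt1 beta : 0 < beta -> 2 `^ (- beta) < 1 :> R.
Proof.
move=> b0; rewrite powRN invf_lt1 ?powR_gt0//.
rewrite -[ltLHS](powRr0 2) /powR gt_eqF// ltr_expR mul0r mulr_gt0//.
by rewrite ln_gt0 ?ltr1n.
Qed.

(** Dyadic shells give a geometric series of ratio [2^-beta].  The constant does
    not depend on the inner radius [a]. *)
Lemma inner_integral_le beta : 0 < beta -> exists2 C, 0 <= C &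
  forall a r, 0 < a -> 0 < r ->
  (\int[mu]_(z in shell n a r) (enorm z `^ (beta - n%:R))%:E <=
    (C * r `^ beta)%:E)%E.
Proof.
move=> b0; set e := beta - n%:R; pose D := 2 `^ `|e| * 2 ^+ n : R.
have D0 : 0 <= D by rewrite mulr_ge0 ?powR_ge0.
have q1 := powR2N_lt1 b0.
have q0 : 0 <= 2 `^ (- beta) :> R by exact: powR_ge0.
set q := 2 `^ (- beta) in q0 q1.
have q1' : 0 < 1 - q by rewrite subr_gt0.
exists (D / (1 - q)); first by rewrite divr_ge0// ltW.
move=> a r a0; have [k] := pow2_large (r / a); elim: k r => [|k IH] r rk r0.
  rewrite expr0 ler_pdivrMr// mul1r in rk.
  rewrite (_ : shell _ _ _ = set0) ?integral_set0.
    by rewrite lee_fin mulr_ge0 ?powR_ge0 ?divr_ge0// ltW.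
  apply/seteqP; split => // z /andP[h1 h2].
  by have := lt_le_trans h1 (le_trans h2 rk); rewrite ltxx.
apply: le_trans (shell_integral_split e a (r / 2) r) _.
have h := half_shell_integral_le e r0; rewrite subrK in h.
have {}IH := IH (r / 2).
have rk' : r / 2 / a <= 2 ^+ k.
  by rewrite mulrAC ler_pdivrMr// -exprSr.
have r20 : 0 < r / 2 by rewrite divr_gt0.
apply: le_trans (leeD (IH rk' r20) h) _.
rewrite -EFinD lee_fin -/D.
have -> : (r / 2) `^ beta = q * r `^ beta.
  by rewrite powRM ?invr_ge0 ?(ltW r0)// mulrC -powR_inv1// -powRrM mulN1r.
rewrite mulrA -mulrDl ler_wpM2r ?powR_ge0//.
rewrite [leLHS](_ : _ = D / (1 - q))//.
by field; rewrite gt_eqF.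
Qed.

(** The same series, outwards; monotone convergence then exhausts the exterior. *)
Lemma outer_integral_le beta : 0 < beta -> exists2 C, 0 <= C &
  forall a, 0 < a ->
  (\int[mu]_(z in outside n a) (enorm z `^ (- beta - n%:R))%:E <=
    (C * a `^ (- beta))%:E)%E.
Proof.
move=> b0; set e := - beta - n%:R; pose D := 2 `^ `|e| * 2 ^+ n : R.
have D0 : 0 <= D by rewrite mulr_ge0 ?powR_ge0.
have q1 := powR2N_lt1 b0.
have q0 : 0 <= 2 `^ (- beta) :> R by exact: powR_ge0.
set q := 2 `^ (- beta) in q0 q1.
have q1' : 0 < 1 - q by rewrite subr_gt0.
pose C := D * q / (1 - q); have C0 : 0 <= C by rewrite divr_ge0 ?mulr_ge0// ltW.
exists C => //.
have bnd k a : 0 < a -> (\int[mu]_(z in shell n a (2 ^+ k * a))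
    (enorm z `^ e)%:E <= (C * a `^ (- beta))%:E)%E.
  elim: k a => [|k IH] a a0.
    rewrite expr0 mul1r (_ : shell _ _ _ = set0) ?integral_set0.
      by rewrite lee_fin mulr_ge0 ?powR_ge0.
    apply/seteqP; split => // z /andP[h1 h2].
    by have := lt_le_trans h1 h2; rewrite ltxx.
  apply: le_trans (shell_integral_split e a (2 * a) _) _.
  have a20 : 0 < 2 * a by rewrite mulr_gt0.
  have h := half_shell_integral_le e a20.
  rewrite subrK mulrAC divff// mul1r in h.
  rewrite exprSr -mulrA.
  apply: le_trans (leeD h (IH _ a20)) _; rewrite -EFinD lee_fin -/D.
  rewrite powRM ?(ltW a0)// -/q !mulrA -mulrDl ler_wpM2r ?powR_ge0//.
  by rewrite [leLHS](_ : _ = C)// /C; field; rewrite gt_eqF.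
move=> a a0.
have -> : outside n a = \bigcup_k shell n a (2 ^+ k * a).
  apply/seteqP; split => z /=.
    move=> az; have [k zk] := pow2_large (enorm z / a).
    by exists k => //; rewrite /shell/= az/= -ler_pdivrMr.
  by move=> [k _ /andP[]].
have := @ge0_nondecreasing_set_cvg_integral _ _ R
  (fun k => shell n a (2 ^+ k * a)) (fun z => (enorm z `^ e)%:E) mu.
move=> /(_ _ _ _ _)/cvg_lim <- //; last first.
- by move=> i z _; rewrite lee_fin powR_ge0.
- by move=> i; apply/measurable_EFinP; apply: measurable_funTS; exact: measurable_enorm_powR.
- by move=> i; exact: measurable_shell.
- move=> i j ij; apply/subsetPset => z /andP[az zi]; rewrite /shell/= az/=.
  by apply: le_trans zi _; rewrite ler_wpM2r ?(ltW a0)// ler_eXn2l ?ltr1n.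
apply: lime_le; last by apply: nearW => k; exact: bnd.
apply: ereal_nondecreasing_is_cvgn; apply: ge0_nondecreasing_set_nondecreasing_integral => //.
- move=> i j ij; apply/subsetPset => z /andP[az zi]; rewrite /shell/= az/=.
  by apply: le_trans zi _; rewrite ler_wpM2r ?(ltW a0)// ler_eXn2l ?ltr1n.
- by move=> i; exact: measurable_shell.
- by move=> i; apply/measurable_EFinP; apply: measurable_funTS; exact: measurable_enorm_powR.
- by move=> i z _; rewrite lee_fin powR_ge0.
Qed.

End power_integrals.

(** * Principal values of paraboloids *)

Section change_of_variables.
Context {R : realType} {n : nat}.
Local Notation mu := (@lebesgue_rV R n).

Lemma integral_preserving (phi : 'rV[R]_n -> 'rV[R]_n)
    (mphi : measurable_fun setT phi)
    (pphi : forall A, measurable A -> pushforward mu phi A = mu A)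
    (D : set 'rV[R]_n) (f : 'rV[R]_n -> \bar R) :
  measurable D -> measurable_fun setT f ->
  (\int[mu]_(z in phi @^-1` D) f (phi z) = \int[mu]_(y in D) f y)%E.
Proof.
move=> mD mf.
have ge0 (g : 'rV[R]_n -> \bar R) : measurable_fun setT g ->
    (forall y, 0 <= g y)%E ->
    (\int[mu]_(z in phi @^-1` D) g (phi z) = \int[mu]_(y in D) g y)%E.
  move=> mg g0; transitivity (\int[pushforward mu phi]_(y in D) g y)%E.
    by rewrite (ge0_integral_pushforward mphi)//; exact: measurable_funTS.
  by apply: eq_measure_integral => A mA _; exact: pphi.
rewrite integralE [RHS]integralE; congr (_ - _)%E.
- rewrite -(ge0 (f^\+)%E); [|exact: measurable_funepos|by move=> y; exact: funepos_ge0].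
  by apply: eq_integral => z _; rewrite !funeposE.
- rewrite -(ge0 (f^\-)%E); [|exact: measurable_funeneg|by move=> y; exact: funeneg_ge0].
  by apply: eq_integral => z _; rewrite !funenegE.
Qed.

Lemma integral_shift (x : 'rV[R]_n) (D : set 'rV[R]_n) (f : 'rV[R]_n -> \bar R) :
  measurable D -> measurable_fun setT f ->
  (\int[mu]_(z in [set z | D (x + z)%R]) f (x + z)%R = \int[mu]_(y in D) f y)%E.
Proof.
move=> mD mf; apply: (@integral_preserving (fun z => x + z)) => //.
  exact: measurable_addv.
by move=> A mA; exact: lebesgue_rV_shift.
Qed.

Lemma integral_oppv (D : set 'rV[R]_n) (f : 'rV[R]_n -> \bar R) :
  measurable D -> measurable_fun setT f ->
  (\int[mu]_(z in [set z | D (- z)%R]) f (- z)%R = \int[mu]_(y in D) f y)%E.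
Proof.
move=> mD mf; apply: (@integral_preserving (fun z => - z)) => //.
  exact: measurable_oppv.
by move=> A mA; exact: lebesgue_rV_opp.
Qed.

Lemma integrable_setU (A B : set 'rV[R]_n) (f : 'rV[R]_n -> \bar R) :
  measurable A -> measurable B -> [disjoint A & B] ->
  mu.-integrable A f -> mu.-integrable B f -> mu.-integrable (A `|` B) f.
Proof.
move=> mA mB AB /integrableP[mfA fA] /integrableP[mfB fB].
have mf : measurable_fun (A `|` B) f by apply/measurable_funU.
apply/integrableP; split => //.
rewrite ge0_integral_setU//; first exact: lte_add_pinfty.
exact: measurableT_comp.
Qed.

End change_of_variables.

(** The integrand of the operator, as a function of the increments of the
    function it is applied to. *)
Definition nonlocal {R : realType} {n : nat} (p s : R) (w : 'rV[R]_n -> R)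
    (z : 'rV[R]_n) : R :=
  signed_power p (w z) * enorm z `^ (- (n%:R + s * p)).

Definition near0 {R : realType} (n : nat) (a r : R) : set 'rV[R]_n :=
  [set z | a < enorm z < r].

Definition far {R : realType} (n : nat) (r : R) : set 'rV[R]_n :=
  [set z | r <= enorm z].

Arguments near0 {R} n a r _.
Arguments far {R} n r _.

Section paraboloid.
Context {R : realType} {n : nat}.
Local Notation mu := (@lebesgue_rV R n).

Lemma measurable_near0 a r : measurable (@near0 R n a r).
Proof.
rewrite (_ : near0 _ _ _ = @enorm R n @^-1` `]a, r[).
  exact: measurable_enorm_preimage.
by apply/seteqP; split => z; rewrite /near0/= in_itv.
Qed.

Lemma measurable_far a : measurable (@far R n a).
Proof.
rewrite (_ : far _ _ = @enorm R n @^-1` `[a, +oo[).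
  exact: measurable_enorm_preimage.
by apply/seteqP; split => z; rewrite /far/= in_itv/= andbT.
Qed.

Lemma measurable_signed_power p : measurable_fun setT (@signed_power R p).
Proof.
apply: measurable_funM => //.
apply: (measurableT_comp (f := (@powR R ^~ (p - 2)))); first exact: measurable_powR.
exact: normr_measurable.
Qed.

Lemma measurable_nonlocal p s (w : 'rV[R]_n -> R) : measurable_fun setT w ->
  measurable_fun setT (nonlocal p s w).
Proof.
move=> mw; apply: measurable_funM; last exact: measurable_enorm_powR.
by apply: (measurableT_comp (f := signed_power p)) => //; exact: measurable_signed_power.
Qed.

Lemma nonlocalN p s (w : 'rV[R]_n -> R) z :
  nonlocal p s (fun z => - w z) z = - nonlocal p s w z.
Proof. by rewrite /nonlocal signed_powerN mulNr. Qed.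

(** Centring at the origin exposes the increments, and with them the symmetry
    [z -> - z]. *)
Lemma frac_plaplacianE p s (v : 'rV[R]_n -> R) (x : 'rV[R]_n) :
  measurable_fun setT v ->
  frac_plaplacian p s v x = ((- (1 - s))%:E *
   lim ((fun e : R => \int[mu]_(z in outside n e)
     (nonlocal p s (fun z => v (x + z) - v x) z)%:E) @ 0^'+))%E.
Proof.
move=> mv; rewrite /frac_plaplacian /PV; congr (_ * lim _)%E.
apply: (congr1 (fun g : R -> \bar R => fmap g (0^'+))); apply/funext => e.
rewrite -(@integral_shift _ _ x (~` ecball x e)).
- rewrite (_ : [set z | _] = outside n e); last first.
    apply/seteqP; split => z; rewrite /outside/ecball/= [x + z]addrC addrK.
      by move=> /negP; rewrite -ltNge.
    by move=> h; apply/negP; rewrite -ltNge.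
  apply: eq_integral => z _; congr (_%:E).
  have -> : x - (x + z) = - z by rewrite opprD addrA subrr add0r.
  by rewrite /nonlocal /signed_power powRN enormN.
- apply: measurableC; rewrite (_ : ecball x e =
     (fun y => - x + y) @^-1` [set z | enorm z <= e]).
    rewrite -[X in measurable X]setTI; apply: (measurable_addv (- x)) => //.
    rewrite (_ : [set z | _] = @enorm R n @^-1` `]-oo, e]).
      exact: measurable_enorm_preimage.
    by apply/seteqP; split => z /=; rewrite in_itv.
  by apply/seteqP; split => z; rewrite /ecball/= addrC.
- apply/measurable_EFinP; apply: measurable_funM.
    apply: measurable_funM; last exact: measurable_funB.
    apply: (measurableT_comp (f := (@powR R ^~ (p - 2)))); first exact: measurable_powR.
    by apply: measurableT_comp; [exact: normr_measurable|exact: measurable_funB].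
  rewrite (_ : (fun y => _) = (fun y => enorm (x + - y) `^ (- (n%:R + s * p)))).
    apply: (measurableT_comp (f := fun y : 'rV[R]_n => enorm y `^ _)).
      exact: measurable_enorm_powR.
    by apply: (measurableT_comp (measurable_addv x)); exact: measurable_oppv.
  by apply/funext => y; rewrite powRN.
Qed.

Lemma disjoint_near_far a r : [disjoint @near0 R n a r & far n r].
Proof.
rewrite disj_set2E; apply/eqP/seteqP; split => // z [/andP[_ h1]].
by rewrite /far/= leNgt h1.
Qed.

Lemma outside_near_far a r : a < r -> @outside R n a = near0 n a r `|` far n r.
Proof.
move=> ar; apply/seteqP; split => z; rewrite /outside/near0/far/=.
  by move=> az; have [zr|rz] := ltP (enorm z) r; [left|right] => //; apply/andP.
by case=> [/andP[]//|]; exact: lt_le_trans.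
Qed.

Lemma far_outside a r : a < r -> far n r `<=` @outside R n a.
Proof. by move=> ar z; rewrite /far/outside/=; exact: lt_le_trans. Qed.

(** Between two positive radii the value of [beta] is irrelevant; it is left free
    so that [inner_integral_le] applies. *)
Lemma near_integrable (f : 'rV[R]_n -> R) (a r K beta : R) : 0 < a -> 0 < r ->
  0 < beta -> measurable_fun setT f ->
  (forall z, near0 n a r z -> `|f z| <= K * enorm z `^ (beta - n%:R)) ->
  mu.-integrable (near0 n a r) (EFin \o f).
Proof.
move=> a0 r0 b0 mf fK; have [C C0 hC] := @inner_integral_le R n beta b0.
have K0 : forall z, near0 n a r z -> 0 <= K.
  move=> z /[dup] /fK h /andP[az _].
  have zp : 0 < enorm z `^ (beta - n%:R) by rewrite powR_gt0// (lt_trans a0).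
  by rewrite -(pmulr_lge0 _ zp) (le_trans _ h).
have mn := measurable_near0 a r.
apply/integrableP; split; first by apply/measurable_EFinP; exact: measurable_funTS.
apply: (@le_lt_trans _ _ (\int[mu]_(z in near0 n a r)
    (`|K|%:E * (enorm z `^ (beta - n%:R))%:E))%E).
  apply: ge0_le_integral => //=.
  - apply/measurable_EFinP; apply: measurableT_comp => //; exact: measurable_funTS.
  - apply/measurable_EFinP; apply: measurable_funM => //; apply: measurable_funTS.
    exact: measurable_enorm_powR.
  - move=> z zn; rewrite lee_fin; apply: le_trans (fK z zn) _.
    by rewrite ler_wpM2r ?powR_ge0// ler_norm.
rewrite ge0_integralZl//=; last first.
  - by move=> z _; rewrite lee_fin powR_ge0.
  - by apply/measurable_EFinP; apply: measurable_funTS; exact: measurable_enorm_powR.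
rewrite lte_mul_pinfty ?lee_fin//.
apply: le_lt_trans (ltry (C * r `^ beta)).
apply: le_trans (hC a r a0 r0).
apply: ge0_subset_integral => //.
- exact: measurable_shell.
- by apply/measurable_EFinP; apply: measurable_funTS; exact: measurable_enorm_powR.
- by move=> z _; rewrite lee_fin powR_ge0.
- by move=> z /andP[h1 h2]; rewrite /shell/= h1 ltW.
Qed.

End paraboloid.

Section paraboloid_pv.
Context {R : realType} {n : nat}.
Local Notation mu := (@lebesgue_rV R n).
Variables (p s : R).
Hypotheses (p2 : 2 <= p) (s01 : 0 < s < 1).

Let linear_part (P z : 'rV[R]_n) : R := nonlocal p s (edot P) z.

(** The contribution of the quadratic term, which is nonnegative by
    monotonicity of the nonlinearity. *)
Let excess (P : 'rV[R]_n) (M : R) (z : 'rV[R]_n) : R :=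
  nonlocal p s (fun z => edot P z + M * enorm z ^+ 2) z - linear_part P z.

Lemma measurable_paraboloid (P : 'rV[R]_n) M :
  measurable_fun setT (fun z => edot P z + M * enorm z ^+ 2).
Proof.
apply: measurable_funD; first exact: measurable_edot.
by apply: measurable_funM => //; apply: measurable_funX; exact: measurable_enorm.
Qed.

Let measurable_linear P : measurable_fun setT (linear_part P).
Proof. by apply: measurable_nonlocal; exact: measurable_edot. Qed.

Let measurable_excess P M : measurable_fun setT (excess P M).
Proof.
apply: measurable_funB => //; apply: measurable_nonlocal.
exact: measurable_paraboloid.
Qed.

Let excess_ge0 P M z : 0 <= M -> 0 <= excess P M z.
Proof.
move=> M0; rewrite /excess /linear_part /nonlocal -mulrBl mulr_ge0 ?powR_ge0//.
by rewrite subr_ge0 le_signed_power// lerDl mulr_ge0// sqr_ge0.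
Qed.

Let excess_le P M r z : 0 <= M -> 0 < enorm z <= r ->
  excess P M z <= (p - 1) * (enorm P + M * r) `^ (p - 2) * M *
    enorm z `^ (p * (1 - s) - n%:R).
Proof.
move=> M0 /andP[z0 zr]; rewrite /excess /linear_part /nonlocal -mulrBl.
set t := enorm z in z0 zr *; pose L := enorm P + M * r.
have r0 : 0 < r by apply: lt_le_trans zr.
have P0 := enorm_ge0 P.
have L0 : 0 <= L by rewrite addr_ge0// mulr_ge0// ltW.
have Pz : `|edot P z| <= enorm P * t := normr_edot_le P z.
have Mt : M * t ^+ 2 <= M * r * t.
  by rewrite expr2 mulrA ler_wpM2r ?(ltW z0)// ler_wpM2l.
have Mt0 : 0 <= M * t ^+ 2 by rewrite mulr_ge0// sqr_ge0.
have h : signed_power p (edot P z + M * t ^+ 2) - signed_power p (edot P z) <=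
    (p - 1) * (L * t) `^ (p - 2) * (edot P z + M * t ^+ 2 - edot P z).
  apply: signed_power_sub_le => //.
  - by rewrite lerDl.
  - apply: le_trans (ler_normD _ _) _; rewrite (ger0_norm Mt0) /L mulrDl.
    exact: lerD.
  - apply: le_trans Pz _; rewrite /L mulrDl lerDl !mulr_ge0//; exact: ltW.
apply: le_trans (ler_wpM2r (powR_ge0 _ _) h) _.
rewrite [edot P z + _]addrC addrK powRM ?(ltW z0)//.
have -> : p * (1 - s) - n%:R = p - 2 + (2 + - (n%:R + s * p)) by ring.
rewrite -(powRDn (p - 2)) // -(powRDn 2)// powR_mulrn ?(ltW z0)//.
by rewrite le_eqVlt; apply/orP; left; apply/eqP; ring.
Qed.

Let ps_gt0 : 0 < p * (1 - s).
Proof. by case/andP: s01 => s0 s1; rewrite mulr_gt0 ?subr_gt0//; have := p2; lra. Qed.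

Let near_integrable_excess P M a r : 0 <= M -> 0 < a -> 0 < r ->
  mu.-integrable (near0 n a r) (EFin \o excess P M).
Proof.
move=> M0 a0 r0; apply: (@near_integrable _ _ _ a r
   ((p - 1) * (enorm P + M * r) `^ (p - 2) * M) _ a0 r0 ps_gt0) => // z.
move=> /andP[h1 h2]; rewrite ger0_norm ?excess_ge0//; apply: excess_le => //.
by rewrite (lt_trans a0)// ltW.
Qed.

Let near_integrable_linear P a r : 0 < a -> 0 < r ->
  mu.-integrable (near0 n a r) (EFin \o linear_part P).
Proof.
move=> a0 r0; apply: (@near_integrable _ _ _ a r
   ((enorm P * r) `^ (p - 1) * a `^ (- (s * p) - 1)) 1 a0 r0) => // z.
move=> /andP[h1 h2]; rewrite /linear_part /nonlocal normrM normr_signed_power//.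
have z0 : 0 < enorm z by apply: lt_trans h1.
rewrite (ger0_norm (powR_ge0 _ _)).
have -> : - (n%:R + s * p) = - (s * p) - 1 + (1 - n%:R) by ring.
rewrite -(powRDn (- (s * p) - 1) (1 - n%:R) z0) -[leRHS]mulrA ler_pM ?powR_ge0 ?mulr_ge0 ?powR_ge0//.
- apply: ler_powRl => //; first by have := p2; lra.
  apply: le_trans (normr_edot_le _ _) _.
  by rewrite ler_wpM2l ?enorm_ge0// ltW.
- rewrite ler_wpM2r ?powR_ge0//; apply: ler_powRl_neg => //; last exact: ltW.
  case/andP: s01 => s0 _.
  have : 0 < s * p by rewrite mulr_gt0//; have := p2; lra.
  lra.
Qed.

(** The integrand is odd and the domain symmetric. *)
Let linear_integral0 P a r : 0 < a -> 0 < r ->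
  (\int[mu]_(z in near0 n a r) (linear_part P z)%:E = 0)%E.
Proof.
move=> a0 r0; have iL := near_integrable_linear P a0 r0.
have mL : measurable_fun setT (EFin \o linear_part P) by exact/measurable_EFinP.
have mn := @measurable_near0 R n a r.
have := @integral_oppv _ _ (near0 n a r) (EFin \o linear_part P) mn mL.
rewrite (_ : [set z | _] = near0 n a r); last first.
  by apply/seteqP; split => z; rewrite /near0/= enormN.
under eq_integral do rewrite /= /linear_part /nonlocal edotNr signed_powerN enormN mulNr EFinN.
rewrite integralN/=; last exact: integrable_add_def.
have := integrable_fin_num mn iL.
rewrite /linear_part /nonlocal/=; set I := (X in X \is a fin_num) => fI.
rewrite -[LHS]/(- I)%E -[RHS]/I => h.
rewrite -[LHS]/I; move: h; rewrite -(fineK fI) -EFinN => -[h].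
by congr EFin; lra.
Qed.

Let w_near_integral (w : 'rV[R]_n -> R) P M a r : 0 <= M -> 0 < a -> 0 < r ->
  (forall z, enorm z < r -> w z = edot P z + M * enorm z ^+ 2) ->
  (\int[mu]_(z in near0 n a r) (nonlocal p s w z)%:E =
   \int[mu]_(z in near0 n a r) (excess P M z)%:E)%E.
Proof.
move=> M0 a0 r0 wE; have mn := @measurable_near0 R n a r.
transitivity (\int[mu]_(z in near0 n a r)
   ((excess P M z)%:E + (linear_part P z)%:E))%E.
  apply: eq_integral => z; rewrite inE => /andP[_ zr].
  by rewrite -EFinD /excess subrK /nonlocal wE.
rewrite integralD//; [|exact: near_integrable_excess|exact: near_integrable_linear].
by rewrite linear_integral0// adde0.
Qed.

(** Subtracting the odd linear part, whose integral over a symmetric shell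
    vanishes, turns the integrand near the origin into a nonnegative one: the
    truncated integrals are then monotone, so that the principal value exists,
    and the ball contributes at most [r^(p - s p)] up to the other factors. *)
Lemma paraboloid_pv_le : exists2 C, 0 <= C &
  forall (w : 'rV[R]_n -> R) (P : 'rV[R]_n) (M r : R),
    0 <= M -> 0 < r -> measurable_fun setT w ->
    (forall z, enorm z < r -> w z = edot P z + M * enorm z ^+ 2) ->
    mu.-integrable (far n r) (EFin \o nonlocal p s w) ->
    let g e := (\int[mu]_(z in outside n e) (nonlocal p s w z)%:E)%E in
    [/\ cvg (g @ 0^'+),
     forall e, 0 < e < r ->
       mu.-integrable (outside n e) (EFin \o nonlocal p s w) &
    (lim (g @ 0^'+) <= (C * (enorm P + M * r) `^ (p - 2) * M *
      r `^ (p * (1 - s)) + \int[mu]_(z in far n r) nonlocal p s w z)%:E)%E].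
Proof.
have [C C0 hC] := @inner_integral_le R n _ ps_gt0.
exists ((p - 1) * C); first by rewrite mulr_ge0//; have := p2; lra.
move=> w P M r M0 r0 mw wE iw g.
have mnl := measurable_nonlocal p s mw.
have gE e : 0 < e < r -> g e = (\int[mu]_(z in near0 n e r) (excess P M z)%:E +
    (\int[mu]_(z in far n r) nonlocal p s w z)%:E)%E.
  move=> /andP[e0 er]; rewrite /g (outside_near_far er) integral_setU.
  - rewrite (w_near_integral M0 e0 r0 wE) /Rintegral fineK//.
    by apply: integrable_fin_num => //; exact: measurable_far.
  - exact: measurable_near0.
  - exact: measurable_far.
  - by apply/measurable_EFinP; exact: measurable_funTS.
  - exact: disjoint_near_far.
have cg : cvg (g @ 0^'+).
  apply: nonincreasing_at_right_is_cvge; near=> d => a b.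
  rewrite !in_itv/= => /andP[a0 ad] /andP[b0 bd] ab.
  have dr : d < r by near: d; exact: nbhs_right_lt.
  rewrite -/(g a) -/(g b) !gE ?a0 ?b0 ?(lt_trans ad) ?(lt_trans bd)// leeD2r//.
  apply: ge0_subset_integral; try exact: measurable_near0.
  - by apply/measurable_EFinP; exact: measurable_funTS.
  - by move=> z _; rewrite lee_fin excess_ge0.
  - by move=> z /andP[h1 h2]; rewrite /near0/= h2 andbT (le_lt_trans ab).
have ie e : 0 < e < r ->
    mu.-integrable (outside n e) (EFin \o nonlocal p s w).
  move=> /andP[e0 er]; rewrite (outside_near_far er).
  apply: integrable_setU => //; [exact: measurable_near0|exact: measurable_far
    |exact: disjoint_near_far|].
  apply: (@eq_integrable _ _ _ mu _ _ (fun z => (excess P M z)%:E + (linear_part P z)%:E)%E).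
  - exact: measurable_near0.
  - move=> z; rewrite inE => /andP[_ zr].
    by rewrite -EFinD /excess subrK /= /nonlocal wE.
  - apply: integrableD; [exact: measurable_near0|exact: near_integrable_excess|].
    exact: near_integrable_linear.
split => //; apply: lime_le => //; near=> e.
have e0 : 0 < e by near: e; exact: nbhs_right_gt.
have er : e < r by near: e; exact: nbhs_right_lt.
rewrite gE ?e0// EFinD leeD2r//.
pose K := (p - 1) * (enorm P + M * r) `^ (p - 2) * M.
have K0 : 0 <= K by rewrite !mulr_ge0 ?powR_ge0//; have := p2; lra.
apply: (@le_trans _ _ (\int[mu]_(z in near0 n e r)
    (K%:E * (enorm z `^ (p * (1 - s) - n%:R))%:E))%E).
  apply: ge0_le_integral => //=.
  - exact: measurable_near0.
  - by move=> z _; rewrite lee_fin excess_ge0.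
  - by apply/measurable_EFinP; exact: measurable_funTS.
  - apply/measurable_EFinP; apply: measurable_funM => //; apply: measurable_funTS.
    exact: measurable_enorm_powR.
  - move=> z /andP[h1 h2]; rewrite -EFinM lee_fin; apply: excess_le => //.
    by rewrite (lt_trans e0)// ltW.
rewrite ge0_integralZl//=; last first.
  - by move=> z _; rewrite lee_fin powR_ge0.
  - by apply/measurable_EFinP; apply: measurable_funTS; exact: measurable_enorm_powR.
  - exact: measurable_near0.
have hs : (\int[mu]_(z in near0 n e r) (enorm z `^ (p * (1 - s) - n%:R))%:E <=
    (C * r `^ (p * (1 - s)))%:E)%E.
  apply: le_trans (hC e r e0 r0).
  apply: ge0_subset_integral => //.
  - exact: measurable_near0.
  - exact: measurable_shell.
  - by apply/measurable_EFinP; apply: measurable_funTS; exact: measurable_enorm_powR.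
  - by move=> z _; rewrite lee_fin powR_ge0.
  - by move=> z /andP[h1 h2]; rewrite /shell/= h1 ltW.
apply: le_trans (lee_wpmul2l _ hs) _; first by rewrite lee_fin.
rewrite -EFinM lee_fin /K le_eqVlt; apply/orP; left; apply/eqP; ring.
Unshelve. all: by end_near. Qed.

End paraboloid_pv.

(** * Touching paraboloids *)

Section quadratic_smooth.
Context {R : realType} {n : nat}.

(** The difference quotients are affine in [h]. *)
Lemma is_derive_quadratic (f : 'rV[R]_n -> R) (y v : 'rV[R]_n) (a b : R) :
  (forall h : R, f (h *: v + y) = f y + h * a + h ^+ 2 * b) ->
  is_derive y v f a.
Proof.
move=> fE.
have cvf : h^-1 *: ((f \o shift y) (h *: v) - f y) @[h --> 0^'] --> a.
  have -> : a = a + 0 * b by rewrite mul0r addr0.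
  apply: (@cvg_trans _ ((a + h * b) @[h --> 0^'])).
    apply: near_eq_cvg; near=> h.
    have h0 : h != 0 by near: h; exact: nbhs_dnbhs_neq.
    rewrite /= fE; apply: (mulfI h0); rewrite /GRing.scale/= mulrA divff// mul1r.
    by ring.
  apply: cvgD; first exact: cvg_cst.
  apply: cvgM; last exact: cvg_cst.
  by apply: cvg_within_filter; exact: cvg_id.
split; first by apply/cvg_ex; exists a.
exact: cvg_lim cvf.
Unshelve. all: by end_near. Qed.

Lemma paraboloid_C2 (A : set 'rV[R]_n) (c M : R) (x P : 'rV[R]_n) :
  C2_on A (fun y => c + edot P (y - x) + M * enorm (y - x) ^+ 2).
Proof.
pose f y := c + edot P (y - x) + M * enorm (y - x) ^+ 2.
pose e (i : 'I_n) : 'rV[R]_n := delta_mx ord0 i.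
have edot_delta (z : 'rV[R]_n) i : edot z (e i) = z ord0 i.
  rewrite /edot (bigD1 i)//= /e mxE !eqxx mulr1 big1 ?addr0// => j ji.
  by rewrite mxE (negbTE ji) andbF mulr0.
have df i y : is_derive y (e i) f (P ord0 i + 2 * M * (y ord0 i - x ord0 i)).
  apply: (@is_derive_quadratic _ _ _ _ M) => h.
  rewrite /f -addrA -addrA; set w := y - x.
  rewrite -(_ : w ord0 i = y ord0 i - x ord0 i); last by rewrite !mxE.
  rewrite edotDr edotZr enormD_sqr edotZl (edotC (e i)).
  rewrite enormZ exprMn real_normK ?num_real// (enorm_sqr (e i)).
  have ei : e i ord0 i = 1 by rewrite mxE !eqxx.
  by rewrite !edot_delta ei; ring.
have dv i y : derive f y (e i) = P ord0 i + 2 * M * (y ord0 i - x ord0 i).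
  exact: (@derive_val _ _ _ _ _ _ _ (df i y)).
have dfE i : 'D_(e i) f = fun y => P ord0 i + 2 * M * (y ord0 i - x ord0 i).
  by apply/funext => y; rewrite dv.
have ddf i j y : is_derive y (e j) ('D_(e i) f) (2 * M * (j == i)%:R).
  apply: (@is_derive_quadratic _ _ _ _ 0) => h.
  by rewrite !dv !mxE eqxx/= [i == j]eq_sym; ring.
have cdf i : continuous ('D_(e i) f).
  rewrite dfE => y.
  apply: (@cvg_comp _ _ _ (fun y : 'rV[R]_n => y ord0 i)
    (fun t : R => P ord0 i + 2 * M * (t - x ord0 i)) _ _ _
    (@coord_continuous R 1 n ord0 i y)).
  apply: cvgD; first exact: cvg_cst.
  apply: cvgM; first exact: cvg_cst.
  by apply: cvgB; [exact: cvg_id|exact: cvg_cst].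
split.
  by move=> i y _; split; [exact: (@ex_derive _ _ _ _ _ _ _ (df i y))|exact: cdf].
move=> i j y _; split; first exact: (@ex_derive _ _ _ _ _ _ _ (ddf i j y)).
rewrite (_ : 'D_(e j) ('D_(e i) f) = cst (2 * M * (j == i)%:R)).
  exact: (@cvg_cst _ _ _ (nbhs y) (nbhs_filter y)).
by apply/funext => z; rewrite (@derive_val _ _ _ _ _ _ _ (ddf i j z)).
Qed.

End quadratic_smooth.

Section tails.
Context {R : realType} {n : nat}.
Local Notation mu := (@lebesgue_rV R n).
Variables (p s : R).
Hypotheses (p2 : 2 <= p) (s01 : 0 < s < 1).

Let sp_gt0 : 0 < s * p.
Proof. by case/andP: s01 => s0 _; rewrite mulr_gt0//; have := p2; lra. Qed.

(** For [|z| >= D] and [|x| <= 2] the weight [1 + |x + z|] is at most a multiple of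
    [|z|]; the tail integral therefore controls the part with [u (x + z)], and
    [outer_integral_le] the part with [u x]. *)
Lemma far_integral_le (A D : R) : 0 <= A -> 0 < D -> exists2 C, 0 <= C &
  forall (u : 'rV[R]_n -> R) x, measurable_fun setT u ->
    (tail_integral p s u <= A%:E)%E -> enorm x <= 2 -> `|u x| <= A ->
    (\int[mu]_(z in far n D)
      `|nonlocal p s (fun z => u (x + z) - u x) z|%:E <= C%:E)%E.
Proof.
move=> A0 D0; have [C1 C10 hC1] := @outer_integral_le R n _ sp_gt0.
(* [1 + |x + z| <= 3 + |z| <= (3 / D + 1) |z|] *)
pose k := (3 / D + 1) `^ (n%:R + s * p).
have k0 : 0 <= k by exact: powR_ge0.
pose C := 2 `^ (p - 1) * (k * A + A `^ (p - 1) * (C1 * (D / 2) `^ (- (s * p)))).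
have C0 : 0 <= C.
  by rewrite mulr_ge0 ?powR_ge0// addr_ge0 ?mulr_ge0 ?powR_ge0.
exists C => // u x mu_ tu x2 uA.
pose F (y : 'rV[R]_n) := `|u y| `^ (p - 1) / (1 + enorm y) `^ (n%:R + s * p).
have F0 y : 0 <= F y by rewrite divr_ge0 ?powR_ge0.
have mF : measurable_fun setT F.
  apply: measurable_funM.
    apply: (measurableT_comp (f := (@powR R ^~ (p - 1)))); first exact: measurable_powR.
    by apply: measurableT_comp => //; exact: normr_measurable.
  rewrite (_ : (fun x => _) = (fun y => (1 + enorm y) `^ (- (n%:R + s * p)))).
    apply: (measurableT_comp (f := (@powR R ^~ (- (n%:R + s * p)))));
      first exact: measurable_powR.
    by apply: measurable_funD => //; exact: measurable_enorm.
  by apply/funext => y; rewrite powRN.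
have mFx : measurable_fun setT (fun z => F (x + z)).
  by apply: (measurableT_comp mF); exact: measurable_addv.
have me := @measurable_enorm_powR R n (- (s * p) - n%:R).
have mfar := @measurable_far R n D.
have mnl : measurable_fun setT (nonlocal p s (fun z => u (x + z) - u x)).
  apply: measurable_nonlocal; apply: measurable_funB => //.
  by apply: (measurableT_comp mu_); exact: measurable_addv.
apply: (@le_trans _ _ (\int[mu]_(z in far n D)
    ((2 `^ (p - 1))%:E * (k%:E * (F (x + z)%R)%:E +
      (A `^ (p - 1))%:E * (enorm z `^ (- (s * p) - n%:R))%:E)))%E).
  apply: ge0_le_integral => //=.
  - apply/measurable_EFinP; apply: measurable_funTS.
    by apply: measurableT_comp => //; exact: normr_measurable.
  - apply/measurable_EFinP; apply: measurable_funTS; apply: measurable_funM => //.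
    by apply: measurable_funD; apply: measurable_funM.
  move=> z Dz; rewrite -[leRHS]/((2 `^ (p - 1) *
    (k * F (x + z) + A `^ (p - 1) * enorm z `^ (- (s * p) - n%:R)))%:E).
  rewrite lee_fin /nonlocal normrM.
  have z0 : 0 < enorm z by apply: lt_le_trans Dz.
  rewrite (ger0_norm (powR_ge0 (enorm z) _)).
  apply: le_trans (ler_wpM2r (powR_ge0 _ _) (normr_signed_power_sub_le _ _ p2)) _.
  rewrite -mulrA ler_wpM2l ?powR_ge0// mulrDl; apply: lerD.
    rewrite /F mulrA [k * _]mulrC -mulrA ler_wpM2l ?powR_ge0//.
    have y0 : 0 < 1 + enorm (x + z) by rewrite ltr_pwDl ?enorm_ge0.
    have Yp := powR_gt0 (n%:R + s * p) y0; have Zp := powR_gt0 (n%:R + s * p) z0.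
    rewrite powRN -[leLHS]mul1r ler_pdivrMr// mulrAC ler_pdivlMr// mul1r.
    rewrite /k -powRM ?enorm_ge0 ?addr_ge0 ?divr_ge0 ?(ltW D0)//.
    apply: ler_powRl; [by rewrite addr_ge0// ltW|exact: ltW|].
    have := ler_enormD x z; rewrite mulrDl mul1r.
    have : 3 <= 3 / D * enorm z.
      by rewrite mulrAC -mulrA ler_peMr// ler_pdivlMr// mul1r.
    by lra.
  have -> : - (n%:R + s * p) = - (s * p) - n%:R by ring.
  rewrite ler_wpM2r ?powR_ge0//; apply: ler_powRl => //.
  by have := p2; lra.
have FF : (\int[mu]_(z in far n D) (F (x + z)%R)%:E <= A%:E)%E.
  apply: le_trans tu.
  have mEF : measurable_fun setT (EFin \o F) by exact/measurable_EFinP.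
  rewrite /tail_integral -(integral_shift x measurableT mEF).
  apply: ge0_subset_integral => //.
  - by rewrite (_ : [set z | _] = setT)//; apply/seteqP.
  - by apply/measurable_EFinP; exact: measurable_funTS.
  - by move=> z _; rewrite lee_fin.
have EE : (\int[mu]_(z in far n D) (enorm z `^ (- (s * p) - n%:R))%:E <=
    (C1 * (D / 2) `^ (- (s * p)))%:E)%E.
  have D20 : 0 < D / 2 by rewrite divr_gt0.
  apply: le_trans (hC1 _ D20); apply: ge0_subset_integral => //.
  - exact: measurable_outside.
  - by apply/measurable_EFinP; exact: measurable_funTS.
  - by move=> z _; rewrite lee_fin powR_ge0.
  - by apply: far_outside; lra.
have m1 : measurable_fun (far n D) (fun z => (k%:E * (F (x + z)%R)%:E)%E).
  by apply/measurable_EFinP; apply: measurable_funTS; exact: measurable_funM.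
have m2 : measurable_fun (far n D)
    (fun z => ((A `^ (p - 1))%:E * (enorm z `^ (- (s * p) - n%:R))%:E)%E).
  by apply/measurable_EFinP; apply: measurable_funTS; exact: measurable_funM.
rewrite ge0_integralZl//=; last 2 first.
- exact: emeasurable_funD.
- move=> z _; rewrite -[leRHS]/((k * F (x + z) + A `^ (p - 1) *
    enorm z `^ (- (s * p) - n%:R))%:E) lee_fin.
  apply: addr_ge0; first exact: (mulr_ge0 k0 (F0 _)).
  by rewrite mulr_ge0 ?powR_ge0.
rewrite /C EFinM; apply: lee_wpmul2l; first by rewrite lee_fin powR_ge0.
rewrite ge0_integralD//=; last 2 first.
- by move=> z _; rewrite -EFinM lee_fin mulr_ge0.
- by move=> z _; rewrite -EFinM lee_fin mulr_ge0 ?powR_ge0.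
rewrite EFinD; apply: leeD.
- rewrite ge0_integralZl//=; [|by apply/measurable_EFinP; exact: measurable_funTS
    |by move=> z _; rewrite lee_fin].
  by rewrite EFinM; apply: lee_wpmul2l; rewrite ?lee_fin.
- rewrite ge0_integralZl//=; [|by apply/measurable_EFinP; exact: measurable_funTS
    |by move=> z _; rewrite lee_fin powR_ge0|by rewrite lee_fin powR_ge0].
  by rewrite EFinM; apply: lee_wpmul2l; rewrite ?lee_fin ?powR_ge0.
Qed.

End tails.

Definition truncated {R : realType} {n : nat} (p s : R) (u : 'rV[R]_n -> R)
    (x : 'rV[R]_n) (r : R) : R :=
  \int[lebesgue_rV n]_(z in far n r) nonlocal p s (fun z => u (x + z) - u x) z.

Section touching.
Context {R : realType} {n : nat}.
Local Notation mu := (@lebesgue_rV R n).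

Lemma integrable_nonlocal p s (u : 'rV[R]_n -> R) x r :
  2 <= p -> 0 < s < 1 -> measurable_fun setT u ->
  (tail_integral p s u < +oo)%E -> enorm x <= 2 -> 0 < r ->
  mu.-integrable (far n r) (EFin \o nonlocal p s (fun z => u (x + z) - u x)).
Proof.
move=> p2 s01 mu_ tu x2 r0.
have t0 : (0 <= tail_integral p s u)%E.
  by apply: integral_ge0 => z _; rewrite lee_fin divr_ge0 ?powR_ge0.
have tf : tail_integral p s u \is a fin_num by rewrite ge0_fin_numE.
pose A := Num.max (fine (tail_integral p s u)) `|u x|.
have A0 : 0 <= A by rewrite /A le_max normr_ge0 orbT.
have [C C0 hC] := @far_integral_le R n p s p2 s01 A r A0 r0.
apply/integrableP; split.
  apply/measurable_EFinP; apply: measurable_funTS; apply: measurable_nonlocal.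
  apply: measurable_funB => //; apply: (measurableT_comp mu_).
  exact: measurable_addv.
apply: le_lt_trans (ltry C); apply: hC => //.
  by rewrite -(fineK tf) lee_fin /A le_max lexx.
by rewrite /A le_max lexx orbT.
Qed.

Section one_operator.
Variables (p s : R).
Hypotheses (p2 : 2 <= p) (s01 : 0 < s < 1).

(** The second claim is the first one for [- v], as the operator is odd. *)
Lemma frac_plaplacian_paraboloid : exists2 c, 0 <= c &
  forall (v : 'rV[R]_n -> R) x P M r, 0 <= M -> 0 < r -> measurable_fun setT v ->
    mu.-integrable (far n r) (EFin \o nonlocal p s (fun z => v (x + z) - v x)) ->
    let E := c * (enorm P + M * r) `^ (p - 2) * M * r `^ (p * (1 - s)) in
    ((forall z, enorm z < r -> v (x + z) - v x = edot P z + M * enorm z ^+ 2) ->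
      ((- ((1 - s) * (truncated p s v x r + E)))%:E <= frac_plaplacian p s v x)%E) /\
    ((forall z, enorm z < r -> v (x + z) - v x = edot P z - M * enorm z ^+ 2) ->
      (frac_plaplacian p s v x <= (- ((1 - s) * (truncated p s v x r - E)))%:E)%E).
Proof.
have [c c0 hc] := @paraboloid_pv_le R n p s p2 s01.
have s1 : 0 <= 1 - s by case/andP: s01 => _; rewrite subr_ge0; exact: ltW.
exists c => // v x P M r M0 r0 mv iv E.
pose w z := v (x + z) - v x.
have mw : measurable_fun setT w.
  apply: measurable_funB => //; apply: (measurableT_comp mv).
  exact: measurable_addv.
split=> wE.
  have [_ _ h] := hc w P M r M0 r0 mw wE iv.
  rewrite frac_plaplacianE// !EFinN mulNe leeN2 EFinM.
  apply: lee_wpmul2l; first by rewrite lee_fin.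
  by apply: le_trans h _; rewrite lee_fin addrC.
have wE' z : enorm z < r -> - w z = edot (- P) z + M * enorm z ^+ 2.
  by move=> zr; rewrite /w wE// edotNl opprB addrC.
have mw' : measurable_fun setT (fun z => - w z) by apply: measurableT_comp.
have iw' : mu.-integrable (far n r) (EFin \o nonlocal p s (fun z => - w z)).
  apply: (@eq_integrable _ _ _ mu _ _ (fun z => - (nonlocal p s w z)%:E)%E).
  - exact: measurable_far.
  - by move=> z _; rewrite /= nonlocalN EFinN.
  - by apply: integrableN => //; exact: measurable_far.
have [cg ig h] := hc _ (- P) M r M0 r0 mw' wE' iw'.
rewrite frac_plaplacianE//.
have cgw : (\int[mu]_(z in outside n e) (nonlocal p s w z)%:E)%E @[e --> 0^'+] -->
    (- lim ((\int[mu]_(z in outside n e) (nonlocal p s (fun z => - w z) z)%:E)%E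
       @[e --> 0^'+]))%E.
  apply: cvg_trans (cvgeN cg); apply: near_eq_cvg; near=> e.
  have e0 : 0 < e by near: e; exact: nbhs_right_gt.
  have er : e < r by near: e; exact: nbhs_right_lt.
  rewrite -integralN; last first.
    apply: integrable_add_def; [exact: measurable_outside|].
    by apply: ig; rewrite e0.
  by apply: eq_integral => z _; rewrite nonlocalN EFinN oppeK.
have TN : \int[mu]_(z in far n r) nonlocal p s (fun z => - w z) z =
    - truncated p s v x r.
  under eq_Rintegral do rewrite nonlocalN -mulN1r.
  by rewrite RintegralZl ?mulN1r//; exact: measurable_far.
rewrite (cvg_lim _ cgw)// [X in (X * _)%E]EFinN mulNe muleN oppeK.
rewrite -mulrN EFinM; apply: lee_wpmul2l; first by rewrite lee_fin.
by apply: le_trans h _; rewrite lee_fin /E enormN opprB TN.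
Unshelve. all: by end_near. Qed.

End one_operator.

Lemma measurable_eball (x : 'rV[R]_n) r : measurable (eball x r).
Proof.
rewrite (_ : eball x r = (fun y => - x + y) @^-1` [set z | enorm z < r]).
  rewrite -[X in measurable X]setTI; apply: (measurable_addv (- x)) => //.
  rewrite (_ : [set z | _] = @enorm R n @^-1` `]-oo, r[).
    exact: measurable_enorm_preimage.
  by apply/seteqP; split => z /=; rewrite in_itv.
by apply/seteqP; split => z; rewrite /eball/= addrC.
Qed.

Lemma eball_shift (x z : 'rV[R]_n) r : eball x r (x + z) = (enorm z < r) :> Prop.
Proof. by rewrite /eball/= [x + z]addrC addrK. Qed.

Lemma patch_ball_near (u eta : 'rV[R]_n -> R) x z r :
  enorm z < r -> patch u (eball x r) eta (x + z) = eta (x + z).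
Proof. by move=> zr; rewrite /patch mem_set// eball_shift. Qed.

Lemma patch_ball_far (u eta : 'rV[R]_n -> R) x z r :
  far n r z -> patch u (eball x r) eta (x + z) = u (x + z).
Proof.
move=> zr; rewrite /patch memNset// eball_shift => h.
by move: zr; rewrite /far/= leNgt h.
Qed.

Lemma measurable_patch_ball (u eta : 'rV[R]_n -> R) x r :
  measurable_fun setT u -> measurable_fun setT eta ->
  measurable_fun setT (patch u (eball x r) eta).
Proof.
move=> mu_ me; apply: measurable_fun_ifT => //.
apply: (measurable_fun_bool true); rewrite setTI.
rewrite (_ : _ @^-1` _ = eball x r); first exact: measurable_eball.
by apply/seteqP; split => z /=; [move/set_mem|move/mem_set].
Qed.

(** The touching paraboloid itself serves as test function on the ball, so that
    only the integral of [u] outside the ball and the error of the ball remain. *)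
Lemma viscosity_touching (p q s1 s2 : R) : 2 <= p -> 2 <= q -> 0 < s1 < 1 ->
  0 < s2 < 1 -> exists c1 c2, [/\ 0 <= c1, 0 <= c2 &
  forall C (u : 'rV[R]_n -> R) x P M r,
    viscosity_solution p q s1 s2 C u -> measurable_fun setT u ->
    0 <= M -> 0 < r -> eball x r `<=` eball 0 2 ->
    let E p s c := c * (enorm P + M * r) `^ (p - 2) * M * r `^ (p * (1 - s)) in
    ((forall z, enorm z < r -> u (x + z) - u x <= edot P z + M * enorm z ^+ 2) ->
      - C <= (1 - s1) * (truncated p s1 u x r + E p s1 c1) +
             (1 - s2) * (truncated q s2 u x r + E q s2 c2)) /\
    ((forall z, enorm z < r -> edot P z - M * enorm z ^+ 2 <= u (x + z) - u x) ->
      (1 - s1) * (truncated p s1 u x r - E p s1 c1) +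
      (1 - s2) * (truncated q s2 u x r - E q s2 c2) <= C)].
Proof.
move=> p2 q2 s101 s201.
have [c1 c10 hc1] := frac_plaplacian_paraboloid p2 s101.
have [c2 c20 hc2] := frac_plaplacian_paraboloid q2 s201.
exists c1, c2; split => // C u x P M r vu mu_ M0 r0 xr2 E.
have [_ [_ tu1] [_ tu2] visc] := vu.
have xin : eball x r x by rewrite /eball/= subrr enorm0.
have x2 : enorm x <= 2.
  by have := xr2 _ xin; rewrite /eball/= subr0; exact: ltW.
pose eta N y := u x + edot P (y - x) + N * enorm (y - x) ^+ 2.
pose v N := patch u (eball x r) (eta N).
have etax N : eta N x = u x.
  by rewrite /eta subrr enorm0 -(scale0r (0 : 'rV[R]_n)) edotZr mul0r expr0n mulr0 !addr0.
have vx N : v N x = u x by rewrite /v /patch mem_set.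
have meta N : measurable_fun setT (eta N).
  rewrite (_ : eta N = (fun y => (fun z => u x + edot P z + N * enorm z ^+ 2) (- x + y))).
    apply: (measurableT_comp (f := fun z => u x + edot P z + N * enorm z ^+ 2));
      last exact: measurable_addv.
    apply: measurable_funD; last first.
      apply: measurable_funM => //; apply: measurable_funX; exact: measurable_enorm.
    by apply: measurable_funD => //; exact: measurable_edot.
  by apply/funext => y; rewrite /eta (addrC (- x) y).
have mv N : measurable_fun setT (v N) by exact: measurable_patch_ball.
have vnear N z : enorm z < r -> v N (x + z) - v N x = edot P z + N * enorm z ^+ 2.
  move=> zr; rewrite vx /v patch_ball_near// /eta [x + z]addrC addrK.
  by ring.
have vfar N z : far n r z -> v N (x + z) - v N x = u (x + z) - u x.
  by move=> zr; rewrite vx /v patch_ball_far.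
have tv p' s' N : truncated p' s' (v N) x r = truncated p' s' u x r.
  apply: eq_Rintegral => z; rewrite inE => zr.
  by rewrite /nonlocal vfar.
have iv p' s' N : 2 <= p' -> 0 < s' < 1 -> (tail_integral p' s' u < +oo)%E ->
    mu.-integrable (far n r)
      (EFin \o nonlocal p' s' (fun z => v N (x + z) - v N x)).
  move=> p'2 s'01 tu.
  apply: (@eq_integrable _ _ _ mu _ _ (EFin \o nonlocal p' s' (fun z => u (x + z) - u x))).
  - exact: measurable_far.
  - by move=> z; rewrite inE => zr; rewrite /= /nonlocal vfar.
  - exact: integrable_nonlocal.
split=> touch.
- have [h1 _] := hc1 (v M) x P M r M0 r0 (mv M) (iv p s1 M p2 s101 tu1).
  have [h2 _] := hc2 (v M) x P M r M0 r0 (mv M) (iv q s2 M q2 s201 tu2).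
  have [+ _] := visc x r (eta M) r0 xr2 (@paraboloid_C2 _ _ _ _ _ _ _) (etax M).
  have above y : eball x r y -> u y <= eta M y.
    move=> xy; have := touch (y - x) xy; rewrite [x + _]addrC subrK /eta; lra.
  move=> /(_ above); rewrite /mixed_op.
  move=> /(le_trans (leeD (h1 (vnear M)) (h2 (vnear M)))).
  by rewrite -EFinD lee_fin !tv -/(E p s1 c1) -/(E q s2 c2); lra.
- have vnear' z : enorm z < r -> v (- M) (x + z) - v (- M) x =
      edot P z - M * enorm z ^+ 2 by move=> zr; rewrite vnear// mulNr.
  have [_ h1] := hc1 (v (- M)) x P M r M0 r0 (mv (- M)) (iv p s1 (- M) p2 s101 tu1).
  have [_ h2] := hc2 (v (- M)) x P M r M0 r0 (mv (- M)) (iv q s2 (- M) q2 s201 tu2).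
  have [_ +] := visc x r (eta (- M)) r0 xr2 (@paraboloid_C2 _ _ _ _ _ _ _) (etax (- M)).
  have below y : eball x r y -> eta (- M) y <= u y.
    move=> xy; have := touch (y - x) xy; rewrite [x + _]addrC subrK /eta; lra.
  move=> /(_ below); rewrite /mixed_op.
  move=> /le_trans/(_ (leeD (h1 vnear') (h2 vnear'))).
  by rewrite -EFinD lee_fin !tv -/(E p s1 c1) -/(E q s2 c2); lra.
Qed.

End touching.

(** * Comparison of the operator at two points *)

Section splitting.
Context {R : realType} {n : nat}.
Local Notation mu := (@lebesgue_rV R n).

(** The domain is split into the set [Q] of the gain, the rest of the shell, where
    [e] dominates, and the tail. *)
Lemma far_integral_split_le (f e : 'rV[R]_n -> R) (Q : set 'rV[R]_n)
    (r rho k v I T : R) :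
  0 <= k -> r <= rho -> measurable Q -> Q `<=` far n r `\` far n rho ->
  mu Q = v%:E ->
  mu.-integrable (far n r) (EFin \o f) ->
  measurable_fun setT e -> (forall z, 0 <= e z) ->
  (forall z, Q z -> f z <= - k) ->
  (forall z, (far n r `\` far n rho) z -> f z <= e z) ->
  (\int[mu]_(z in far n r `\` far n rho) (e z)%:E <= I%:E)%E ->
  \int[mu]_(z in far n rho) f z <= T ->
  \int[mu]_(z in far n r) f z <= - (k * v) + I + T.
Proof.
move=> k0 rrho mQ QS Qv intf me e0 fQ fe eI fT.
have mr := @measurable_far R n r; have mrho := @measurable_far R n rho.
set S := far n r `\` far n rho in QS fe eI *.
have mS : measurable S by exact: measurableD.
have mSQ : measurable (S `\` Q) by exact: measurableD.
have subr : far n rho `<=` far n r by move=> z; exact: le_trans.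
have rE : far n r = S `|` far n rho by rewrite setUC setDUK.
have SE : S = (S `\` Q) `|` Q by rewrite setUC setDUK.
have intS : mu.-integrable S (EFin \o f).
  by apply: integrableS intf => //; exact: subDsetl.
have intSQ : mu.-integrable (S `\` Q) (EFin \o f).
  by apply: integrableS intS => //; exact: subDsetl.
have intQ : mu.-integrable Q (EFin \o f) by apply: integrableS intS.
rewrite rE Rintegral_setU//; last 2 first.
- by rewrite -rE.
- by rewrite disj_set2E /S setDE -setIA setICl setI0.
apply: lerD => //.
rewrite {1}SE Rintegral_setU//; last 2 first.
- by rewrite -SE.
- by rewrite disj_set2E setDE -setIA setICl setI0.
rewrite addrC; apply: lerD.
  apply: (@le_trans _ _ (\int[mu]_(z in Q) (- k))).
    apply: le_Rintegral => //; apply/integrableP; split.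
      by apply/measurable_EFinP; exact: measurable_cst.
    by under eq_integral do rewrite /=; rewrite integral_cst//= Qv ltry.
  by rewrite Rintegral_cst// [X in fine X](_ : _ = v%:E)//= mulNr.
have meE : measurable_fun setT (EFin \o e) by exact/measurable_EFinP.
rewrite -lee_fin /Rintegral fineK; last exact: integrable_fin_num.
apply: le_trans (eI); apply: (@le_trans _ _ (\int[mu]_(z in S `\` Q) (e z)%:E)%E).
  apply: le_integral => //.
  - apply/integrableP; split; first exact: measurable_funTS.
    apply: (@le_lt_trans _ _ (\int[mu]_(z in S) (e z)%:E)%E).
      under eq_integral do rewrite /= ger0_norm//.
      apply: ge0_subset_integral => //; first exact: (measurable_funTS meE).
      by move=> z _; rewrite lee_fin.
    by apply: le_lt_trans (ltry I).
  - by move=> z; rewrite inE => -[Sz _]; rewrite lee_fin fe.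
apply: ge0_subset_integral => //; first exact: (measurable_funTS meE).
by move=> z _; rewrite lee_fin.
Qed.

Lemma cube_near (c z : 'rV[R]_n) h : 0 <= h ->
  box (c - const_mx h) (c - const_mx h + const_mx (2 * h)) z ->
  enorm (z - c) <= n%:R * h.
Proof.
move=> h0 bz; apply: enorm_le_coord => // i; have := bz i.
by rewrite !mxE ler_norml => /andP[h1 h2]; apply/andP; split; lra.
Qed.

End splitting.

Section operator_estimate.
Context {R : realType} {n : nat}.
Local Notation mu := (@lebesgue_rV R n).

(** The factor [|z|^eps] is sacrificed to integrability at the origin; the minimum
    with [0] covers the exponents for which the integral stays bounded as [r]
    tends to [0]. *)
Lemma shell_error_le (eps : R) : 0 < eps -> exists2 C, 0 <= C &
  forall X r rho : R, 0 < r -> r <= 1 -> rho <= 1 ->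
  (\int[mu]_(z in far n r `\` far n rho) (enorm z `^ (X - n%:R))%:E <=
    (C * r `^ (Num.min 0 (X - eps)))%:E)%E.
Proof.
move=> e0; have [C C0 hC] := @inner_integral_le R n eps e0.
exists C => // X r rho r0 r1 rho1.
have mS : measurable (far n r `\` far n rho : set 'rV[R]_n).
  by apply: measurableD; exact: measurable_far.
have me b := @measurable_enorm_powR R n b.
set E := Num.min _ _.
apply: (@le_trans _ _ (\int[mu]_(z in far n r `\` far n rho)
    ((r `^ E)%:E * (enorm z `^ (eps - n%:R))%:E))%E).
  apply: ge0_le_integral => //=.
  - by move=> z _; rewrite lee_fin powR_ge0.
  - by apply/measurable_EFinP; exact: measurable_funTS.
  - by apply/measurable_EFinP; apply: measurable_funTS; exact: measurable_funM.
  move=> z [rz /negP]; rewrite /far/= -ltNge => zrho.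
  have z0 : 0 < enorm z by exact: lt_le_trans rz.
  have z1 : enorm z <= 1 by rewrite (le_trans (ltW zrho)).
  rewrite -EFinM lee_fin.
  have -> : X - n%:R = (X - eps) + (eps - n%:R) by ring.
  rewrite -powRDn// ler_wpM2r ?powR_ge0//.
  apply: (@le_trans _ _ (enorm z `^ E)).
    by apply: ger_powR; rewrite ?z0// /E ge_min lexx orbT.
  by apply: ler_powRl_neg => //; rewrite /E ge_min lexx.
rewrite ge0_integralZl//=; last 3 first.
- by apply/measurable_EFinP; exact: measurable_funTS.
- by move=> z _; rewrite lee_fin powR_ge0.
- by rewrite lee_fin powR_ge0.
rewrite mulrC EFinM; apply: lee_wpmul2l; first by rewrite lee_fin powR_ge0.
have r20 : 0 < r / 2 by rewrite divr_gt0.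
have := hC (r / 2) 1 r20 ltr01; rewrite powR1 mulr1; apply: le_trans.
apply: ge0_subset_integral => //.
- exact: measurable_shell.
- by apply/measurable_EFinP; exact: measurable_funTS.
- by move=> z _; rewrite lee_fin powR_ge0.
- move=> z [rz /negP]; rewrite /far/= -ltNge => zrho; rewrite /shell/=.
  apply/andP; split; last by rewrite (le_trans (ltW zrho)).
  by apply: lt_le_trans rz; lra.
Qed.

Lemma nonlocal_gain (p s A B b delta t : R) (z : 'rV[R]_n) :
  2 <= p -> 0 <= s * p -> 0 <= delta -> delta <= b -> b <= B ->
  A <= B - delta -> 0 < enorm z -> enorm z <= t ->
  nonlocal p s (fun=> A) z - nonlocal p s (fun=> B) z <=
    - (b `^ (p - 2) * delta * t `^ (- (n%:R + s * p))).
Proof.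
move=> p2 sp0 d0 db bB AB z0 zt; rewrite /nonlocal -mulrBl.
have h := signed_power_sub_gain p2 d0 db bB AB.
apply: le_trans (ler_wpM2r (powR_ge0 _ _) h) _.
rewrite mulNr lerN2 ler_wpM2l ?mulr_ge0 ?powR_ge0//.
by apply: ler_powRl_neg => //; rewrite oppr_le0 addr_ge0.
Qed.

(** If [A <= B], monotonicity gives the sign; otherwise the increments are
    controlled by [Lam |z|^m] and differ by at most the drift, and the mean value
    inequality applies. *)
Lemma nonlocal_error (p s A B w T Lam m : R) (z : 'rV[R]_n) :
  2 <= p -> 0 <= w -> 0 <= Lam -> 0 <= T -> 0 < enorm z ->
  A <= B + w * (T * enorm z + enorm z ^+ 2) ->
  (B <= A -> `|A| <= Lam * enorm z `^ m /\ `|B| <= Lam * enorm z `^ m) ->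
  nonlocal p s (fun=> A) z - nonlocal p s (fun=> B) z <=
    (p - 1) * w * Lam `^ (p - 2) *
     (T * enorm z `^ (m * (p - 2) + 1 - s * p - n%:R) +
      enorm z `^ (m * (p - 2) + 1 - s * p + 1 - n%:R)).
Proof.
move=> p2 w0 Lam0 T0 z0 ABw H; rewrite /nonlocal -mulrBl.
have p1 : 0 <= p - 1 by lra.
have [AB|BA] := lerP A B.
  apply: (@le_trans _ _ 0).
    by rewrite mulr_le0_ge0 ?powR_ge0// subr_le0 le_signed_power.
  by rewrite !mulr_ge0 ?powR_ge0// addr_ge0 ?mulr_ge0 ?powR_ge0.
have [Az Bz] := H (ltW BA).
have hs := signed_power_sub_le p2 (ltW BA) Az Bz.
apply: le_trans (ler_wpM2r (powR_ge0 _ _) hs) _.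
have AB : A - B <= w * (T * enorm z + enorm z ^+ 2) by rewrite lerBlDl.
have c0 : 0 <= (p - 1) * (Lam * enorm z `^ m) `^ (p - 2).
  by rewrite mulr_ge0 ?powR_ge0.
apply: le_trans (ler_wpM2r (powR_ge0 _ _) (ler_wpM2l c0 AB)) _.
rewrite powRM ?powR_ge0// -powRrM.
set E := enorm z `^ (- _).
have E1 : enorm z `^ (m * (p - 2) + 1 - s * p - n%:R) =
    enorm z `^ (m * (p - 2)) * (enorm z * E).
  rewrite -[X in _ * (X * _)](powRr1 (ltW z0)) /E !powRDn//.
  by congr (_ `^ _); ring.
have E2 : enorm z `^ (m * (p - 2) + 1 - s * p + 1 - n%:R) =
    enorm z `^ (m * (p - 2)) * (enorm z ^+ 2 * E).
  rewrite -(powR_mulrn 2 (ltW z0)) /E !powRDn//.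
  by congr (_ `^ _); ring.
by rewrite E1 E2 le_eqVlt; apply/orP; left; apply/eqP; ring.
Qed.

(** The lower end of the shell, [t^(1+sig)], produces the exponent in the
    hypothesis on [Gx]. *)
Lemma error_integral_le (sig th eps X Gx : R) : 0 < sig -> 0 <= th <= 1 ->
  0 < eps -> Gx <= 0 -> Gx <= th + (1 + sig) * Num.min 0 (X - eps) ->
  exists2 C, 0 <= C & forall c t rho : R, 0 <= c -> 0 < t <= 1 -> rho <= 1 ->
  (\int[mu]_(z in far n (t `^ (1 + sig)) `\` far n rho)
    (c * (t `^ th * enorm z `^ (X - n%:R) + enorm z `^ (X + 1 - n%:R)))%:E <=
   (c * (C * t `^ Gx))%:E)%E.
Proof.
move=> sig0 /andP[th0 th1] eps0 Gx0 GxE.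
have [C1 C10 hC1] := @shell_error_le eps eps0.
exists (2 * C1); first by rewrite mulr_ge0.
move=> c t rho c0 /andP[t0 t1] rho1; set r := t `^ (1 + sig).
have r0 : 0 < r by rewrite powR_gt0.
have sig1 : 0 <= 1 + sig by lra.
have r1 : r <= 1 by apply: powR_le1 => //; rewrite (ltW t0).
have mS : measurable (far n r `\` far n rho : set 'rV[R]_n).
  by apply: measurableD; exact: measurable_far.
have mE b : measurable_fun (far n r `\` far n rho : set 'rV[R]_n)
    (fun z => (enorm z `^ b)%:E).
  by apply/measurable_EFinP; apply: measurable_funTS; exact: measurable_enorm_powR.
have mE2 : measurable_fun (far n r `\` far n rho : set 'rV[R]_n)
    (fun z => ((t `^ th)%:E * (enorm z `^ (X - n%:R))%:E)%E).
  apply/measurable_EFinP; apply: measurable_funTS; apply: measurable_funM => //.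
  exact: measurable_enorm_powR.
under eq_integral do rewrite EFinM EFinD EFinM.
rewrite ge0_integralZl//=; last 2 first.
- exact: emeasurable_funD.
- move=> z _; rewrite -[leRHS]/((t `^ th * enorm z `^ (X - n%:R) +
    enorm z `^ (X + 1 - n%:R))%:E) lee_fin addr_ge0 ?mulr_ge0 ?powR_ge0//.
rewrite EFinM; apply: lee_wpmul2l; first by rewrite lee_fin.
rewrite ge0_integralD//=; last 2 first.
- by move=> z _; rewrite -EFinM lee_fin mulr_ge0 ?powR_ge0.
- by move=> z _; rewrite lee_fin powR_ge0.
rewrite ge0_integralZl//=; last 2 first.
- by move=> z _; rewrite lee_fin powR_ge0.
- by rewrite lee_fin powR_ge0.
have b1 := hC1 X r rho r0 r1 rho1.
have b2 := hC1 (X + 1) r rho r0 r1 rho1.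
have tth : (0 <= (t `^ th)%:E :> \bar R)%E by rewrite lee_fin powR_ge0.
apply: le_trans (leeD (lee_wpmul2l tth b1) b2) _.
rewrite -EFinM -EFinD lee_fin /r -!powRrM mulrCA powRDn//.
have -> : 2 * C1 * t `^ Gx = C1 * t `^ Gx + C1 * t `^ Gx by ring.
apply: lerD; rewrite ler_wpM2l//; apply: ger_powR; rewrite ?t0//.
have [Xe|Xe] := lerP 0 (X + 1 - eps); first by rewrite mulr0.
have E : Num.min 0 (X - eps) = X - eps by apply: min_r; lra.
rewrite E in GxE.
have -> : (1 + sig) * (X + 1 - eps) = (1 + sig) * (X - eps) + (1 + sig) by ring.
lra.
Qed.

(** A cube rather than a ball, because its volume is known exactly. *)
Lemma gain_cube (a : 'rV[R]_n) (h : R) : n%:R * h <= enorm a / 8 -> 0 <= h ->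
  let Q := box (4^-1 *: a - const_mx h) (4^-1 *: a - const_mx h + const_mx (2 * h)) in
  [/\ measurable Q, mu Q = ((2 * h) ^+ n)%:E,
     (forall z, Q z -> enorm (z - 4^-1 *: a) <= n%:R * h) &
     (forall z, Q z -> enorm a / 8 <= enorm z <= enorm a / 2)].
Proof.
move=> nht h0 Q.
have Qn z : Q z -> enorm (z - 4^-1 *: a) <= n%:R * h by exact: cube_near.
split => //.
- exact: measurable_box.
- by apply: lebesgue_rV_cube; rewrite mulr_ge0.
move=> z /Qn h1; have := ler_dist_enorm z (4^-1 *: a).
move=> /le_trans/(_ h1)/le_trans/(_ nht).
rewrite enormZ [`|4^-1|]ger0_norm ?invr_ge0// ler_norml => /andP[h2 h3].
by apply/andP; split; lra.
Qed.

Lemma tail_difference_le (p s A0 rho : R) : 2 <= p -> 0 < s < 1 -> 0 <= A0 ->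
  0 < rho -> exists2 C, 0 <= C &
  forall (u : 'rV[R]_n -> R) x y, measurable_fun setT u ->
    (tail_integral p s u <= A0%:E)%E -> enorm x <= 2 -> enorm y <= 2 ->
    `|u x| <= A0 -> `|u y| <= A0 ->
    \int[mu]_(z in far n rho) (nonlocal p s (fun z => u (x + z) - u x) z -
      nonlocal p s (fun z => u (y + z) - u y) z) <= C.
Proof.
move=> p2 s01 A00 rho0.
have [C C0 hC] := @far_integral_le R n p s p2 s01 A0 rho A00 rho0.
exists (2 * C); first by rewrite mulr_ge0.
move=> u x y mu_ tu x2 y2 ux uy.
have mf := @measurable_far R n rho.
have tuoo : (tail_integral p s u < +oo)%E by apply: le_lt_trans tu _; rewrite ltry.
have bnd v : enorm v <= 2 -> `|u v| <= A0 ->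
    `|\int[mu]_(z in far n rho) nonlocal p s (fun z => u (v + z) - u v) z| <= C.
  move=> v2 uv.
  have iv := integrable_nonlocal p2 s01 mu_ tuoo v2 rho0.
  apply: le_trans (le_normr_Rintegral _ iv) _ => //.
  rewrite -lee_fin /Rintegral fineK; first exact: hC.
  by apply: integrable_fin_num => //; exact: integrable_norm.
rewrite RintegralB//; try exact: integrable_nonlocal.
apply: le_trans (ler_norm _) _; apply: le_trans (ler_normB _ _) _.
by rewrite mulr_natl mulr2n; apply: lerD; exact: bnd.
Qed.

(** The comparison of the integrals of one operator at the two points of a
    maximum configuration.  On a small cube around [a / 4] the strict concavity
    of the profile separates the increments and produces the negative term;
    elsewhere near the origin the increments are ordered up to the drift, which
    produces the second term; the tails are bounded. *)
Lemma operator_estimate (p s A0 rho cb cd ct w gam alf sig th eps m Gx : R) :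
  (0 < n)%N -> 2 <= p -> 0 < s < 1 -> 0 <= A0 -> 0 < rho <= 1 -> 0 < cb ->
  0 < cd <= cb -> 0 < ct <= 1 / 8 -> 0 <= w -> 0 <= alf -> 0 < sig ->
  0 <= th <= 1 -> 0 < eps ->
  Gx <= 0 -> Gx <= th + (1 + sig) * Num.min 0 (m * (p - 2) + 1 - s * p - eps) ->
  exists kap K t0 : R, [/\ 0 < kap, 0 <= K, 0 < t0 <= 1 &
  forall (u : 'rV[R]_n -> R) (xb yb : 'rV[R]_n) (L Lam : R),
  measurable_fun setT u -> (tail_integral p s u <= A0%:E)%E ->
  enorm xb <= 2 -> enorm yb <= 2 -> `|u xb| <= A0 -> `|u yb| <= A0 ->
  0 <= L -> 0 <= Lam ->
  let a := xb - yb in let t := enorm a in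
  let A z := u (xb + z) - u xb in let B z := u (yb + z) - u yb in
  0 < t <= t0 ->
  (forall z, enorm z < rho -> A z <= B z + w * (t `^ th * enorm z + enorm z ^+ 2)) ->
  (forall z, enorm z < rho -> B z <= A z ->
    `|A z| <= Lam * enorm z `^ m /\ `|B z| <= Lam * enorm z `^ m) ->
  (forall z, enorm (z - 4^-1 *: a) <= ct * t `^ (1 + alf) ->
     cb * L * t `^ gam <= B z /\ A z <= B z - cd * L * t `^ (gam + alf)) ->
  truncated p s u xb (t `^ (1 + sig)) - truncated p s u yb (t `^ (1 + sig)) <=
    - (kap * L `^ (p - 1) * t `^ (gam * (p - 1) - s * p + alf * (n%:R + 1)))
    + K * Lam `^ (p - 2) * t `^ Gx + K].
Proof.
move=> n0 p2 s01 A00 /andP[rho0 rho1] cb0 /andP[cd0 cdb] /andP[ct0 ct8] w0 alf0.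
move=> sig0 th01 eps0 Gx0 GxE.
have sp0 : 0 <= s * p by case/andP: s01 => s0 _; rewrite mulr_ge0 ?(ltW s0)//; lra.
have p1 : 0 <= p - 1 by lra.
have p10 : 0 < p - 1 by lra.
have nR0 : 0 < n%:R :> R by rewrite ltr0n.
have [C1 C10 hC1] := error_integral_le sig0 th01 eps0 Gx0 GxE.
have [C2 C20 hC2] := tail_difference_le p2 s01 A00 rho0.
pose kap := cb `^ (p - 2) * cd * (2 * (ct / n%:R)) ^+ n.
have ctn0 : 0 < ct / n%:R by rewrite divr_gt0.
have kap0 : 0 < kap.
  by rewrite !mulr_gt0 ?powR_gt0// exprn_gt0// mulr_gt0.
pose K := (p - 1) * w * C1 + C2.
have K10 : 0 <= (p - 1) * w * C1 by rewrite !mulr_ge0.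
have K0 : 0 <= K by rewrite addr_ge0.
(* so that the ball of radius [t^(1+sig)] stays inside [|z| <= t / 8], off the cube *)
pose t0 := Num.min (8^-1 `^ (sig^-1)) rho.
have t00 : 0 < t0 by rewrite lt_min rho0 powR_gt0// invr_gt0.
have t01 : t0 <= 1 by rewrite ge_min rho1 orbT.
exists kap, K, t0; split => //; first exact/andP.
move=> u xb yb L Lam mu_ tu xb2 yb2 uxb uyb L0 Lam0 a t A B /andP[t_gt0 tt0].
move=> H1 H2 H3; set r := t `^ (1 + sig).
have t1 : t <= 1 by exact: le_trans tt0 t01.
have r0 : 0 < r by rewrite powR_gt0.
have rt8 : r <= t / 8.
  rewrite /r -powRDn// powRr1 ?(ltW t_gt0)// ler_wpM2l ?(ltW t_gt0)//.
  have : t <= 8^-1 `^ (sig^-1) by apply: le_trans tt0 _; rewrite ge_min lexx.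
  move=> /(ler_powRl (ltW sig0) (ltW t_gt0)).
  by rewrite -powRrM mulVf ?gt_eqF// powRr1// invr_ge0.
have trho : t <= rho by apply: le_trans tt0 _; rewrite ge_min lexx orbT.
have t8t : t / 8 <= t by rewrite ler_pdivrMr// ler_peMr ?(ltW t_gt0)// ler1n.
have rrho : r <= rho by apply: le_trans rt8 (le_trans t8t trho).
have tpos : 0 < t `^ (1 + alf) by rewrite powR_gt0.
pose h := ct * t `^ (1 + alf) / n%:R.
have h0 : 0 <= h by rewrite /h !mulr_ge0 ?invr_ge0 ?(ltW nR0) ?(ltW tpos) ?(ltW ct0).
have nh : n%:R * h = ct * t `^ (1 + alf).
  by rewrite /h mulrCA divff ?mulr1// gt_eqF.
have ta1 : t `^ (1 + alf) <= t by apply: ge1r_powR; rewrite ?t_gt0// lerDl.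
have nht : n%:R * h <= t / 8.
  rewrite nh; apply: le_trans (ler_wpM2r (ltW tpos) ct8) _.
  by rewrite mul1r mulrC ler_wpM2r.
have [mQ Qv Qn Qz] := gain_cube nht h0.
set Q := box _ _ in mQ Qv Qn Qz; clearbody Q.
have QS : Q `<=` far n r `\` far n rho.
  move=> z /Qz/andP[z1 z2]; split; first exact: le_trans rt8 z1.
  rewrite /far/= leNgt; apply/negP/negPn; apply: le_lt_trans z2 _.
  by apply: lt_le_trans trho; rewrite ltr_pdivrMr// ltr_pMr// ltr1n.
(* the pointwise gain on [Q], to be multiplied by the volume of [Q] *)
pose k := (cb * L * t `^ gam) `^ (p - 2) * (cd * L * t `^ (gam + alf)) *
   t `^ (- (n%:R + s * p)).
have d0 : 0 <= cd * L * t `^ (gam + alf) by rewrite !mulr_ge0 ?powR_ge0// ltW.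
have k0 : 0 <= k by rewrite !mulr_ge0 ?powR_ge0// ltW.
have dlt : cd * L * t `^ (gam + alf) <= cb * L * t `^ gam.
  rewrite ler_pM ?powR_ge0 ?mulr_ge0 ?(ltW cd0) ?ler_wpM2r//.
  by apply: ger_powR; rewrite ?t_gt0// lerDl.
pose c := (p - 1) * w * Lam `^ (p - 2).
have c0 : 0 <= c by rewrite !mulr_ge0 ?powR_ge0.
pose X := m * (p - 2) + 1 - s * p.
pose e (z : 'rV[R]_n) := c *
   (t `^ th * enorm z `^ (X - n%:R) + enorm z `^ (X + 1 - n%:R)).
have e0 z : 0 <= e z.
  apply: (mulr_ge0 c0); apply: addr_ge0; last exact: powR_ge0.
  by apply: mulr_ge0; exact: powR_ge0.
have me_ b := @measurable_enorm_powR R n b.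
have me : measurable_fun setT e.
  by apply: measurable_funM => //; apply: measurable_funD => //; exact: measurable_funM.
pose nlA := nonlocal p s A; pose nlB := nonlocal p s B.
have fQ z : Q z -> nlA z - nlB z <= - k.
  move=> zQ; have /andP[z1 z2] := Qz z zQ.
  have z0 : 0 < enorm z by apply: lt_le_trans z1; rewrite divr_gt0.
  have [h1 h2] : cb * L * t `^ gam <= B z /\ A z <= B z - cd * L * t `^ (gam + alf).
    by apply: H3; rewrite -nh; exact: Qn.
  apply: (@nonlocal_gain p s (A z) (B z)) => //.
  apply: le_trans z2 _; rewrite ler_pdivrMr// ler_peMr ?(ltW t_gt0)//.
  by rewrite ler1n.
have fe z : (far n r `\` far n rho) z -> nlA z - nlB z <= e z.
  move=> [rz /negP]; rewrite /far/= -ltNge => zrho.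
  have z0 : 0 < enorm z by exact: lt_le_trans rz.
  apply: (@nonlocal_error p s (A z) (B z));
    [exact: p2|exact: w0|exact: Lam0|exact: powR_ge0|exact: z0|exact: H1|exact: H2].
have eI := hC1 c t rho c0 _ rho1.
have {}eI := eI (introT andP (conj t_gt0 t1)).
have fT : \int[mu]_(z in far n rho) (nlA z - nlB z) <= C2 by exact: hC2.
have tuoo : (tail_integral p s u < +oo)%E by apply: le_lt_trans tu _; rewrite ltry.
have iA := integrable_nonlocal p2 s01 mu_ tuoo xb2 r0.
have iB := integrable_nonlocal p2 s01 mu_ tuoo yb2 r0.
have mfr := @measurable_far R n r.
have iAB : mu.-integrable (far n r) (EFin \o (fun z => nlA z - nlB z)).
  apply: (@eq_integrable _ _ _ mu _ _ (fun z => (nlA z)%:E - (nlB z)%:E)%E) => //.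
  exact: integrableB.
rewrite -[truncated p s u xb r]/(\int[mu]_(z in far n r) nlA z).
rewrite -[truncated p s u yb r]/(\int[mu]_(z in far n r) nlB z).
rewrite -RintegralB//.
have := far_integral_split_le k0 rrho mQ QS Qv iAB me e0 fQ fe eI fT.
move=> /le_trans; apply.
have kE : k * (2 * h) ^+ n = kap * L `^ (p - 1) *
    t `^ (gam * (p - 1) - s * p + alf * (n%:R + 1)).
  have hE : 2 * h = 2 * (ct / n%:R) * t `^ (1 + alf) by rewrite /h; ring.
  rewrite hE exprMn -[(t `^ (1 + alf)) ^+ n]powR_mulrn ?powR_ge0// -powRrM.
  rewrite /k !powRM ?mulr_ge0 ?powR_ge0 ?(ltW cb0)// -powRrM.
  have LE : L `^ (p - 1) = L * L `^ (p - 2).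
    by rewrite -(mulr_powRB1 L0 p10); congr (_ * _ `^ _); ring.
  have tE : t `^ (gam * (p - 1) - s * p + alf * (n%:R + 1)) =
      t `^ (gam * (p - 2)) * t `^ (gam + alf) * t `^ (- (n%:R + s * p)) *
      t `^ ((1 + alf) * n%:R).
    by rewrite !powRDn//; congr (_ `^ _); ring.
  by rewrite LE tE /kap; ring.
rewrite kE -addrA -[leRHS]addrA lerD2l /K.
have q1 : 0 <= C2 * (Lam `^ (p - 2) * t `^ Gx) by rewrite !mulr_ge0 ?powR_ge0.
have -> : ((p - 1) * w * C1 + C2) * Lam `^ (p - 2) * t `^ Gx =
   c * (C1 * t `^ Gx) + C2 * (Lam `^ (p - 2) * t `^ Gx) by rewrite /c; ring.
by apply: lerD; rewrite ?lerDl ?lerDr.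
Qed.

End operator_estimate.

(** * Concave profiles and maximum configurations *)

(** The slope [G] supports the concave [phi] from above at [t], with a quadratic
    gain near [t].  All quantities scale like those of [t^gam]; the exponent [alf]
    is a loss of concavity, which makes room for profiles that are almost linear. *)
Definition tangent_at {R : realType} (phi : R -> R) (gam alf c0 C0 t G : R) :=
  [/\ c0 * t `^ (gam - 1) <= G <= C0 * t `^ (gam - 1),
      forall w, 0 <= w -> phi w <= phi t + G * (w - t) &
      forall w, t / 2 <= w <= 2 * t ->
        phi w <= phi t + G * (w - t) - c0 * t `^ (gam - 2 + alf) * (w - t) ^+ 2].

(** The range [0, 2] contains the distances between points of a ball of radius
    at most [1]. *)
Definition profile {R : realType} (phi : R -> R) (gam alf c0 C0 : R) :=
  [/\ phi 0 = 0,
      forall w v, 0 <= w <= 2 -> 0 <= v <= 2 -> phi w - phi v <= C0 * `|w - v| `^ gam,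
      forall t, 0 <= t <= 2 -> c0 * t `^ gam <= phi t &
      forall t, 0 < t <= 1 -> exists G, tangent_at phi gam alf c0 C0 t G].

Section profile_lemmas.
Context {R : realType}.
Variables (phi : R -> R) (gam alf c0 C0 : R).

(** For a displacement by a quarter of [xb - yb], applied at one of the two
    points, the distance changes from [t] to [5 t / 4] or [3 t / 4].  The
    first-order terms of the two cases cancel, up to the size of the cube, so
    that only the concavity remains in the sum. *)
Lemma profile_gain (t G ct wp wm : R) : 0 < c0 -> 0 <= alf -> 0 < t <= 1 ->
  0 <= ct <= 1 / 8 -> 128 * (C0 * ct) <= c0 ->
  tangent_at phi gam alf c0 C0 t G ->
  `|wp - 5 / 4 * t| <= ct * t `^ (1 + alf) ->
  `|wm - 3 / 4 * t| <= ct * t `^ (1 + alf) ->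
  (phi wp - phi t) + (phi wm - phi t) <= - (c0 / 64 * t `^ (gam + alf)) /\
  phi wm - phi t <= - (c0 / 8 * t `^ gam).
Proof.
move=> c00 alf0 /andP[t0 t1] /andP[ct0 ct8] C0ct [/andP[G1 G2] tan tan2] hp hm.
set tau := ct * t `^ (1 + alf) in hp hm.
have tau0 : 0 <= tau by rewrite mulr_ge0 ?powR_ge0.
have ta : t `^ (1 + alf) <= t by apply: ge1r_powR; rewrite ?t0// lerDl.
have taut : tau <= t / 8.
  rewrite /tau (le_trans (ler_wpM2l ct0 ta))//.
  by rewrite (le_trans (ler_wpM2r (ltW t0) ct8))// mul1r mulrC.
have Gt : c0 * t `^ gam <= G * t.
  apply: le_trans (ler_wpM2r (ltW t0) G1); rewrite -mulrA.
  by rewrite -[X in _ * (_ * X)](powRr1 (ltW t0)) powRDn// subrK.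
have G0 : 0 <= G by apply: le_trans G1; rewrite mulr_ge0 ?powR_ge0 ?(ltW c00).
have tga : 0 <= t `^ (gam + alf) by exact: powR_ge0.
have Gtau : 2 * (G * tau) <= c0 / 64 * t `^ (gam + alf).
  have h1 : G * tau <= C0 * t `^ (gam - 1) * tau by rewrite ler_wpM2r.
  have h2 : C0 * t `^ (gam - 1) * tau = C0 * ct * t `^ (gam + alf).
    rewrite /tau mulrACA powRDn//; congr (_ * _ `^ _); ring.
  have h3 := ler_wpM2r tga C0ct.
  rewrite h2 in h1; move: h1 h3; set y := _ `^ _; set x := C0 * ct.
  by move=> h1 h3; lra.
set H := c0 * t `^ (gam - 2 + alf) in tan2.
have H0 : 0 <= H by rewrite mulr_ge0 ?powR_ge0 ?(ltW c00).
have HT : H * (t / 8) ^+ 2 = c0 / 64 * t `^ (gam + alf).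
  rewrite /H expr_div_n -(powR_mulrn 2 (ltW t0)).
  have -> : gam + alf = gam - 2 + alf + 2 by ring.
  by rewrite -(powRDn _ 2 t0); field.
move: hp hm; rewrite !ler_norml => /andP[p1 p2] /andP[m1 m2].
have hp2 := tan2 wp; have hm2 := tan2 wm.
have /hp2 {}hp2 : t / 2 <= wp <= 2 * t by apply/andP; split; lra.
have /hm2 {}hm2 : t / 2 <= wm <= 2 * t by apply/andP; split; lra.
have sp : H * (t / 8) ^+ 2 <= H * (wp - t) ^+ 2.
  by rewrite ler_wpM2l// ler_pXn2r ?nnegrE//; lra.
have sm : H * (t / 8) ^+ 2 <= H * (wm - t) ^+ 2.
  rewrite ler_wpM2l// -(sqrrN (wm - t)) ler_pXn2r ?nnegrE//; lra.
rewrite HT in sp sm.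
have Gs : G * (wp - t) + G * (wm - t) <= 2 * (G * tau).
  rewrite -mulrDr mulrCA ler_wpM2l//; lra.
have Gm : G * (wm - t) <= G * (- (t / 8)).
  by rewrite ler_wpM2l//; lra.
have Hm0 : 0 <= H * (wm - t) ^+ 2 by rewrite mulr_ge0// sqr_ge0.
move: hp2 hm2 sp sm Gs Gm Hm0 Gtau Gt.
move: (H * _) (H * _) (G * (wp - t)) (G * (wm - t)) (G * tau) (t `^ (gam + alf)).
move: (t `^ gam) => ? ? ? ? ? ? ?; rewrite mulrN mulrA; move: (G * t) => *.
by split; lra.
Qed.

End profile_lemmas.

Section configuration.
Context {R : realType} {n : nat}.

(** From [2 t (w - t) <= w^2 - t^2]. *)
Lemma enorm_addl_le (a z : 'rV[R]_n) : a != 0 ->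
  enorm (a + z) - enorm a <= (2 * edot a z + enorm z ^+ 2) / (2 * enorm a).
Proof.
move=> a0; have t0 : 0 < enorm a by rewrite enorm_gt0.
rewrite ler_pdivlMr ?mulr_gt0//.
have := enormD_sqr a z; set w := enorm (a + z); set t := enorm a => h.
have -> : 2 * edot a z + enorm z ^+ 2 = w ^+ 2 - t ^+ 2 by rewrite h; ring.
have := sqr_ge0 (w - t); nra.
Qed.

(** The error of the test paraboloids on the ball of radius [t^(1+sig)] carries
    the factor [t^(sig p (1-s))] relative to the scaling
    [L^(p-1) t^(gam (p-1) - s p)] of the problem. *)
Lemma paraboloid_error_le (p s gam sig cE C1 L t N M : R) :
  2 <= p -> 0 <= 1 - s -> 0 <= cE -> 0 <= C1 -> 0 <= L -> 0 < t <= 1 -> 0 <= sig ->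
  0 <= N <= C1 * L * t `^ (gam - 1) -> 0 <= M <= C1 * L * t `^ (gam - 2) ->
  cE * (N + M * t `^ (1 + sig)) `^ (p - 2) * M * (t `^ (1 + sig)) `^ (p * (1 - s))
  <= cE * (2 * C1) `^ (p - 2) * C1 * L `^ (p - 1) *
     t `^ (gam * (p - 1) - s * p + sig * (p * (1 - s))).
Proof.
move=> p2 s1 cE0 C10 L0 /andP[t0 t1] sig0 /andP[N0 NC] /andP[M0 MC].
have rt : t `^ (1 + sig) <= t by apply: ge1r_powR; rewrite ?t0// lerDl.
have MrC : M * t `^ (1 + sig) <= C1 * L * t `^ (gam - 1).
  apply: le_trans (ler_wpM2l M0 rt) _.
  apply: le_trans (ler_wpM2r (ltW t0) MC) _.
  have -> : gam - 1 = gam - 2 + 1 by ring.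
  by rewrite -(powRDn _ 1 t0) powRr1 ?(ltW t0)// mulrA.
have S0 : 0 <= N + M * t `^ (1 + sig) by rewrite addr_ge0// mulr_ge0// powR_ge0.
have SC : N + M * t `^ (1 + sig) <= 2 * C1 * L * t `^ (gam - 1).
  by apply: le_trans (lerD NC MrC) _; rewrite le_eqVlt; apply/orP; left; apply/eqP; ring.
have p20 : 0 <= p - 2 by lra.
have h1 := ler_powRl p20 S0 SC.
apply: (@le_trans _ _ (cE * (2 * C1 * L * t `^ (gam - 1)) `^ (p - 2) *
    (C1 * L * t `^ (gam - 2)) * (t `^ (1 + sig)) `^ (p * (1 - s)))).
  rewrite ler_wpM2r ?powR_ge0//; apply: ler_pM => //.
    by rewrite mulr_ge0 ?powR_ge0.
  by rewrite ler_wpM2l.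
rewrite !powRM ?mulr_ge0 ?powR_ge0// -!powRrM.
have LE : L `^ (p - 1) = L * L `^ (p - 2).
  have p10 : 0 < p - 1 by lra.
  by rewrite -(mulr_powRB1 L0 p10); congr (_ * _ `^ _); ring.
have tE : t `^ (gam * (p - 1) - s * p + sig * (p * (1 - s))) =
    t `^ ((gam - 1) * (p - 2)) * t `^ (gam - 2) * t `^ ((1 + sig) * (p * (1 - s))).
  by rewrite !powRDn//; congr (_ `^ _); ring.
by rewrite LE tE le_eqVlt; apply/orP; left; apply/eqP; ring.
Qed.

(** What is left of the maximality at [(xb, yb)] of
    [u x - u y - L phi(|x - y|) - m |x - x0|^2], with [q = xb - x0], when the first
    point moves, the second one moves, or both move in parallel. *)
Record configuration (u : 'rV[R]_n -> R) (xb yb q : 'rV[R]_n) (phi : R -> R)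
    (L m rho : R) : Prop := Configuration {
  config_upper : forall z, enorm z < rho -> u (xb + z) - u xb <=
    L * (phi (enorm (xb - yb + z)) - phi (enorm (xb - yb)))
    + m * (2 * edot q z + enorm z ^+ 2) ;
  config_lower : forall z, enorm z < rho ->
    - (L * (phi (enorm (xb - yb - z)) - phi (enorm (xb - yb)))) <=
    u (yb + z) - u yb ;
  config_order : forall z, enorm z < rho -> u (xb + z) - u xb <=
    u (yb + z) - u yb + m * (2 * edot q z + enorm z ^+ 2) }.

Section consequences.
Variables (u : 'rV[R]_n -> R) (xb yb q : 'rV[R]_n) (phi : R -> R).
Variables (L m rho gam alf c0 C0 G : R).
Hypothesis cfg : configuration u xb yb q phi L m rho.
Hypotheses (L1 : 1 <= L) (m0 : 0 <= m) (rho1 : rho <= 1) (c00 : 0 < c0).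
Hypotheses (gam1 : 0 < gam <= 1) (alf0 : 0 <= alf).
Local Notation a := (xb - yb).
Local Notation t := (enorm (xb - yb)).
Hypotheses (t01 : 0 < t <= 1) (tan : tangent_at phi gam alf c0 C0 t G).

Lemma config_paraboloid_above z : enorm z < rho ->
  u (xb + z) - u xb <= edot ((L * G / t) *: a + (2 * m) *: q) z +
    (L * G / (2 * t) + m) * enorm z ^+ 2.
Proof.
move=> zr; apply: le_trans (config_upper cfg zr) _.
have /andP[t0 _] := t01; have [/andP[G1 _] tan1 _] := tan.
have G0 : 0 <= G by apply: le_trans G1; rewrite mulr_ge0 ?powR_ge0 ?(ltW c00).
have h : phi (enorm (a + z)) - phi t <= G * (enorm (a + z) - t).
  by rewrite lerBlDl; apply: tan1; exact: enorm_ge0.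
have a0 : a != 0 by rewrite -enorm_gt0.
have L0 : 0 <= L by apply: le_trans L1.
have h2 := ler_wpM2l G0 (enorm_addl_le z a0).
have h3 := ler_wpM2l L0 (le_trans h h2).
rewrite edotDl !edotZl -/(edot a z).
apply: le_trans (lerD h3 (lexx _)) _.
rewrite le_eqVlt; apply/orP; left; apply/eqP.
by field; rewrite gt_eqF.
Qed.

Lemma config_paraboloid_below z : enorm z < rho ->
  edot ((L * G / t) *: a) z - (L * G / (2 * t) + m) * enorm z ^+ 2 <=
  u (yb + z) - u yb.
Proof.
move=> zr; apply: le_trans _ (config_lower cfg zr).
have /andP[t0 _] := t01; have [/andP[G1 _] tan1 _] := tan.
have G0 : 0 <= G by apply: le_trans G1; rewrite mulr_ge0 ?powR_ge0 ?(ltW c00).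
have h : phi (enorm (a - z)) - phi t <= G * (enorm (a - z) - t).
  by rewrite lerBlDl; apply: tan1; exact: enorm_ge0.
have a0 : a != 0 by rewrite -enorm_gt0.
have L0 : 0 <= L by apply: le_trans L1.
have h2 := ler_wpM2l G0 (enorm_addl_le (- z) a0).
have h3 := ler_wpM2l L0 (le_trans h h2).
rewrite lerNr; apply: le_trans (h3) _.
rewrite edotZl edotNr enormN opprB.
have mz : 0 <= m * enorm z ^+ 2 by rewrite mulr_ge0// sqr_ge0.
rewrite -subr_ge0; apply: le_trans mz _; rewrite le_eqVlt; apply/orP; left.
by apply/eqP; field; rewrite gt_eqF.
Qed.

(** In the cube around [a / 4], the bounds from above at [xb] and from below at
    [yb] add up to the concavity of the profile, which dominates the drift. *)
Lemma config_gain ct w th z : 0 <= ct <= 1 / 8 -> 128 * (C0 * ct) <= c0 ->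
  rho > t -> 0 <= w -> 256 * w <= c0 * L -> gam + alf <= 1 + th -> th <= 1 ->
  m * (2 * edot q z + enorm z ^+ 2) <= w * (t `^ th * enorm z + enorm z ^+ 2) ->
  enorm (z - 4^-1 *: a) <= ct * t `^ (1 + alf) ->
  c0 / 8 * L * t `^ gam <= u (yb + z) - u yb /\
  u (xb + z) - u xb <= u (yb + z) - u yb - c0 / 128 * L * t `^ (gam + alf).
Proof.
move=> ctr C0ct rhot w0 wL gath th1 hw hz; have /andP[t0 t1] := t01.
have L0 : 0 <= L by apply: le_trans L1.
have ta : t `^ (1 + alf) <= t by apply: ge1r_powR; rewrite ?t0// lerDl.
have /andP[ct0 ct8] := ctr.
have hz8 : enorm (z - 4^-1 *: a) <= t / 8.
  apply: le_trans hz _; apply: le_trans (ler_wpM2l ct0 ta) _.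
  by rewrite (le_trans (ler_wpM2r (ltW t0) ct8))// mul1r mulrC.
have zt : enorm z <= t.
  have := ler_enormD (z - 4^-1 *: a) (4^-1 *: a).
  rewrite subrK enormZ [`|4^-1|]ger0_norm ?invr_ge0//.
  by move: (enorm z) (enorm (z - _)) hz8 => *; lra.
have zrho : enorm z < rho by exact: le_lt_trans zt rhot.
have hp : `|enorm (a + z) - 5 / 4 * t| <= ct * t `^ (1 + alf).
  apply: le_trans hz.
  have -> : 5 / 4 * t = enorm ((5 / 4) *: a).
    by rewrite enormZ ger0_norm.
  apply: le_trans (ler_dist_enorm _ _) _.
  rewrite (_ : a + z - (5 / 4) *: a = z - 4^-1 *: a)//.
  by apply/rowP => i; rewrite !mxE; field.
have hm : `|enorm (a - z) - 3 / 4 * t| <= ct * t `^ (1 + alf).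
  apply: le_trans hz.
  have -> : 3 / 4 * t = enorm ((3 / 4) *: a).
    by rewrite enormZ ger0_norm.
  apply: le_trans (ler_dist_enorm _ _) _.
  rewrite enormB (_ : (3 / 4) *: a - (a - z) = z - 4^-1 *: a)//.
  by apply/rowP => i; rewrite !mxE; field.
have [g1 g2] := profile_gain c00 alf0 t01 ctr C0ct tan hp hm.
have hu := config_upper cfg zrho; have hl := config_lower cfg zrho.
have Lg1 := ler_wpM2l L0 g1; have Lg2 := ler_wpM2l L0 g2.
have tz : w * (t `^ th * enorm z + enorm z ^+ 2) <= 2 * w * t `^ (gam + alf).
  rewrite [2 * w]mulrC -mulrA ler_wpM2l//.
  have h1 : t `^ th * enorm z <= t `^ (gam + alf).
    apply: le_trans (ler_wpM2l (powR_ge0 _ _) zt) _.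
    rewrite -[X in _ * X](powRr1 (ltW t0)) powRDn//.
    by apply: ger_powR; rewrite ?t0// [th + 1]addrC.
  have h2 : enorm z ^+ 2 <= t `^ (gam + alf).
    apply: (@le_trans _ _ (t ^+ 2)); first by rewrite ler_pXn2r ?nnegrE ?enorm_ge0.
    rewrite -(powR_mulrn 2 (ltW t0)); apply: ger_powR; rewrite ?t0//.
    by apply: le_trans gath _; lra.
  by rewrite mulr_natl mulr2n; exact: lerD.
have wLt := ler_wpM2r (powR_ge0 t (gam + alf)) wL.
split.
  apply: le_trans hl; rewrite lerNr; apply: le_trans Lg2 _.
  by rewrite mulrN lerN2 le_eqVlt; apply/orP; left; apply/eqP; ring.
move: hu hl Lg1 tz hw wLt.
rewrite [L * (_ + (_ - _))]mulrDr.
move: (L * (phi (enorm (a + z)) - phi t)) (L * (phi (enorm (a - z)) - phi t)).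
move: (m * _) (w * (_ + _)) (u (xb + z) - u xb) (u (yb + z) - u yb).
move: (t `^ (gam + alf)) => T v1 v2 v3 v4 v5 v6 hu hl Lg1 tz hw wLt.
lra.
Qed.

End consequences.
End configuration.

(** * Absorption of the errors *)

Section absorption.
Context {R : realType}.

Lemma small_powR (D e b : R) : 0 <= D -> 0 < e -> 0 < b ->
  exists2 t1, 0 < t1 <= 1 & forall t, 0 < t <= t1 -> D * t `^ e <= b.
Proof.
move=> D0 e0 b0; have D1 : 0 < D + 1 by lra.
have x0 : 0 < b / (D + 1) by rewrite divr_gt0.
exists (Num.min 1 ((b / (D + 1)) `^ e^-1)).
  by rewrite lt_min ltr01 powR_gt0//= ge_min lexx.
move=> t /andP[t0]; rewrite le_min => /andP[t1 tx].
have h := ler_powRl (ltW e0) (ltW t0) tx.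
rewrite -powRrM mulVf ?gt_eqF// powRr1 ?(ltW x0)// in h.
apply: le_trans (ler_wpM2l D0 h) _.
rewrite mulrA ler_pdivrMr// mulrC; nra.
Qed.

(** The paraboloid error carries the extra factor [t^e] and is absorbed for small
    [t], whatever the sign of [g].  If [mode] holds, the error with [L^(p-2)] is
    absorbed in [L^(p-1)] for large [L], and [t^g >= 1] leaves a multiple of [L]. *)
Lemma absorb_errors (mode : bool) (p g e kap K D Ck Kh : R) :
  2 <= p -> 0 < e -> 0 < kap -> 0 <= K -> 0 <= D -> 0 <= Ck -> 0 <= Kh ->
  (mode -> g <= 0) ->
  exists k K2 L0 t0, [/\ 0 <= k, mode -> 0 < k, 1 <= L0, 0 < t0 <= 1 &
  forall L t, L0 <= L -> 0 < t <= t0 ->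
    - (kap * L `^ (p - 1) * t `^ g)
    + K * (if mode then Ck * L else Kh) `^ (p - 2) * t `^ (if mode then g else 0)
    + K + 2 * (D * L `^ (p - 1) * t `^ (g + e)) <= - (k * L) + K2].
Proof.
move=> p2 e0 kap0 K0 D0 Ck0 Kh0 g0.
have kap4 : 0 < kap / 4 by rewrite divr_gt0.
have [t0 t01 ht] := small_powR D0 e0 kap4.
pose cK := K * Ck `^ (p - 2).
have cK0 : 0 <= cK by rewrite mulr_ge0 ?powR_ge0.
have q0 : 0 <= 4 * cK / kap by apply: divr_ge0; [exact: mulr_ge0|exact: ltW].
exists (if mode then kap / 4 else 0), (K * Kh `^ (p - 2) + K).
exists (1 + 4 * cK / kap), t0; split => //.
- by case: (mode) => //; exact: ltW.
- by case: (mode).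
- by rewrite lerDl.
move=> L t LL /[dup] tt /andP[tp _].
have L1 : 1 <= L by lra.
have Lp : 0 < L by lra.
have cKL : cK <= kap / 4 * L.
  have h : 4 * cK / kap <= L by lra.
  by move: h; rewrite ler_pdivrMr// => h; lra.
have Lp1 : L `^ (p - 1) = L * L `^ (p - 2).
  have p10 : 0 < p - 1 by lra.
  by rewrite -(mulr_powRB1 (ltW Lp) p10); congr (_ * _ `^ _); ring.
have X0 : 0 <= L `^ (p - 1) * t `^ g by rewrite mulr_ge0 ?powR_ge0.
have hE : 2 * (D * L `^ (p - 1) * t `^ (g + e)) <=
    kap / 2 * (L `^ (p - 1) * t `^ g).
  have := ler_wpM2r X0 (ht _ tt); rewrite -(powRDn g e tp).
  move: (L `^ _) (t `^ g) (t `^ e) => *; lra.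
have KK : 0 <= K * Kh `^ (p - 2) by rewrite mulr_ge0 ?powR_ge0.
case: (mode) g0 => [g0|_]; last first.
  rewrite powRr0 mulr1 mul0r oppr0 add0r.
  have kX := mulr_ge0 (ltW kap0) X0; move: hE kX; rewrite -[kap * L `^ _ * _]mulrA.
  by move: (L `^ _ * _) (2 * _) (K * _) => *; lra.
have h1 : K * (Ck * L) `^ (p - 2) * t `^ g <= kap / 4 * (L `^ (p - 1) * t `^ g).
  rewrite powRM ?(ltW Lp)// mulrA -/cK Lp1 !mulrA.
  by rewrite ler_wpM2r ?powR_ge0// ler_wpM2r ?powR_ge0.
have h2 : L <= L `^ (p - 1) * t `^ g.
  have tg : 1 <= t `^ g.
    have := @ger_powR _ t _ _ _ (g0 isT); rewrite powRr0; apply.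
    by rewrite tp; case/andP: t01 => _; apply: le_trans; case/andP: tt.
  have LL2 : L <= L `^ (p - 1).
    by rewrite -[leLHS]powRr1 ?(ltW Lp)//; apply: ler_powR => //; lra.
  by rewrite -[leLHS]mulr1; apply: ler_pM => //; lra.
have h3 := ler_wpM2l (ltW kap4) h2.
move: hE h1 h3 KK; rewrite -[kap * L `^ _ * _]mulrA.
move: (L `^ _ * _) (2 * _) (K * Kh `^ _) (K * _ `^ _ * _) => *; lra.
Qed.

End absorption.

Section operator_conclusion.
Context {R : realType} {n : nat}.

Definition gain_exponent (p s gam alf : R) :=
  gam * (p - 1) - s * p + alf * (n%:R + 1).

(** The conditions on the exponents for one of the two operators; [mode] tells
    whether the increments of [u] are controlled by the profile ([L |z|^gam]) or
    by the Hoelder continuity already known ([K |z|^kap]). *)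
Definition admissible (mode : bool) (p s gam alf kap sig eps : R) :=
  alf * (n%:R + 1) < sig * (p * (1 - s)) /\
  if mode then
    gain_exponent p s gam alf <= 0 /\
    gain_exponent p s gam alf <=
      kap / 2 + (1 + sig) * Num.min 0 (gam * (p - 2) + 1 - s * p - eps)
  else 0 <= kap / 2 + (1 + sig) * Num.min 0 (kap * (p - 2) + 1 - s * p - eps).

Section modulus.
Variables (u : 'rV[R]_n -> R) (xb yb q : 'rV[R]_n) (phi : R -> R).
Variables (L m rho gam alf c0 C0 : R).
Hypothesis cfg : configuration u xb yb q phi L m rho.
Hypotheses (L1 : 1 <= L) (m0 : 0 <= m) (rho1 : rho <= 1) (C00 : 0 <= C0).
Hypotheses (gam1 : 0 < gam <= 1) (q1 : enorm q <= 1).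
Hypotheses (t1 : enorm (xb - yb) <= 1) (prof : profile phi gam alf c0 C0).
Local Notation a := (xb - yb).
Local Notation t := (enorm (xb - yb)).

Lemma profile_increment z : enorm z <= 1 ->
  phi (enorm (a + z)) - phi t <= C0 * enorm z `^ gam.
Proof.
move=> z1; have [_ hphi _ _] := prof; have /andP[gam0 _] := gam1.
have az2 : 0 <= enorm (a + z) <= 2.
  by rewrite enorm_ge0/= (le_trans (ler_enormD _ _))// -[2]/(1 + 1) lerD.
have t2 : 0 <= t <= 2 by rewrite enorm_ge0/= (le_trans t1)// ler1n.
apply: le_trans (hphi _ _ az2 t2) _.
rewrite ler_wpM2l//; apply: ler_powRl => //; first exact: ltW.
by apply: le_trans (ler_dist_enorm _ _) _; rewrite addrC addKr.
Qed.

(** Where the increments are in the unfavourable order, the upper bound for the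
    larger one and the lower bound for the smaller one control both. *)
Lemma config_modulus z : enorm z < rho ->
  u (yb + z) - u yb <= u (xb + z) - u xb ->
  `|u (xb + z) - u xb| <= (C0 + 3 * m) * L * enorm z `^ gam /\
  `|u (yb + z) - u yb| <= (C0 + 3 * m) * L * enorm z `^ gam.
Proof.
move=> zr BA; have hu := config_upper cfg zr; have hl := config_lower cfg zr.
have z1 : enorm z <= 1 by rewrite (le_trans (ltW zr)).
have /andP[gam0 gam1'] := gam1.
have i1 := profile_increment z1.
have i2 : phi (enorm (a - z)) - phi t <= C0 * enorm z `^ gam.
  by rewrite -[enorm z]enormN; apply: profile_increment; rewrite enormN.
have L0 : 0 <= L by apply: le_trans L1.
have zg : enorm z <= enorm z `^ gam.
  have := enorm_ge0 z; rewrite le_eqVlt => /predU1P[<-|z0]; first exact: powR_ge0.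
  by rewrite -[leLHS](powRr1 (ltW z0)) ger_powR// z0.
have z2 : enorm z ^+ 2 <= enorm z `^ gam.
  apply: le_trans zg; rewrite expr2 -[leRHS]mulr1.
  by rewrite ler_wpM2l ?enorm_ge0.
have qz : edot q z <= enorm z `^ gam.
  apply: le_trans (edot_le _ _) _; apply: le_trans zg.
  by rewrite -[leRHS]mul1r ler_wpM2r ?enorm_ge0.
have W0 : 0 <= enorm z `^ gam by exact: powR_ge0.
have e1 : L * (phi (enorm (a + z)) - phi t) <= L * (C0 * enorm z `^ gam).
  by rewrite ler_wpM2l.
have e2 : L * (phi (enorm (a - z)) - phi t) <= L * (C0 * enorm z `^ gam).
  by rewrite ler_wpM2l.
have e3 : m * (2 * edot q z + enorm z ^+ 2) <= m * (3 * enorm z `^ gam).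
  by rewrite ler_wpM2l//; lra.
have e4 : m * (3 * enorm z `^ gam) <= 3 * m * L * enorm z `^ gam.
  have : 0 <= m * enorm z `^ gam by rewrite mulr_ge0.
  by move: L1; set x := m * _ => l1 x0; have := ler_wpM2r x0 l1; rewrite /x; lra.
have e5 : (C0 + 3 * m) * L * enorm z `^ gam =
  L * (C0 * enorm z `^ gam) + 3 * m * L * enorm z `^ gam by ring.
have e6 : 0 <= 3 * m * L * enorm z `^ gam by rewrite !mulr_ge0.
move: e1 e2 e3 e4 e6 hu hl BA; rewrite e5.
move: (L * (phi (enorm (a + z)) - phi t)) (L * (phi (enorm (a - z)) - phi t)).
move: (3 * m * L * _) (m * (3 * _)) (m * (_ + _)) (L * (C0 * _)).
move: (u (yb + z) - u yb) (u (xb + z) - u xb) => *.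
by rewrite !ler_norml; split; apply/andP; split; lra.
Qed.

End modulus.

(** Slope and curvature of the two test paraboloids; the penalisation is of lower
    order because [t <= 1 <= L]. *)
Lemma paraboloid_size (a q : 'rV[R]_n) (L G m gam alf c0 C0 : R) (phi : R -> R) :
  0 <= c0 -> 1 <= L -> 0 <= m -> gam <= 1 -> enorm q <= 1 ->
  0 < enorm a <= 1 -> tangent_at phi gam alf c0 C0 (enorm a) G ->
  let t := enorm a in
  [/\ enorm ((L * G / t) *: a + (2 * m) *: q) <= (C0 + 2 * m) * L * t `^ (gam - 1),
     enorm ((L * G / t) *: a) <= (C0 + 2 * m) * L * t `^ (gam - 1) &
     0 <= L * G / (2 * t) + m <= (C0 + 2 * m) * L * t `^ (gam - 2)].
Proof.
move=> c00 L1 m0 gam1 q1; set t := enorm a => /andP[t0 t1] [/andP[G1 G2] _ _].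
have L0 : 0 <= L by apply: le_trans L1.
have G0 : 0 <= G by apply: le_trans G1; rewrite mulr_ge0 ?powR_ge0.
have LG0 : 0 <= L * G / t by rewrite divr_ge0 ?(ltW t0)// mulr_ge0.
have aE : enorm ((L * G / t) *: a) = L * G.
  by rewrite enormZ ger0_norm// -/t; field; rewrite gt_eqF.
have LG : L * G <= C0 * L * t `^ (gam - 1).
  by rewrite [C0 * L]mulrC -mulrA ler_wpM2l.
have pow1 b : b <= 0 -> 1 <= t `^ b.
  by move=> b0; have := @ger_powR _ t _ _ _ b0; rewrite powRr0; apply; rewrite t0.
have mL b : b <= 0 -> m <= m * L * t `^ b.
  move=> b0; rewrite -mulrA -[leLHS]mulr1 ler_wpM2l//.
  by rewrite -[leLHS]mulr1; apply: ler_pM => //; exact: pow1.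
have m1 : m <= m * L * t `^ (gam - 1) by apply: mL; lra.
have m2 : m <= m * L * t `^ (gam - 2) by apply: mL; lra.
have qE : enorm ((2 * m) *: q) <= 2 * m.
  rewrite enormZ ger0_norm ?mulr_ge0// -[leRHS]mulr1 ler_wpM2l ?mulr_ge0//.
have Gt : L * G / t <= C0 * L * t `^ (gam - 2).
  rewrite ler_pdivrMr//; apply: le_trans LG _.
  have -> : gam - 1 = gam - 2 + 1 by ring.
  by rewrite -(powRDn _ 1 t0) powRr1 ?(ltW t0)// mulrA.
have e1 : L * G / (2 * t) = L * G / t / 2 by field; rewrite gt_eqF.
split.
- apply: le_trans (ler_enormD _ _) _; rewrite aE.
  by move: qE LG m1; move: (enorm _) (t `^ _) => *; lra.
- rewrite aE; apply: le_trans LG _; move: m1; move: (t `^ _) => *; lra.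
- rewrite e1; move: LG0 Gt m2; move: (L * G / t) (t `^ _) => *.
  by apply/andP; split; lra.
Qed.

Lemma drift_le (q : 'rV[R]_n) (m Cq T : R) : 0 <= m -> 0 <= Cq -> 0 <= T -> enorm q <= Cq * T ->
  forall z, m * (2 * edot q z + enorm z ^+ 2) <=
    m * (2 * Cq + 1) * (T * enorm z + enorm z ^+ 2).
Proof.
move=> m0 Cq0 T0 qt z.
have e1 : edot q z <= Cq * T * enorm z.
  by apply: le_trans (edot_le _ _) _; rewrite ler_wpM2r ?enorm_ge0.
have e0 : 0 <= Cq * T by apply: le_trans (enorm_ge0 q) qt.
rewrite -mulrA ler_wpM2l//.
have x0 := mulr_ge0 T0 (enorm_ge0 z).
have y0 := mulr_ge0 Cq0 (sqr_ge0 (enorm z)).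
by move: e1 x0 y0; rewrite -mulrA mulrDl mul1r; move: (edot q z) (T * _) (enorm z ^+ 2) => *; lra.
Qed.

(** One operator, with its errors absorbed: its contribution to the difference of
    the two tested equations decreases linearly in [L] if [mode] holds, and is
    otherwise at worst a constant. *)
Lemma operator_conclusion (mode : bool)
    (p s A0 rho gam alf sig eps kap Kh c0 C0 m Cq cE : R) :
  (0 < n)%N -> 2 <= p -> 0 < s < 1 -> 0 <= A0 -> 0 < rho <= 1 ->
  0 < gam <= 1 -> 0 <= alf -> 0 < sig -> 0 <= kap <= 1 -> 0 < eps ->
  0 < c0 <= C0 -> 0 <= m -> 0 <= Cq -> 0 <= Kh -> 0 <= cE ->
  gam + alf <= 1 + kap / 2 -> admissible mode p s gam alf kap sig eps ->
  exists k K2 L0 t0, [/\ 0 <= k, mode -> 0 < k, 1 <= L0, 0 < t0 <= 1 &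
  forall (phi : R -> R) (u : 'rV[R]_n -> R) (xb yb q : 'rV[R]_n) (L G : R),
  let a := xb - yb in let t := enorm (xb - yb) in
  let r := t `^ (1 + sig) in
  let M := L * G / (2 * t) + m in
  let E P := cE * (enorm P + M * r) `^ (p - 2) * M * r `^ (p * (1 - s)) in
  profile phi gam alf c0 C0 -> tangent_at phi gam alf c0 C0 t G ->
  measurable_fun setT u -> (tail_integral p s u <= A0%:E)%E ->
  enorm xb <= 2 -> enorm yb <= 2 -> `|u xb| <= A0 -> `|u yb| <= A0 ->
  enorm q <= 1 -> enorm q <= Cq * t `^ (kap / 2) ->
  (forall z, enorm z < rho -> `|u (xb + z) - u xb| <= Kh * enorm z `^ kap) ->
  (forall z, enorm z < rho -> `|u (yb + z) - u yb| <= Kh * enorm z `^ kap) ->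
  configuration u xb yb q phi L m rho ->
  L0 <= L -> 0 < t <= t0 ->
  (truncated p s u xb r + E ((L * G / t) *: a + (2 * m) *: q)) -
  (truncated p s u yb r - E ((L * G / t) *: a)) <= - (k * L) + K2].
Proof.
move=> n0 p2 /[dup] s01 /andP[s0 s1] A00 /[dup] rr /andP[rho0 rho1].
move=> /[dup] gam01 /andP[gam0 gam1] alf0 sig0 /andP[kap0 kap1] eps0.
move=> /andP[c00 cC] m0 Cq0 Kh0 cE0 gath [adm1 adm2].
set g := gain_exponent p s gam alf in adm2.
have s1' : 0 <= 1 - s by lra.
have sumE x y (e f : R) : x + e - (y - f) = x - y + (e + f) by ring.
have C00 : 0 < C0 by exact: lt_le_trans cC.
pose w := m * (2 * Cq + 1).
have w0 : 0 <= w by rewrite mulr_ge0// addr_ge0// mulr_ge0.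
(* the largest cube for which the first-order terms of [profile_gain] are dominated *)
pose ct := c0 / (128 * C0).
have ct0 : 0 < ct by rewrite divr_gt0// mulr_gt0.
have ct8 : ct <= 1 / 8.
  by rewrite ler_pdivrMr ?mulr_gt0//; lra.
have C0ct : 128 * (C0 * ct) <= c0.
  by rewrite le_eqVlt; apply/orP; left; apply/eqP; rewrite /ct; field; rewrite gt_eqF.
have cb0 : 0 < c0 / 8 by rewrite divr_gt0.
have cdb : 0 < c0 / 128 <= c0 / 8 by apply/andP; split; lra.
have th01 : 0 <= kap / 2 <= 1 by apply/andP; split; lra.
pose mm := if mode then gam else kap; pose Gx := if mode then g else 0.
have Gx0 : Gx <= 0 by rewrite /Gx; case: (mode) adm2 => // -[].
have GxE : Gx <= kap / 2 + (1 + sig) * Num.min 0 (mm * (p - 2) + 1 - s * p - eps).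
  by rewrite /Gx /mm; case: (mode) adm2 => // -[].
have ctr : 0 < ct <= 1 / 8 by rewrite ct0.
have [kp [K [t0 [kp0 K0 /andP[t00 t01] hop]]]] := @operator_estimate R n
  p s A0 rho (c0 / 8) (c0 / 128) ct w gam alf sig (kap / 2) eps mm Gx n0 p2 s01 A00 rr
  cb0 cdb ctr w0 alf0 sig0 th01 eps0 Gx0 GxE.
pose C1 := C0 + 2 * m.
have C10 : 0 <= C1 by rewrite addr_ge0 ?mulr_ge0 ?(ltW C00).
pose D := cE * (2 * C1) `^ (p - 2) * C1.
have D0 : 0 <= D by rewrite !mulr_ge0 ?powR_ge0.
pose e := sig * (p * (1 - s)) - alf * (n%:R + 1).
have e0 : 0 < e by rewrite subr_gt0.
have Ck0 : 0 <= C0 + 3 * m by rewrite addr_ge0 ?mulr_ge0 ?(ltW C00).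
have modeg : mode -> g <= 0 by case: (mode) adm2 => // -[].
have [k [K2 [L1 [t1 [k0 modek L11 /andP[t10 t11] habs]]]]] :=
  absorb_errors p2 e0 kp0 K0 D0 Ck0 Kh0 modeg.
pose L0 := L1 + 256 * w / c0.
have wc0 : 0 <= 256 * w / c0 := divr_ge0 (mulr_ge0 (ler0n _ _) w0) (ltW c00).
pose t2 := Num.min (rho / 2) (Num.min t0 t1).
have t20 : 0 < t2 by rewrite !lt_min t00 t10 divr_gt0.
exists k, K2, L0, t2; split => //; first by rewrite (le_trans L11)// lerDl.
  by rewrite t20 /t2 !ge_min t01 !orbT.
move=> phi u xb yb q L G a t r M E prof tan mu_ tu xb2 yb2 uxb uyb q1 qt hx hy cfg LL.
move=> /andP[tp]; rewrite /t2 !le_min => /and3P[trho tt0 tt1].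
have trho' : t < rho by apply: le_lt_trans trho _; rewrite ltr_pdivrMr// ltr_pMr ?ltr1n.
have tle1 : t <= 1 by exact: le_trans tt0 t01.
have LL1 : L1 <= L by apply: le_trans LL; rewrite lerDl.
have Lge1 : 1 <= L by exact: le_trans LL1.
have Lge0 : 0 <= L by exact: le_trans Lge1.
have wL : 256 * w <= c0 * L.
  rewrite [leRHS]mulrC -ler_pdivrMr//; apply: le_trans LL.
  by rewrite lerDr (le_trans _ L11).
have hw := drift_le m0 Cq0 (powR_ge0 _ _) qt.
pose Lam := if mode then (C0 + 3 * m) * L else Kh.
have Lam0 : 0 <= Lam by rewrite /Lam; case: (mode) => //; rewrite mulr_ge0.
have tp01 : 0 < t <= 1 by rewrite tp.
have hH1 z : enorm z < rho -> u (xb + z) - u xb <=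
    u (yb + z) - u yb + w * (t `^ (kap / 2) * enorm z + enorm z ^+ 2).
  by move=> zr; apply: le_trans (config_order cfg zr) _; rewrite lerD2l.
have hH2 z : enorm z < rho -> u (yb + z) - u yb <= u (xb + z) - u xb ->
    `|u (xb + z) - u xb| <= Lam * enorm z `^ mm /\
    `|u (yb + z) - u yb| <= Lam * enorm z `^ mm.
  move=> zr BA; rewrite /Lam /mm; case: (mode); last by split; [exact: hx|exact: hy].
  exact: (config_modulus cfg Lge1 m0 rho1 (ltW C00) gam01 q1 tle1 prof zr BA).
have hH3 z : enorm (z - 4^-1 *: a) <= ct * t `^ (1 + alf) ->
    c0 / 8 * L * t `^ gam <= u (yb + z) - u yb /\
    u (xb + z) - u xb <= u (yb + z) - u yb - c0 / 128 * L * t `^ (gam + alf).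
  have ctr' : 0 <= ct <= 1 / 8 by rewrite (ltW ct0).
  have th1 : kap / 2 <= 1 by case/andP: th01.
  exact: (config_gain cfg Lge1 c00 alf0 tp01 tan ctr' C0ct trho' w0 wL gath th1 (hw z)).
have t_t0 : 0 < t <= t0 by rewrite tp.
have h1 := hop u xb yb L Lam mu_ tu xb2 yb2 uxb uyb Lge0 Lam0 t_t0 hH1 hH2 hH3.
have c00' := ltW c00.
have [P1 P2 M1] := paraboloid_size c00' Lge1 m0 gam1 q1 tp01 tan.
have N1 : 0 <= enorm ((L * G / t) *: a + (2 * m) *: q) <= C1 * L * t `^ (gam - 1).
  by rewrite enorm_ge0.
have N2 : 0 <= enorm ((L * G / t) *: a) <= C1 * L * t `^ (gam - 1).
  by rewrite enorm_ge0.
have h2 := paraboloid_error_le p2 s1' cE0 C10 Lge0 tp01 (ltW sig0) N1 M1.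
have h3 := paraboloid_error_le p2 s1' cE0 C10 Lge0 tp01 (ltW sig0) N2 M1.
have t_t1 : 0 < t <= t1 by rewrite tp.
have := habs L t LL1 t_t1; apply: le_trans.
have -> : g + e = gam * (p - 1) - s * p + sig * (p * (1 - s)).
  by rewrite /g /e /gain_exponent; ring.
rewrite sumE; apply: lerD; first exact: h1.
by rewrite [leRHS]mulr_natl [leRHS]mulr2n; exact: (lerD h2 h3).
Qed.

End operator_conclusion.

(** * Two profiles and the doubled function *)

Section profiles.
Context {R : realType}.

Lemma powR_scale (b t w : R) : 0 < t -> 0 <= w -> w `^ b = t `^ b * (w / t) `^ b.
Proof.
move=> t0 w0; rewrite -powRM ?(ltW t0)//; last by rewrite divr_ge0// ltW.
by congr (_ `^ _); field; rewrite gt_eqF.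
Qed.

(** Subadditivity, from [x <= x^b] for the two fractions [(w - v) / w] and [v / w]. *)
Lemma powR_sub_le (b w v : R) : 0 < b <= 1 -> 0 <= w -> 0 <= v ->
  w `^ b - v `^ b <= `|w - v| `^ b.
Proof.
move=> /andP[b0 b1] w0 v0.
have [wv|vw] := lerP w v.
  apply: (@le_trans _ _ 0); last exact: powR_ge0.
  by rewrite subr_le0; apply: ler_powRl => //; exact: ltW.
have d0 : 0 < w - v by rewrite subr_gt0.
have wp : 0 < w by exact: le_lt_trans vw.
rewrite lerBlDr.
have h x : 0 <= x <= 1 -> x <= x `^ b.
  move=> /andP[x0 x1]; move: x0; rewrite le_eqVlt => /predU1P[<-|x0].
    exact: powR_ge0.
  by rewrite -[leLHS](powRr1 (ltW x0)) ger_powR// x0.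
have e1 : (w - v) / w + v / w = 1 by field; rewrite gt_eqF.
have a1 : 0 <= (w - v) / w by rewrite divr_ge0 ?ltW.
have a2 : 0 <= v / w by rewrite divr_ge0// ltW.
have h1 : (w - v) / w <= ((w - v) / w) `^ b.
  by apply: h; rewrite a1 -e1 lerDl.
have h2 : v / w <= (v / w) `^ b by apply: h; rewrite a2 -e1 lerDr.
rewrite (powR_scale b wp (ltW d0)) (powR_scale b wp v0) -mulrDr.
by rewrite -[leLHS]mulr1 ler_wpM2l ?powR_ge0// -e1 lerD.
Qed.

Lemma profile_powR (gam : R) : 0 < gam < 1 ->
  profile (fun t => t `^ gam) gam 0 (Num.min gam (1 - gam) / 9) 1.
Proof.
move=> /[dup] g01 /andP[g0 g1]; set c0 := _ / 9.
have cg : c0 <= gam.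
  have : Num.min gam (1 - gam) <= gam by rewrite ge_min lexx.
  by rewrite /c0; move: (Num.min _ _) => x; lra.
split.
- by rewrite powR0// gt_eqF.
- move=> w v /andP[w0 _] /andP[v0 _]; rewrite mul1r.
  by apply: powR_sub_le => //; rewrite g0 ltW.
- move=> t _; rewrite -[leRHS]mul1r ler_wpM2r ?powR_ge0//.
  by apply: le_trans cg _; exact: ltW.
- move=> t /andP[t0 t1]; exists (gam * t `^ (gam - 1)).
  have tE : t `^ (gam - 1) = t `^ gam / t by rewrite -powRBn// powRr1// ltW.
  split.
  + by rewrite mul1r ler_wpM2r ?powR_ge0//= ler_piMl ?powR_ge0// ltW.
  + move=> w w0; rewrite (powR_scale gam t0 w0).
    have g01' : 0 <= gam <= 1 by rewrite !ltW.
    have x0 : 0 <= w / t by rewrite divr_ge0// ltW.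
    apply: le_trans (ler_wpM2l (powR_ge0 t gam) (powR_le_tangent g01' x0)) _.
    rewrite le_eqVlt; apply/orP; left; apply/eqP.
    by rewrite tE; field; rewrite gt_eqF.
  + move=> w /andP[w1 w2].
    have w0 : 0 <= w by apply: le_trans w1; rewrite divr_ge0// ltW.
    rewrite (powR_scale gam t0 w0).
    have x04 : 0 <= w / t <= 4.
      rewrite divr_ge0 ?(ltW t0)//= ler_pdivrMr//; lra.
    apply: le_trans (ler_wpM2l (powR_ge0 t gam) (powR_le_tangent_sqr g01 x04)) _.
    rewrite le_eqVlt; apply/orP; left; apply/eqP.
    have -> : t `^ (gam - 2 + 0) = t `^ gam / t ^+ 2.
      by rewrite addr0 -powRBn// powR_mulrn// ltW.
    by rewrite tE -/c0; field; rewrite gt_eqF.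
Qed.

(** The quotient by [t] stays between positive constants, and the second
    derivative is of order [- t^(alf - 1)]: this is a concave profile that still
    gives a Lipschitz bound. *)
Lemma profile_lipschitz (alf : R) : 0 < alf <= 1 ->
  profile (fun t => t - t `^ (1 + alf) / 4) 1 alf (alf / 36) 1.
Proof.
move=> /andP[a0 a1].
have b1 : 1 < 1 + alf by rewrite ltrDl.
have b0 : 0 < 1 + alf by lra.
have bE t : 0 < t -> t `^ (1 + alf) = t * t `^ alf.
  by move=> t0; rewrite -powRDn// powRr1// ltW.
have tan t w : 0 < t -> 0 <= w ->
    t `^ (1 + alf) + (1 + alf) * t `^ alf * (w - t) <= w `^ (1 + alf).
  move=> t0 w0; rewrite (powR_scale _ t0 w0).
  have x0 : 0 <= w / t by rewrite divr_ge0// ltW.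
  apply: le_trans _ (ler_wpM2l (powR_ge0 t _) (powR_ge_tangent (ltW b1) x0)).
  rewrite le_eqVlt; apply/orP; left; apply/eqP.
  by rewrite bE//; field; rewrite gt_eqF.
have small t : 0 <= t <= 2 -> t `^ alf <= 2.
  move=> /andP[t0 t2]; apply: le_trans (ler_powRl (ltW a0) t0 t2) _.
  by rewrite -[leRHS](@powRr1 _ 2)// ler_powR// ler1n.
split.
- by rewrite powR0 ?gt_eqF// mul0r subr0.
- move=> w v /andP[w0 w2] /andP[v0 v2]; rewrite mul1r powRr1//.
  have [wv|vw] := lerP v w.
    have := ler_powRl (ltW b0) v0 wv.
    by move: (_ `^ _) (_ `^ _) => *; lra.
  have vp : 0 < v by exact: le_lt_trans vw.
  have := tan v w vp w0.
  have : (1 + alf) * v `^ alf <= 4.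
    have -> : 4 = 2 * 2 :> R by ring.
    by apply: ler_pM; rewrite ?powR_ge0 ?(ltW b0)//; [lra|apply: small; rewrite v0].
  move: (v `^ alf) (v `^ (1 + alf)) (w `^ (1 + alf)) => y1 y2 y3 h1 h2.
  move: h1 h2; set X := (1 + alf) * y1 => h1 h2; nra.
- move=> t /andP[t0 t2]; rewrite powRr1//.
  move: t0; rewrite le_eqVlt => /predU1P[<-|t0].
    by rewrite powR0 ?gt_eqF// mul0r subr0 mulr0.
  rewrite bE//; have : t `^ alf <= 2 by apply: small; rewrite ltW.
  by move: (t `^ alf) => y; nra.
- move=> t /andP[t0 t1]; exists (1 - (1 + alf) * t `^ alf / 4).
  have ta1 : t `^ alf <= 1 by apply: powR_le1; [exact: ltW|rewrite (ltW t0)].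
  have ta0 : 0 <= t `^ alf by exact: powR_ge0.
  split.
  + rewrite subrr powRr0 !mulr1; move: ta0 ta1; move: (t `^ alf) => y y0 y1.
    by apply/andP; split; nra.
  + move=> w w0; have := tan t w t0 w0.
    by move: (t `^ alf) (t `^ (1 + alf)) (w `^ (1 + alf)) => *; lra.
  + move=> w /andP[w1 w2].
    have w0 : 0 <= w by apply: le_trans w1; rewrite divr_ge0// ltW.
    have x04 : 0 <= w / t <= 4.
      rewrite divr_ge0 ?(ltW t0)//= ler_pdivrMr//; lra.
    have := ler_wpM2l (powR_ge0 t (1 + alf)) (powR_ge_tangent_sqr b1 x04).
    rewrite -powR_scale//.
    have -> : t `^ (1 - 2 + alf) = t `^ (1 + alf) / t ^+ 2.
      rewrite -(powR_mulrn 2 (ltW t0)) powRBn//; congr (_ `^ _); ring.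
    have -> : Num.min 1 (1 + alf - 1) = alf by rewrite addrAC subrr add0r min_r.
    have -> : t `^ (1 + alf) * (1 + (1 + alf) * (w / t - 1) + alf / 9 * (w / t - 1) ^+ 2)
       = t `^ (1 + alf) + (1 + alf) * t `^ alf * (w - t) +
         4 * (alf / 36 * (t `^ (1 + alf) / t ^+ 2) * (w - t) ^+ 2).
      by rewrite bE//; field; rewrite gt_eqF.
    by move: (t `^ (1 + alf) / t ^+ 2) => y; move: (alf / 36 * y * _) (t `^ alf) (t `^ (1 + alf)) (w `^ (1 + alf)) => *; lra.
Qed.

End profiles.

Section doubling.
Context {R : realType} {n : nat}.

Lemma enorm_mx_norm_bounded (A : set 'rV[R]_n) (M : R) :
  (forall x, A x -> enorm x <= M) -> bounded_set A.
Proof.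
move=> hA; exists M; split; first exact: num_real.
by move=> N MN x Ax; apply: le_trans (mx_norm_le_enorm x) _; rewrite (le_trans (hA _ Ax))// ltW.
Qed.

Lemma closed_ecball (x0 : 'rV[R]_n) d : closed (ecball x0 d).
Proof.
rewrite (_ : ecball x0 d = (fun x => enorm (x - x0)) @^-1` [set y | y <= d])//.
apply: preimage_closed; last exact: closed_le.
move=> x _; apply: continuous_comp; last exact: continuous_enorm.
by apply: continuousB; [exact: cvg_id|exact: cst_continuous].
Qed.

Lemma compact_ecball (x0 : 'rV[R]_n) d : compact (ecball x0 d).
Proof.
apply: bounded_closed_compact; last exact: closed_ecball.
apply: (@enorm_mx_norm_bounded _ (d + enorm x0)) => x xd.
by rewrite -[x](subrK x0) (le_trans (ler_enormD _ _))// lerD2r.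
Qed.

(** Compactness of the two closed balls; the modulus of continuity of [phi] makes
    the doubled function continuous. *)
Lemma doubling_max (u : 'rV[R]_n -> R) (phi : R -> R) (gam alf c0 C0 L m d : R)
    (x0 : 'rV[R]_n) :
  0 < gam -> 0 <= C0 -> profile phi gam alf c0 C0 -> 0 <= d <= 1 ->
  {within ecball x0 d, continuous u} ->
  exists x y, [/\ ecball x0 d x, ecball x0 d y & forall x' y',
    ecball x0 d x' -> ecball x0 d y' ->
    u x' - u y' - L * phi (enorm (x' - y')) - m * enorm (x' - x0) ^+ 2 <=
    u x - u y - L * phi (enorm (x - y)) - m * enorm (x - x0) ^+ 2].
Proof.
move=> gam0 C00 [_ hphi _ _] /andP[d0 d1] cu.
pose B := ecball x0 d `*` ecball x0 d.
pose f (z : 'rV[R]_n * 'rV[R]_n) := u z.1 - u z.2 - L * phi (enorm (z.1 - z.2))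
   - m * enorm (z.1 - x0) ^+ 2.
have B0 : B !=set0.
  by exists (x0, x0); rewrite /B /ecball/= subrr enorm0.
have cB : compact B by apply: compact_setX; exact: compact_ecball.
have enB z : B z -> 0 <= enorm (z.1 - z.2) <= 2.
  rewrite /B /ecball/= => -[h1 h2]; rewrite enorm_ge0/=.
  have -> : z.1 - z.2 = (z.1 - x0) + (x0 - z.2) by rewrite addrA subrK.
  by apply: le_trans (ler_enormD _ _) _; rewrite [enorm (x0 - _)]enormB; lra.
have cf : {within B, continuous f}.
  apply/subspace_continuousP => z Bz.
  have F0 : Filter (within B (nbhs z)) by exact: within_filter.
  have cu1 : (fun z' => u z'.1) @ within B (nbhs z) --> u z.1.
    move=> V nV; have := (subspace_continuousP _ u).1 cu z.1 (proj1 Bz) V nV.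
    rewrite !nbhs_simpl/= /within/= => h.
    have : nbhs z (fst @^-1` [set x | ecball x0 d x -> V (u x)]) by exact: (cvg_fst h).
    by apply: filterS => z' h' [Bz' _]; exact: h'.
  have cu2 : (fun z' => u z'.2) @ within B (nbhs z) --> u z.2.
    move=> V nV; have := (subspace_continuousP _ u).1 cu z.2 (proj2 Bz) V nV.
    rewrite !nbhs_simpl/= /within/= => h.
    have : nbhs z (snd @^-1` [set x | ecball x0 d x -> V (u x)]) by exact: (cvg_snd h).
    by apply: filterS => z' h' [_ Bz']; exact: h'.
  have cen (g : 'rV[R]_n * 'rV[R]_n -> 'rV[R]_n) : {for z, continuous g} ->
      (fun z' => enorm (g z')) @ within B (nbhs z) --> enorm (g z).
    move=> cg; apply: cvg_within_filter.
    by apply: (@continuous_comp _ _ _ g (@enorm R n)) => //; exact: continuous_enorm.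
  have cd : (fun z' => enorm (z'.1 - z'.2)) @ within B (nbhs z) --> enorm (z.1 - z.2).
    by apply: cen; apply: continuousB; [exact: cvg_fst|exact: cvg_snd].
  have cq : (fun z' => enorm (z'.1 - x0)) @ within B (nbhs z) --> enorm (z.1 - x0).
    by apply: cen; apply: continuousB; [exact: cvg_fst|exact: cst_continuous].
  have cphi : (fun z' => phi (enorm (z'.1 - z'.2))) @ within B (nbhs z) -->
      phi (enorm (z.1 - z.2)).
    apply/cvgrPdist_lt => e e0.
    pose del := (e / (C0 + 1)) `^ gam^-1.
    have C01 : 0 < C0 + 1 by lra.
    have eC0 : 0 < e / (C0 + 1) by rewrite divr_gt0.
    have del0 : 0 < del by rewrite powR_gt0.
    have /cvgrPdist_lt/(_ _ del0) h1 := cd.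
    have h2 : \forall z' \near within B (nbhs z), B z' by exact: withinT.
    near=> z'.
    have Bz' : B z' by near: z'.
    have h : `|enorm (z.1 - z.2) - enorm (z'.1 - z'.2)| < del by near: z'.
    have hp : C0 * `|enorm (z.1 - z.2) - enorm (z'.1 - z'.2)| `^ gam < e.
      apply: (@le_lt_trans _ _ (C0 * (e / (C0 + 1)))).
        rewrite ler_wpM2l//; apply: le_trans (ler_powRl (ltW gam0) (normr_ge0 _) (ltW h)) _.
        by rewrite -powRrM mulVf ?gt_eqF// powRr1// ltW.
      by rewrite mulrCA gtr_pMr// ltr_pdivrMr// mul1r ltrDl.
    have [b1 b2] := (enB _ Bz, enB _ Bz').
    rewrite ltr_norml; apply/andP; split.
      rewrite ltrNl opprB; apply: le_lt_trans _ hp; rewrite [`|_|]distrC; exact: hphi.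
    by apply: le_lt_trans _ hp; exact: hphi.
  have cq2 : (fun z' => enorm (z'.1 - x0) ^+ 2) @ within B (nbhs z) -->
      enorm (z.1 - x0) ^+ 2 by exact: (cvgM cq cq).
  apply: cvgB; last by apply: cvgM; [exact: cvg_cst|exact: cq2].
  apply: cvgB; last by apply: cvgM; [exact: cvg_cst|].
  exact: cvgB.
have [[x y]] := compact_EVT_max B0 cB cf.
rewrite inE => -[/= xd yd] hmax; exists x, y; split => // x' y' xd' yd'.
by have := hmax (x', y'); apply; rewrite inE.
Unshelve. all: by end_near.
Qed.

End doubling.

(** * Improvement of the Hoelder exponent *)

Section improvement.
Context {R : realType} {n : nat}.

Definition hoelder_ball (u : 'rV[R]_n -> R) (r k K : R) :=
  forall x y, enorm x < r -> enorm y < r -> `|u x - u y| <= K * enorm (x - y) `^ k.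

Lemma max_configuration (u : 'rV[R]_n -> R) (phi : R -> R) (L m d rho : R)
    (x0 xb yb : 'rV[R]_n) :
  enorm (xb - x0) + rho <= d -> enorm (yb - x0) + rho <= d -> 0 <= rho ->
  (forall x' y', ecball x0 d x' -> ecball x0 d y' ->
    u x' - u y' - L * phi (enorm (x' - y')) - m * enorm (x' - x0) ^+ 2 <=
    u xb - u yb - L * phi (enorm (xb - yb)) - m * enorm (xb - x0) ^+ 2) ->
  configuration u xb yb (xb - x0) phi L m rho.
Proof.
move=> xd yd rho0 hmax.
have inb w z : enorm (w - x0) + rho <= d -> enorm z < rho -> ecball x0 d (w + z).
  move=> wd zr; rewrite /ecball/= addrAC (le_trans (ler_enormD _ _))//.
  by apply: le_trans wd; rewrite lerD2l ltW.
have inb0 w : enorm (w - x0) + rho <= d -> ecball x0 d w.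
  by move=> wd; rewrite /ecball/=; apply: le_trans wd; rewrite lerDl.
have qz z : enorm (xb + z - x0) ^+ 2 =
    enorm (xb - x0) ^+ 2 + (2 * edot (xb - x0) z + enorm z ^+ 2).
  have -> : xb + z - x0 = xb - x0 + z by rewrite addrAC.
  by rewrite enormD_sqr; ring.
split => z zr.
- have := hmax _ _ (inb _ _ xd zr) (inb0 _ yd); rewrite qz.
  have -> : xb + z - yb = xb - yb + z by rewrite addrAC.
  by move: (phi _) (phi _) (_ + enorm z ^+ 2) => *; lra.
- have := hmax _ _ (inb0 _ xd) (inb _ _ yd zr).
  have -> : xb - (yb + z) = xb - yb - z by rewrite opprD addrA.
  by move: (phi _) (phi _) => *; lra.
- have := hmax _ _ (inb _ _ xd zr) (inb _ _ yd zr); rewrite qz.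
  have -> : xb + z - (yb + z) = xb - yb by rewrite opprD addrACA subrr addr0.
  by move: (phi _) (_ + enorm z ^+ 2) => *; lra.
Qed.

Lemma weighted_sum_bound (C s1 s2 X1 X2 Y1 Y2 k1 k2 K1 K2 L : R) :
  s1 <= 1 -> s2 <= 1 ->
  - C <= (1 - s1) * X1 + (1 - s2) * X2 -> (1 - s1) * Y1 + (1 - s2) * Y2 <= C ->
  X1 - Y1 <= - (k1 * L) + K1 -> X2 - Y2 <= - (k2 * L) + K2 ->
  ((1 - s1) * k1 + (1 - s2) * k2) * L <= 2 * C + ((1 - s1) * K1 + (1 - s2) * K2).
Proof.
move=> s11 s21 hX hY h1 h2.
have a1 : 0 <= 1 - s1 by rewrite subr_ge0.
have a2 : 0 <= 1 - s2 by rewrite subr_ge0.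
have := ler_wpM2l a1 h1; have := ler_wpM2l a2 h2.
move: hX hY; clear; lra.
Qed.

(** The localising term keeps the first maximum point near the centre. *)
Lemma localised (A0 d x v : R) : 0 <= A0 -> 0 < d -> 0 <= x -> v <= 2 * A0 ->
  32 * (A0 + 1) / d ^+ 2 * x ^+ 2 <= v -> x <= d / 4.
Proof.
move=> A00 d0 x0 vA h.
have d2 : 0 < d ^+ 2 by rewrite exprn_gt0.
have A1 : 0 < A0 + 1 by lra.
have h1 : 32 * (A0 + 1) * x ^+ 2 <= 2 * A0 * d ^+ 2.
  rewrite -ler_pdivrMr//; apply: le_trans vA; apply: le_trans h.
  by rewrite le_eqVlt; apply/orP; left; apply/eqP; ring.
have h2 : x ^+ 2 <= (d / 4) ^+ 2.
  rewrite -(ler_pM2l A1) expr_div_n.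
  by move: h1 d2; move: (x ^+ 2) (d ^+ 2) => a b *; nra.
by rewrite -(@ler_pXn2r _ 2) ?nnegrE//; apply: divr_ge0 => //; exact: ltW.
Qed.

(** A known Hoelder estimate makes the localisation, and with it the drift, small
    with [t]. *)
Lemma localised_rate (m x Kh t kap : R) : 0 < m -> 0 <= x -> 0 <= Kh -> 0 < t ->
  m * x ^+ 2 <= Kh * t `^ kap -> x <= Num.sqrt (Kh / m) * t `^ (kap / 2).
Proof.
move=> m0 x0 K0 t0 h.
rewrite -(@ler_pXn2r _ 2) ?nnegrE ?mulr_ge0 ?sqrtr_ge0 ?powR_ge0//.
rewrite exprMn sqr_sqrtr ?divr_ge0 ?(ltW m0)//.
have -> : (t `^ (kap / 2)) ^+ 2 = t `^ kap.
  by rewrite expr2 powRDn// -splitr.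
by rewrite mulrAC ler_pdivlMr// mulrC.
Qed.

(** For a large [L] the assumption that the doubled function has a positive
    maximum contradicts the equation: testing at both points, subtracting and
    inserting [operator_conclusion] for both operators bounds [L].  One operator
    whose mode is true suffices; the known regularity [kap] enters through the
    decay of the drift, and through the increments for the other mode. *)
Lemma improvement (m1 m2 : bool)
    (p q s1 s2 C A0 R0 R1 gam alf sig eps kap Kh c0 C0 : R) (phi : R -> R) :
  (0 < n)%N -> 2 <= p -> 2 <= q -> 0 < s1 < 1 -> 0 < s2 < 1 -> 0 <= A0 ->
  0 < R0 -> R0 < R1 -> R1 <= 2 ->
  0 < gam <= 1 -> 0 <= alf -> 0 < sig -> 0 <= kap <= 1 -> 0 < eps ->
  0 < c0 <= C0 -> 0 <= Kh -> gam + alf <= 1 + kap / 2 ->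
  @admissible R n m1 p s1 gam alf kap sig eps ->
  @admissible R n m2 q s2 gam alf kap sig eps -> m1 || m2 ->
  profile phi gam alf c0 C0 ->
  exists2 K, 0 <= K & forall u : 'rV[R]_n -> R,
    viscosity_solution p q s1 s2 C u -> measurable_fun setT u ->
    (tail_integral p s1 u <= A0%:E)%E -> (tail_integral q s2 u <= A0%:E)%E ->
    (forall x, enorm x < 2 -> `|u x| <= A0) ->
    hoelder_ball u R1 kap Kh -> hoelder_ball u R0 gam K.
Proof.
move=> n0 p2 q2 s101 s201 A00 R00 R01 R12 gam01 alf0 sig0 kap01 eps0 c0C Kh0 gath.
move=> adm1 adm2 m12 prof.
have [c1 [c2 [c10 c20 touch]]] := @viscosity_touching R n p q s1 s2 p2 q2 s101 s201.
pose d := (R1 - R0) / 2.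
have d0 : 0 < d by rewrite divr_gt0// subr_gt0.
have d1 : d <= 1 by rewrite /d; lra.
have dR : R0 + d < R1 by rewrite /d; lra.
have dh : 0 < d / 2 <= 1 by apply/andP; split; lra.
(* the penalisation [m |x - x0|^2] exceeds the oscillation [2 A0] at distance [d / 4] *)
pose m := 32 * (A0 + 1) / d ^+ 2.
have A01 : 0 < A0 + 1 by lra.
have m0 : 0 < m by apply: divr_gt0; [exact: mulr_gt0|exact: exprn_gt0].
pose Cq := Num.sqrt (Kh / m).
have Cq0 : 0 <= Cq by exact: sqrtr_ge0.
have [k1 [K1 [L1 [t1 [k10 k1p L11 /andP[t10 t11] op1]]]]] := operator_conclusion
  n0 p2 s101 A00 dh gam01 alf0 sig0 kap01 eps0 c0C (ltW m0) Cq0 Kh0 c10 gath adm1.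
have [k2 [K2 [L2 [t2' [k20 k2p L21 /andP[t20 t21] op2]]]]] := operator_conclusion
  n0 q2 s201 A00 dh gam01 alf0 sig0 kap01 eps0 c0C (ltW m0) Cq0 Kh0 c20 gath adm2.
have /andP[gam0 gam1] := gam01; have /andP[c00 cC] := c0C.
have C00 : 0 <= C0 by apply: le_trans cC; exact: ltW.
pose ts := Num.min (Num.min t1 t2') (d / 4).
have ts0 : 0 < ts by rewrite !lt_min t10 t20 divr_gt0.
pose k := (1 - s1) * k1 + (1 - s2) * k2.
have /andP[s10 s11] := s101; have /andP[s20 s21] := s201.
have k0 : 0 < k.
  rewrite /k; case/orP: m12 => [/k1p|/k2p] kp.
    by apply: ltr_wpDr; [apply: mulr_ge0 => //; rewrite subr_ge0 ltW|rewrite mulr_gt0 ?subr_gt0].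
  by apply: ltr_wpDl; [apply: mulr_ge0 => //; rewrite subr_ge0 ltW|rewrite mulr_gt0 ?subr_gt0].
pose X := 2 * C + ((1 - s1) * K1 + (1 - s2) * K2).
(* the third entry makes [t <= ts], the last one contradicts the two equations *)
pose L := Num.max (Num.max L1 L2) (Num.max (2 * A0 / (c0 * ts `^ gam) + 1) (X / k + 1)).
have LL1 : L1 <= L by rewrite !le_max lexx.
have LL2 : L2 <= L by rewrite !le_max lexx orbT.
have LLA : 2 * A0 / (c0 * ts `^ gam) < L.
  by rewrite !lt_max ltrDl ltr01 !orbT.
have LLX : X / k < L by rewrite !lt_max ltrDl ltr01 !orbT.
have Lge1 : 1 <= L by exact: le_trans LL1.
have L0 : 0 <= L by exact: le_trans Lge1.
exists (L * C0 + 2 * A0 / d `^ gam).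
  by rewrite addr_ge0 ?mulr_ge0 ?invr_ge0 ?powR_ge0.
move=> u vu mu_ tu1 tu2 uA hKh.
have phi_le w : 0 <= w <= 2 -> phi w <= C0 * w `^ gam.
  move=> w02; have [p0 hphi _ _] := prof; have := hphi w 0 w02.
  rewrite p0 !subr0 ger0_norm; last by case/andP: w02.
  by apply; rewrite lexx/= ler0n.
have key x0 y : enorm x0 < R0 -> enorm (x0 - y) <= d ->
    u x0 - u y <= L * phi (enorm (x0 - y)).
  move=> x0R x0y.
  have sub z : ecball x0 d z -> enorm z < R1.
    move=> zd; rewrite -[z](subrK x0) (le_lt_trans (ler_enormD _ _))//.
    by apply: lt_trans dR; rewrite addrC ltr_leD.
  have sub2 z : ecball x0 d z -> enorm z < 2 by move=> /sub zR; exact: lt_le_trans R12.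
  have cu : {within ecball x0 d, continuous u}.
    apply: (continuous_subspaceW _ (_ : {within ecball 0 2, continuous u})).
      by move=> z /sub2 z2; rewrite /ecball/= subr0 ltW.
    by case: vu.
  have d01 : 0 <= d <= 1 by rewrite ltW.
  have [xb [yb [xbd ybd hmax]]] :=
    doubling_max L m gam0 C00 prof d01 cu.
  have xx0 : ecball x0 d x0 by rewrite /ecball/= subrr enorm0 ltW.
  have yx0 : ecball x0 d y by rewrite /ecball/= enormB.
  set Phi := u xb - u yb - L * phi (enorm (xb - yb)) - m * enorm (xb - x0) ^+ 2 in hmax.
  suff Phi0 : Phi <= 0.
    have := le_trans (hmax x0 y xx0 yx0) Phi0.
    by rewrite subrr enorm0 expr0n mulr0 subr0 subr_le0.
  rewrite leNgt; apply/negP => Phip.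
  pose t := enorm (xb - yb).
  have t_ge0 : 0 <= t by exact: enorm_ge0.
  have t2 : t <= 2.
    rewrite /t; have -> : xb - yb = (xb - x0) - (yb - x0) by rewrite opprB addrA subrK.
    rewrite (le_trans (ler_enormD _ _))// enormN.
    by apply: le_trans (lerD xbd ybd) _; move: d1; clear; lra.
  have [p0 _ p3 p4] := prof.
  have tp : 0 < t.
    rewrite enorm_gt0; apply: contraPneq Phip => /subr0_eq xy.
    rewrite /Phi xy !subrr enorm0 p0 mulr0 subr0 sub0r; apply/negP; rewrite -leNgt oppr_le0.
    by rewrite mulr_ge0 ?(ltW m0)// sqr_ge0.
  have ptE : c0 * t `^ gam <= phi t by apply: p3; rewrite t_ge0.
  have pt0 : 0 <= c0 * t `^ gam by rewrite mulr_ge0 ?powR_ge0 ?(ltW c00).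
  have Lphi : L * (c0 * t `^ gam) <= L * phi t by rewrite ler_wpM2l.
  have Lphi0 : 0 <= L * (c0 * t `^ gam) by rewrite mulr_ge0.
  have mq0 : 0 <= m * enorm (xb - x0) ^+ 2 by rewrite mulr_ge0 ?(ltW m0)// sqr_ge0.
  have [xb2 yb2] := (sub2 _ xbd, sub2 _ ybd).
  have uxy : u xb - u yb <= 2 * A0.
    have := uA _ xb2; have := uA _ yb2; rewrite !ler_norml => /andP[h1 h2] /andP[h3 h4].
    by move: h1 h4; clear; lra.
  have PhiE : L * phi t + m * enorm (xb - x0) ^+ 2 < u xb - u yb.
    by move: Phip; rewrite /Phi -/t; move: (L * phi t) => ?; clear; lra.
  have LA : L * (c0 * t `^ gam) <= 2 * A0.
    by move: Lphi mq0 uxy PhiE; move: (m * _) (L * phi t) (u xb - u yb) => ? ? ?; clear; lra.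
  have mq : m * enorm (xb - x0) ^+ 2 <= u xb - u yb.
    by move: Lphi Lphi0 PhiE; move: (m * _) (L * phi t) (u xb - u yb) => ? ? ?; clear; lra.
  have tts : t <= ts.
    rewrite leNgt; apply/negP => tst.
    have h1 := ler_powRl (ltW gam0) (ltW ts0) (ltW tst).
    have h2 := ler_wpM2l L0 (ler_wpM2l (ltW c00) h1).
    move: LLA; rewrite ltr_pdivrMr ?mulr_gt0 ?powR_gt0// => h3.
    by have := lt_le_trans h3 (le_trans h2 LA); rewrite ltxx.
  move: (tts); rewrite /ts !le_min => /andP[/andP[tt1 tt2] ttd].
  have qd : enorm (xb - x0) <= d / 4.
    exact: (localised A00 d0 (enorm_ge0 _) uxy mq).
  have qr : enorm (xb - x0) <= Cq * t `^ (kap / 2).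
    apply: localised_rate => //; first exact: enorm_ge0.
    apply: le_trans mq _; apply: le_trans (ler_norm _) _.
    by apply: hKh; exact: sub.
  have yq : enorm (yb - x0) <= d / 2.
    have -> : yb - x0 = (xb - x0) - (xb - yb) by apply/rowP => i; rewrite !mxE; ring.
    rewrite (le_trans (ler_enormD _ _))// enormN.
    by apply: le_trans (lerD qd ttd) _; clear; lra.
  have cfg : configuration u xb yb (xb - x0) phi L m (d / 2).
    apply: max_configuration hmax.
    - by apply: le_trans (lerD qd (lexx _)) _; move: d0; clear; lra.
    - by apply: le_trans (lerD yq (lexx _)) _; clear; lra.
    - by rewrite divr_ge0 ?(ltW d0).
  have tle1 : t <= 1 by exact: le_trans tt1 t11.
  have tp01 : 0 < t <= 1 by rewrite tp.
  have [G tan] := p4 t tp01.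
  have q1 : enorm (xb - x0) <= 1 by apply: le_trans qd _; move: d1; clear; lra.
  pose r := t `^ (1 + sig).
  have r0 : 0 < r by rewrite powR_gt0.
  have rt : r <= t by apply: ge1r_powR; rewrite ?tp// lerDl ltW.
  have rd4 : r <= d / 4 by exact: le_trans ttd.
  have rho_r : r < d / 2 by apply: le_lt_trans rd4 _; move: d0; clear; lra.
  have inB w : enorm (w - x0) <= d / 2 -> eball w r `<=` eball 0 2.
    move=> wd z; rewrite /eball/= subr0 => zw; apply: sub2; rewrite /ecball/=.
    have -> : z - x0 = (z - w) + (w - x0) by rewrite addrA subrK.
    rewrite (le_trans (ler_enormD _ _))//.
    by apply: le_trans (lerD (ltW zw) wd) _; move: rd4 d0; clear; lra.
  have [_ _ /andP[M0 _]] := paraboloid_size (ltW c00) Lge1 (ltW m0) gam1 q1 tp01 tan.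
  have qd2 : enorm (xb - x0) <= d / 2 by apply: le_trans qd _; move: d0; clear; lra.
  have [hX _] := touch C u xb ((L * G / t) *: (xb - yb) + (2 * m) *: (xb - x0))
    (L * G / (2 * t) + m) r vu mu_ M0 r0 (inB _ qd2).
  have [_ hY] := touch C u yb ((L * G / t) *: (xb - yb))
    (L * G / (2 * t) + m) r vu mu_ M0 r0 (inB _ yq).
  have {}hX := hX (fun z zr => config_paraboloid_above cfg Lge1 c00 tp01 tan (lt_trans zr rho_r)).
  have {}hY := hY (fun z zr =>
    config_paraboloid_below cfg Lge1 (ltW m0) c00 tp01 tan (lt_trans zr rho_r)).
  have hold w : enorm (w - x0) <= d / 2 -> forall z, enorm z < d / 2 ->
      `|u (w + z) - u w| <= Kh * enorm z `^ kap.
    move=> wd z zd; rewrite -{2}[z](addKr w) [- w + _]addrC; apply: hKh; apply: sub; rewrite /ecball/=.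
      rewrite addrAC (le_trans (ler_enormD _ _))//.
      by apply: le_trans (lerD wd (ltW zd)) _; clear; lra.
    by apply: le_trans wd _; move: d0; clear; lra.
  have [uxA uyA] := (uA _ xb2, uA _ yb2).
  have h1 := op1 phi u xb yb (xb - x0) L G prof tan mu_ tu1 (ltW xb2) (ltW yb2) uxA uyA q1 qr
    (hold _ qd2) (hold _ yq) cfg LL1.
  have h2 := op2 phi u xb yb (xb - x0) L G prof tan mu_ tu2 (ltW xb2) (ltW yb2) uxA uyA q1 qr
    (hold _ qd2) (hold _ yq) cfg LL2.
  have /h1 {}h1 : 0 < t <= t1 by rewrite tp.
  have /h2 {}h2 : 0 < t <= t2' by rewrite tp.
  have := weighted_sum_bound (ltW s11) (ltW s21) hX hY h1 h2.
  rewrite -/k -/X leNgt => /negP; apply.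
  by move: LLX; rewrite ltr_pdivrMr// mulrC.
have one x y : enorm x < R0 -> enorm y < R0 ->
    u x - u y <= (L * C0 + 2 * A0 / d `^ gam) * enorm (x - y) `^ gam.
  move=> xR yR; rewrite mulrDl.
  have a1 : 0 <= L * C0 * enorm (x - y) `^ gam by rewrite !mulr_ge0 ?powR_ge0.
  have dg : 0 < d `^ gam by rewrite powR_gt0.
  have a2 : 0 <= 2 * A0 / d `^ gam * enorm (x - y) `^ gam.
    by rewrite !mulr_ge0 ?powR_ge0// invr_ge0 ltW.
  have [xyd|xyd] := lerP (enorm (x - y)) d.
    apply: le_trans (key x y xR xyd) _.
    have h : 0 <= enorm (x - y) <= 2 by rewrite enorm_ge0 (le_trans xyd)// (le_trans d1)// ler1n.
    by have := ler_wpM2l L0 (phi_le _ h); rewrite mulrA => h'; rewrite (le_trans h')// lerDl.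
  have R02 (z : 'rV[R]_n) : enorm z < R0 -> enorm z < 2.
    by move=> zR; apply: lt_le_trans R12; exact: lt_trans R01.
  have uxy : u x - u y <= 2 * A0.
    have := uA _ (R02 _ xR); have := uA _ (R02 _ yR).
    rewrite !ler_norml => /andP[h1 h2] /andP[h3 h4].
    by move: h1 h4; clear; lra.
  apply: le_trans uxy _; apply: le_trans (_ : _ <= 2 * A0 / d `^ gam * enorm (x - y) `^ gam) _.
    rewrite -mulrA ler_peMr ?mulr_ge0// mulrC ler_pdivlMr// mul1r.
    by apply: ler_powRl; rewrite ltW.
  by rewrite lerDr.
move=> x y xR yR; rewrite ler_norml lerNl opprB; apply/andP; split; last exact: one.
by rewrite enormB; exact: one.
Qed.

End improvement.

(** * The bootstrap *)

Section exponents.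
Context {R : realType} {n : nat}.

Lemma le_addM_min0 (x k c y : R) : x <= k -> x <= k + c * y ->
  x <= k + c * Num.min 0 y.
Proof. by move=> h1 h2; case: (lerP 0 y) => _; rewrite ?mulr0 ?addr0. Qed.

(** Since [gam (p-2) + 1 - s p] exceeds the gain exponent by [1 - gam], half of this
    difference can be spent on [eps] and the other half on [sig]. *)
Lemma admissible_subcritical (p s gam kap sig : R) :
  2 <= p -> 0 < s < 1 -> 0 < gam < 1 -> gam * (p - 1) <= s * p -> 0 <= kap ->
  0 < sig -> sig * p <= (1 - gam) / 2 ->
  @admissible R n true p s gam 0 kap sig ((1 - gam) / 2).
Proof.
move=> p2 /andP[s0 s1] /andP[g0 g1] gp kap0 sig0 sigp.
have p0 : 0 < p by lra.
rewrite /admissible /gain_exponent !mul0r addr0; split.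
  by rewrite !mulr_gt0// subr_gt0.
have gp0 : gam * (p - 1) - s * p <= 0 by rewrite subr_le0.
split => //; apply: le_addM_min0; first by lra.
have -> : gam * (p - 2) + 1 - s * p - (1 - gam) / 2 =
  gam * (p - 1) - s * p + (1 - gam) / 2 by field.
have h : - (sig * p) <= sig * (gam * (p - 1) - s * p).
  rewrite -mulrN ler_wpM2l ?(ltW sig0)//.
  have : 0 <= gam * (p - 1) by rewrite mulr_ge0//; lra.
  have : s * p <= p by rewrite ler_piMl// ltW.
  by lra.
have e1 : 0 <= sig * ((1 - gam) / 2) by rewrite mulr_ge0//; lra.
move: h e1 sigp; move: (gam * (p - 1) - s * p) ((1 - gam) / 2) => y e.
rewrite mulrDl mul1r [sig * (_ + _)]mulrDr.
by move: (sig * y) (sig * p) (sig * e) => *; lra.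
Qed.

(** At the critical exponent [kap (p-2) + 1 - s p] equals [1 - kap], so that the
    error integrals converge at the origin without any decay of the drift. *)
Lemma admissible_critical (p s gam kap sig : R) :
  2 <= p -> 0 < s < 1 -> gam < 1 -> kap * (p - 1) = s * p -> 0 <= kap ->
  kap < gam -> 0 < sig -> @admissible R n false p s gam 0 kap sig ((1 - gam) / 2).
Proof.
move=> p2 /andP[s0 s1] g1 gp kap0 kg sig0.
have p0 : 0 < p by lra.
rewrite /admissible !mul0r; split; first by rewrite !mulr_gt0// subr_gt0.
rewrite min_l ?mulr0 ?addr0 ?divr_ge0// -gp.
have -> : kap * (p - 2) + 1 - kap * (p - 1) - (1 - gam) / 2 =
  (1 - kap) - (1 - gam) / 2 by field.
by lra.
Qed.

(** For [gam = 1] the error exponent is no longer above the gain exponent, and the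
    decay [t^(kap/2)] of the drift, nearly [t^(1/2)], makes up for it. *)
Lemma admissible_lipschitz (p s alf kap : R) :
  2 <= p -> 0 < s < 1 -> p - 1 < s * p -> 15 / 16 <= kap ->
  alf * (n%:R + 1) <= s * p - (p - 1) -> alf * (n%:R + 1) <= 1 / 16 ->
  alf * (n%:R + 1) <= p * (1 - s) / 16 ->
  @admissible R n true p s 1 alf kap (1 / 8) (1 / 8).
Proof.
move=> p2 /andP[s0 s1] sp kap1; rewrite /admissible /gain_exponent.
move: (alf * _) => x x1 x2 x3.
have p1s : 0 < p * (1 - s) by rewrite mulr_gt0 ?subr_gt0//; lra.
have spp : s * p < p by rewrite gtr_pMl//; lra.
split; first by move: p1s x3; move: (p * (1 - s)) => y; lra.
move: (s * p) sp x1 spp => y *.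
split; first by lra.
by apply: le_addM_min0; lra.
Qed.

(** With [kap] close to [1] the exponent [kap (p-2) + 1 - s p] is almost
    nonnegative. *)
Lemma admissible_lipschitz_known (p s alf : R) (kap : R) :
  2 <= p -> 0 < s < 1 -> s * p <= p - 1 -> 15 / 16 <= kap -> 1 - (8 * p)^-1 <= kap ->
  alf * (n%:R + 1) <= p * (1 - s) / 16 ->
  @admissible R n false p s 1 alf kap (1 / 8) (1 / 8).
Proof.
move=> p2 /andP[s0 s1] sp kap1 kap2; rewrite /admissible.
move: (alf * _) => x x3.
have p1s : 0 < p * (1 - s) by rewrite mulr_gt0 ?subr_gt0//; lra.
have p0 : 0 < p by lra.
split; first by move: p1s x3; move: (p * (1 - s)) => y; lra.
have h : (1 - kap) * (p - 2) <= 1 / 8.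
  apply: (@le_trans _ _ ((8 * p)^-1 * p)).
    apply: (@le_trans _ _ ((8 * p)^-1 * (p - 2))).
      by rewrite ler_wpM2r//; lra.
    by rewrite ler_wpM2l//; [rewrite invr_ge0; lra|lra].
  by rewrite le_eqVlt; apply/orP; left; apply/eqP; field; rewrite gt_eqF.
apply: le_addM_min0; first by lra.
move: (s * p) sp => y sp; move: h; rewrite mulrBl mul1r.
by move: (kap * (p - 2)) => z h; lra.
Qed.

End exponents.

Section steps.
Context {R : realType} {n : nat}.

Definition uniform_hoelder (p q s1 s2 C gam : R) :=
  forall A0 r : R, 0 <= A0 -> 0 < r < 2 -> exists2 K, 0 <= K &
  forall u : 'rV[R]_n -> R, viscosity_solution p q s1 s2 C u ->
    measurable_fun setT u ->
    (tail_integral p s1 u <= A0%:E)%E -> (tail_integral q s2 u <= A0%:E)%E ->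
    (forall x, enorm x < 2 -> `|u x| <= A0) -> hoelder_ball u r gam K.

Lemma viscosity_solution_sym (p q s1 s2 C : R) (u : 'rV[R]_n -> R) :
  viscosity_solution p q s1 s2 C u -> viscosity_solution q p s2 s1 C u.
Proof.
case=> cu t1 t2 visc; split => // x0 r eta r0 sub c2 ex.
by rewrite /mixed_op addeC; exact: visc.
Qed.

Lemma uniform_hoelder_sym (p q s1 s2 C gam : R) :
  uniform_hoelder p q s1 s2 C gam -> uniform_hoelder q p s2 s1 C gam.
Proof.
move=> h A0 r A00 r02; have [K K0 hK] := h A0 r A00 r02; exists K => // u vu mu_ t1 t2.
by apply: hK => //; exact: viscosity_solution_sym.
Qed.

Variables (p q s1 s2 C : R).
Hypotheses (n0 : (0 < n)%N) (p2 : 2 <= p) (q2 : 2 <= q).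
Hypotheses (s101 : 0 < s1 < 1) (s201 : 0 < s2 < 1).

(** Below both critical exponents boundedness alone starts the argument: it is the
    Hoelder estimate with exponent [0]. *)
Lemma uniform_hoelder_subcritical gam : 0 < gam < 1 ->
  gam * (p - 1) <= s1 * p -> gam * (q - 1) <= s2 * q ->
  uniform_hoelder p q s1 s2 C gam.
Proof.
move=> /[dup] g01 /andP[g0 g1] gp gq A0 r A00 /andP[r0 r2].
pose sig := (1 - gam) / (2 * (p + q)).
have pq0 : 0 < p + q by have := p2; have := q2; lra.
have sig0 : 0 < sig by rewrite divr_gt0 ?mulr_gt0// subr_gt0.
have sigpq : sig * (p + q) = (1 - gam) / 2 by rewrite /sig; field; rewrite gt_eqF.
have sp0 : 0 <= sig * p by rewrite mulr_ge0 ?(ltW sig0)//; have := p2; lra.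
have sq0 : 0 <= sig * q by rewrite mulr_ge0 ?(ltW sig0)//; have := q2; lra.
rewrite mulrDr in sigpq.
have sigp : sig * p <= (1 - gam) / 2 by rewrite -sigpq lerDl.
have sigq : sig * q <= (1 - gam) / 2 by rewrite -sigpq lerDr.
have g01' : 0 < gam <= 1 by rewrite g0 ltW.
have k01 : 0 <= (0 : R) <= 1 by rewrite lexx ler01.
have eps0 : 0 < (1 - gam) / 2 by rewrite divr_gt0// subr_gt0.
have mn0 : 0 < Num.min gam (1 - gam) by rewrite lt_min g0 subr_gt0.
have mn1 : Num.min gam (1 - gam) <= 1 by rewrite ge_min (ltW g1).
have c01 : 0 < Num.min gam (1 - gam) / 9 <= 1.
  by move: mn0 mn1; move: (Num.min _ _) => x x0 x1; apply/andP; split; lra.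
have A02 : 0 <= 2 * A0 by rewrite mulr_ge0.
have gk : gam + 0 <= 1 + 0 / 2 by rewrite addr0 mul0r addr0 ltW.
have [K K0 hK] := improvement C n0 p2 q2 s101 s201 A00 r0 r2 (lexx 2) g01' (lexx 0)
  sig0 k01 eps0 c01 A02 gk (admissible_subcritical p2 s101 g01 gp (lexx 0) sig0 sigp)
  (admissible_subcritical q2 s201 g01 gq (lexx 0) sig0 sigq) isT (profile_powR g01).
exists K => // u vu mu_ t1 t2 uA; apply: hK => // x y x2 y2.
rewrite powRr0 mulr1 (le_trans (ler_normB _ _))// mulr_natl mulr2n.
by rewrite lerD// uA.
Qed.

(** Above the critical exponent of the second operator, that operator is
    controlled by the Hoelder continuity at its critical exponent. *)
Lemma uniform_hoelder_between gam : gam < 1 ->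
  gam * (p - 1) <= s1 * p -> s2 * q < gam * (q - 1) ->
  uniform_hoelder p q s1 s2 C gam.
Proof.
move=> g1 gp gq A0 r A00 /andP[r0 r2].
have q10 : 0 < q - 1 by have := q2; lra.
pose kap := s2 * q / (q - 1).
have kapq : kap * (q - 1) = s2 * q by rewrite /kap; field; rewrite gt_eqF.
have kapg : kap < gam by rewrite -(ltr_pM2r q10) kapq.
have /andP[s20 s21] := s201.
have kap0 : 0 < kap by rewrite /kap divr_gt0// mulr_gt0//; have := q2; lra.
have g0 : 0 < gam by exact: lt_trans kapg.
have g01 : 0 < gam < 1 by rewrite g0.
have kap01 : 0 < kap < 1 by rewrite kap0 (lt_trans kapg).
have p10 : 0 <= p - 1 by have := p2; lra.
have kapp : kap * (p - 1) <= s1 * p.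
  by apply: le_trans gp; rewrite ler_wpM2r// ltW.
pose r1 := (r + 2) / 2.
have r1r : r < r1 by rewrite /r1; lra.
have r12 : r1 < 2 by rewrite /r1; lra.
have r102 : 0 < r1 < 2 by rewrite r12 (lt_trans r0).
have kapq' : kap * (q - 1) <= s2 * q by rewrite kapq.
have [K1 K10 hK1] := uniform_hoelder_subcritical kap01 kapp kapq' A00 r102.
pose sig := (1 - gam) / (2 * p).
have p0 : 0 < p by have := p2; lra.
have sig0 : 0 < sig by rewrite divr_gt0 ?mulr_gt0// subr_gt0.
have sigp : sig * p <= (1 - gam) / 2.
  by rewrite le_eqVlt; apply/orP; left; apply/eqP; rewrite /sig; field; rewrite gt_eqF.
have g01' : 0 < gam <= 1 by rewrite g0 ltW.
have k01 : 0 <= kap <= 1 by case/andP: kap01 => *; rewrite !ltW.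
have eps0 : 0 < (1 - gam) / 2 by rewrite divr_gt0// subr_gt0.
have mn0 : 0 < Num.min gam (1 - gam) by rewrite lt_min g0 subr_gt0.
have mn1 : Num.min gam (1 - gam) <= 1 by rewrite ge_min (ltW g1).
have c01 : 0 < Num.min gam (1 - gam) / 9 <= 1.
  by move: mn0 mn1; move: (Num.min _ _) => x x0 x1; apply/andP; split; lra.
have gk : gam + 0 <= 1 + kap / 2 by lra.
have [K K0 hK] := improvement C n0 p2 q2 s101 s201 A00 r0 r1r (ltW r12) g01' (lexx 0)
  sig0 k01 eps0 c01 K10 gk (admissible_subcritical p2 s101 g01 gp (ltW kap0) sig0 sigp)
  (admissible_critical q2 s201 g1 kapq (ltW kap0) kapg sig0) isT (profile_powR g01).
exists K => // u vu mu_ t1 t2 uA; apply: hK => //.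
exact: hK1.
Qed.

End steps.

Section conclusion.
Context {R : realType} {n : nat}.

Lemma uniform_hoelder_lt1 (p q s1 s2 C gam : R) : (0 < n)%N -> 2 <= p -> 2 <= q ->
  0 < s1 < 1 -> 0 < s2 < 1 -> 0 < gam < 1 ->
  gam <= Num.max (s1 * p / (p - 1)) (s2 * q / (q - 1)) ->
  @uniform_hoelder R n p q s1 s2 C gam.
Proof.
move=> n0 p2 q2 s101 s201 g01; have /andP[_ g1] := g01.
have p10 : 0 < p - 1 by lra.
have q10 : 0 < q - 1 by lra.
rewrite le_max !ler_pdivlMr//.
have [gp|gp] := lerP (gam * (p - 1)) (s1 * p);
  have [gq|gq] := lerP (gam * (q - 1)) (s2 * q) => // _.
- exact: uniform_hoelder_subcritical.
- exact: uniform_hoelder_between.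
- by apply: uniform_hoelder_sym; exact: uniform_hoelder_between.
Qed.

(** Every exponent below [1] is available as known regularity.  It is chosen so
    close to [1] that the second operator is harmless when it is subcritical. *)
Lemma uniform_lipschitz_left (p q s1 s2 C : R) : (0 < n)%N -> 2 <= p -> 2 <= q ->
  0 < s1 < 1 -> 0 < s2 < 1 -> p - 1 < s1 * p ->
  @uniform_hoelder R n p q s1 s2 C 1.
Proof.
move=> n0 p2 q2 /[dup] s101 /andP[s10 s11] /[dup] s201 /andP[s20 s21] sp.
move=> A0 r A00 /andP[r0 r2].
have p10 : 0 < p - 1 by lra.
have q0 : 0 < q by lra.
have p0 : 0 < p by lra.
(* then [(1 - kap) (q - 2) <= 1/8], which [admissible_lipschitz_known] can afford *)
pose kap : R := 1 - (8 * q)^-1.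
have iq : 0 < (8 * q)^-1 <= 1 / 16.
  rewrite invr_gt0 mulr_gt0//= div1r lef_pV2 ?posrE ?mulr_gt0//; lra.
have k15 : 15 / 16 <= kap by rewrite /kap; move: iq; move: (_^-1) => x; lra.
have kap01 : 0 < kap < 1.
  by move: k15 iq; rewrite /kap; move: (_^-1) => x x0 x1; apply/andP; split; lra.
have kapm : kap <= Num.max (s1 * p / (p - 1)) (s2 * q / (q - 1)).
  rewrite le_max; apply/orP; left; rewrite ler_pdivlMr//.
  apply: le_trans (ltW sp); rewrite ler_piMl ?(ltW p10)//.
  by case/andP: kap01 => _ /ltW.
pose r1 := (r + 2) / 2.
have r1r : r < r1 by rewrite /r1; lra.
have r12 : r1 < 2 by rewrite /r1; lra.
have r102 : 0 < r1 < 2 by rewrite r12 (lt_trans r0).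
have [K1 K10 hK1] := @uniform_hoelder_lt1 p q s1 s2 C kap n0 p2 q2 s101 s201 kap01
  kapm A0 r1 A00 r102.
pose mode := q - 1 < s2 * q.
(* the excess over the critical exponents and the factors [1 - s] bound
   [alf (n + 1)] from above *)
pose x0 := Num.min (Num.min (s1 * p - (p - 1)) (1 / 16))
  (Num.min (p * (1 - s1) / 16) (Num.min (q * (1 - s2) / 16)
     (if mode then s2 * q - (q - 1) else 1))).
have x0p : 0 < x0.
  rewrite /x0 !lt_min subr_gt0 sp !divr_gt0 ?mulr_gt0 ?subr_gt0//=.
  by rewrite /mode; case: ifP => //; rewrite subr_gt0.
have n1 : 0 < n%:R + 1 :> R by rewrite ltr_pwDr.
pose alf := x0 / (n%:R + 1).
have alfn : alf * (n%:R + 1) = x0 by rewrite /alf divfK// gt_eqF.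
have alf0 : 0 < alf by rewrite divr_gt0.
have x1 : x0 <= s1 * p - (p - 1) by rewrite /x0 !ge_min lexx.
have x2 : x0 <= 1 / 16 by rewrite /x0 !ge_min lexx !orbT.
have x3 : x0 <= p * (1 - s1) / 16 by rewrite /x0 !ge_min lexx !orbT.
have x4 : x0 <= q * (1 - s2) / 16 by rewrite /x0 !ge_min lexx !orbT.
have x5 : mode -> x0 <= s2 * q - (q - 1).
  by move=> md; rewrite /x0 md !ge_min lexx !orbT.
have alf1 : alf <= 1 / 16.
  apply: le_trans x2; rewrite ler_pdivrMr// ler_peMr ?(ltW x0p)// lerDr//.
have adm1 : @admissible R n true p s1 1 alf kap (1 / 8) (1 / 8).
  by apply: admissible_lipschitz => //; rewrite alfn.
have adm2 : @admissible R n mode q s2 1 alf kap (1 / 8) (1 / 8).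
  move: x5; rewrite /mode; have [sq|sq] := ltrP (q - 1) (s2 * q) => x5.
    by apply: admissible_lipschitz => //; rewrite alfn//; exact: x5.
  by apply: admissible_lipschitz_known => //; rewrite alfn.
have g01 : 0 < (1 : R) <= 1 by rewrite ltr01 lexx.
have e0 : 0 < 1 / 8 :> R by rewrite divr_gt0.
have k01 : 0 <= kap <= 1 by case/andP: kap01 => *; rewrite !ltW.
have a01 : 0 < alf <= 1 by rewrite alf0 (le_trans alf1)//; lra.
have c01 : 0 < alf / 36 <= 1 by apply/andP; split; lra.
have gk : 1 + alf <= 1 + kap / 2 by lra.
have [K K0 hK] := improvement C n0 p2 q2 s101 s201 A00 r0 r1r (ltW r12) g01 (ltW alf0)
  e0 k01 e0 c01 K10 gk adm1 adm2 isT (profile_lipschitz a01).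
exists K => // u vu mu_ t1 t2 uA; apply: hK => //.
exact: hK1.
Qed.

End conclusion.

(** * Borel representatives *)

Section null_modification.
Import HBNNSimple.
Local Open Scope ereal_scope.

(** The integral is a supremum over simple functions, and these can be set to zero
    on the null set; this also covers integrands that are not Borel. *)
Lemma integral_eq_off_null d (T : measurableType d) (R : realType)
    (mu : {measure set T -> \bar R}) (D N : set T) (f g : T -> \bar R) :
  measurable N -> mu N = 0 -> (forall x, ~ N x -> f x = g x) ->
  \int[mu]_(x in D) f x = \int[mu]_(x in D) g x.
Proof.
move=> mN N0.
have le1 (h k : T -> \bar R) : (forall x, 0 <= h x) -> (forall x, 0 <= k x) ->
    (forall x, ~ N x -> h x = k x) -> \int[mu]_(x in D) h x <= \int[mu]_(x in D) k x.
  move=> h0 k0 hk; rewrite !ge0_integralE//.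
  apply: ge_ereal_sup => _ [s /= sh <-]; apply: ereal_sup_ubound => /=.
  have mNC : measurable (~` N) by exact: measurableC.
  exists (proj_nnsfun s mNC).
    move=> x; rewrite -mrestrict /patch.
    case: (boolP (x \in ~` N)) => [|_]; last by case: ifP.
    rewrite inE => /hk hkx; rewrite (le_trans (sh x))// /patch.
    by case: ifP => //; rewrite hkx.
  rewrite -!integralT_nnsfun; apply: ae_eq_integral => //.
  - by apply/measurable_EFinP; exact: measurable_funP.
  - by apply/measurable_EFinP; exact: measurable_funP.
  exists N; split => // x /= /not_implyP[_ hx].
  apply: contrapT => Nx; apply: hx.
  by rewrite mindicE mem_set// mulr1.
have eq1 (h k : T -> \bar R) : (forall x, 0 <= h x) -> (forall x, 0 <= k x) ->
    (forall x, ~ N x -> h x = k x) -> \int[mu]_(x in D) h x = \int[mu]_(x in D) k x.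
  move=> h0 k0 hk; apply/eqP; rewrite eq_le !le1// => x Nx; by rewrite hk.
move=> fg; rewrite integralE [RHS]integralE; congr (_ - _); apply: eq1 => // x Nx.
- by rewrite !funeposE fg.
- by rewrite !funenegE fg.
Qed.

End null_modification.

Section borel_representative.
Context {R : realType} {n : nat}.
Local Notation mu := (@lebesgue_rV R n).

(** Such sets form a sigma-algebra, because countable unions of null sets are
    null. *)
Lemma completed_measurable_ae (G : set 'rV[R]_n) :
  <<s completed_algebra_gen mu >> G ->
  exists A N, [/\ measurable A, measurable N, mu N = 0%E &
    forall x, ~ N x -> G x <-> A x].
Proof.
pose P (G : set 'rV[R]_n) := exists A N, [/\ measurable A, measurable N, mu N = 0%E &
    forall x, ~ N x -> G x <-> A x].
apply: (@smallest_sub _ _ _ P) => /=.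
  split => [|G' [A [N [mA mN N0 h]]]|F hF].
  - by exists set0, set0; split.
  - exists (~` A), N; split => //; first exact: measurableC.
    by move=> x Nx; rewrite setTD /=; have := h x Nx; tauto.
  - have [A hA] := choice hF; have [N hN] := choice hA.
    exists (\bigcup_k A k), (\bigcup_k N k); split.
    + by apply: bigcupT_measurable => k; have [] := hN k.
    + by apply: bigcupT_measurable => k; have [] := hN k.
    + have mN k : measurable (N k) by have [] := hN k.
      apply/negligibleP; first exact: bigcupT_measurable.
      apply: negligible_bigcup => k; apply/negligibleP => //.
      by have [] := hN k.
    + move=> x Nx; split => -[k _ kx]; exists k => //;
        have [_ _ _ h] := hN k; apply/(h x) => // Nkx; apply: Nx; by exists k.
move=> _ [A mA [N [M [mM M0 NM]] <-]]; exists A, M; split => // x Mx.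
by split; [case=> // /NM|left].
Qed.

Lemma measurable_gt_rat (v : 'rV[R]_n -> R) :
  (forall q : rat, measurable [set x | ratr q < v x]) -> measurable_fun setT v.
Proof.
move=> h mT; apply: (measurability _ (RGenOInfty.measurableE R)) => //.
move=> _ [_ [a ->] <-]; rewrite setTI.
pose F (q : rat) := if a < ratr q then [set x | ratr q < v x] else set0.
rewrite (_ : _ @^-1` _ = \bigcup_q F q).
  by apply: bigcupT_measurable_rat => q; rewrite /F; case: ifP.
apply/seteqP; split => x /=; rewrite in_itv/= andbT.
  by move=> /rat_in_itvoo[q]; rewrite in_itv/= => /andP[aq qv]; exists q => //; rewrite /F aq.
by move=> [q _]; rewrite /F; case: ifP => //= aq; exact: lt_trans.
Qed.

(** Each superlevel set at a rational height is Borel up to a null set; off the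
    union of these null sets, and on [D], the function is kept. *)
Lemma borel_representative (D : set 'rV[R]_n) (u : 'rV[R]_n -> R) :
  measurable D -> measurable_fun D u -> Lebesgue_measurable u ->
  exists v N, [/\ measurable_fun setT v, measurable N, mu N = 0%E,
    forall x, D x -> v x = u x & forall x, ~ N x -> v x = u x].
Proof.
move=> mD mu_ Lu.
have hq (q : rat) : exists A N, [/\ measurable A, measurable N, mu N = 0%E &
    forall x, ~ N x -> ratr q < u x <-> A x].
  apply: completed_measurable_ae.
  have /(_ measurableT `]ratr q, +oo[%classic) := Lu.
  rewrite setTI => /(_ (measurable_itv _)).
  by rewrite (_ : u @^-1` _ = [set x | ratr q < u x])//;
    apply/seteqP; split => x /=; rewrite in_itv/= andbT.
have [A hA] := choice hq; have [N hN] := choice hA.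
pose e k : rat := odflt 0 (unpickle k).
have ee q : e (pickle q) = q by rewrite /e pickleK.
pose M := \bigcup_k N (e k).
have mN q : measurable (N q) by have [] := hN q.
have mM : measurable M by exact: bigcupT_measurable.
have M0 : mu M = 0%E.
  apply/negligibleP => //; apply: negligible_bigcup => k; apply/negligibleP => //.
  by have [] := hN (e k).
have NM q x : ~ M x -> ~ N q x.
  by move=> Mx Nx; apply: Mx; exists (pickle q) => //; rewrite ee.
pose v x := if x \in D then u x else if x \in M then 0 else u x.
exists v, M; split => //.
- apply: measurable_gt_rat => q.
  rewrite (_ : [set x | _] = (D `&` u @^-1` `]ratr q, +oo[) `|`
    ((~` D `&` ~` M) `&` A q) `|`
    ((~` D `&` M) `&` (if ratr q < 0 :> R then setT else set0))).
    have mDC := measurableC mD; have mMC := measurableC mM.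
    apply: measurableU; last first.
      by apply: measurableI; [exact: measurableI|case: ifP].
    apply: measurableU; first exact: mu_.
    by apply: measurableI; [exact: measurableI|have [] := hN q].
  apply/seteqP; split => x /=; rewrite /v.
    case: (boolP (x \in D)) => [|/negP]; rewrite inE => Dx.
      by move=> qx; left; left; rewrite in_itv/= andbT.
    case: (boolP (x \in M)) => [|/negP]; rewrite inE => Mx qx.
      by right; rewrite qx.
    by left; right; split => //; have [_ _ _ h] := hN q; apply/h => //; exact: NM.
  case=> [[[Dx]|[[Dx Mx] Ax]]|[[Dx Mx]]].
  + by rewrite in_itv/= andbT mem_set.
  + rewrite memNset// memNset//.
    by have [_ _ _ h] := hN q; apply/(h x) => //; exact: NM.
  + by rewrite memNset// mem_set//; case: ifP.
- by move=> x Dx; rewrite /v mem_set.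
- by move=> x Mx; rewrite /v (memNset Mx); case: ifP.
Qed.

End borel_representative.

Section reduction.
Context {R : realType} {n : nat}.
Local Notation mu := (@lebesgue_rV R n).

Lemma measurable_Lebesgue (v : 'rV[R]_n -> R) :
  measurable_fun setT v -> Lebesgue_measurable v.
Proof.
move=> mv _ Y mY; apply: sub_sigma_algebra; exists (setT `&` v @^-1` Y).
  exact: (mv measurableT Y mY).
by exists set0; [exact: negligible_set0|rewrite setU0].
Qed.

Section transfer.
Variables (u v : 'rV[R]_n -> R) (N : set 'rV[R]_n).
Hypotheses (mN : measurable N) (N0 : mu N = 0%E).
Hypotheses (vu2 : forall x, ecball 0 2 x -> v x = u x) (vuN : forall x, ~ N x -> v x = u x).

Lemma tail_integral_off_null p s : tail_integral p s v = tail_integral p s u.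
Proof. by apply: (integral_eq_off_null _ mN N0) => x Nx; rewrite vuN. Qed.

Lemma tail_space_off_null p s : measurable_fun setT v ->
  tail_space p s u -> tail_space p s v.
Proof.
move=> mv [[_ loc] t]; split; last by rewrite tail_integral_off_null.
split; first exact: measurable_Lebesgue.
move=> K cK; apply: le_lt_trans (loc K cK); rewrite le_eqVlt; apply/orP; left; apply/eqP.
by apply: (integral_eq_off_null _ mN N0) => x Nx; rewrite vuN.
Qed.

Lemma PV_off_null (x : 'rV[R]_n) (F G : 'rV[R]_n -> R) :
  (forall y, ~ N y -> F y = G y) -> PV x F = PV x G.
Proof.
move=> FG; rewrite /PV.
have -> // : (fun e : R => \int[mu]_(y in ~` ecball x e) (F y)%:E)%E =
  (fun e : R => \int[mu]_(y in ~` ecball x e) (G y)%:E)%E.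
by apply/funext => e; apply: (integral_eq_off_null _ mN N0) => y Ny; rewrite FG.
Qed.

Lemma mixed_op_off_null p q s1 s2 (u' v' : 'rV[R]_n -> R) x :
  v' x = u' x -> (forall y, ~ N y -> v' y = u' y) ->
  mixed_op p q s1 s2 v' x = mixed_op p q s1 s2 u' x.
Proof.
move=> vx vy.
have fE r s : frac_plaplacian r s v' x = frac_plaplacian r s u' x.
  have e : PV x (fun y => `|v' y - v' x| `^ (r - 2) * (v' y - v' x)
                    / enorm (x - y) `^ (n%:R + s * r)) =
           PV x (fun y => `|u' y - u' x| `^ (r - 2) * (u' y - u' x)
                    / enorm (x - y) `^ (n%:R + s * r)).
    by apply: PV_off_null => y Ny; rewrite vx (vy y Ny).
  by rewrite /frac_plaplacian e.
by rewrite /mixed_op !fE.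
Qed.

(** Test functions only see [u] inside the ball pointwise, where nothing has
    changed, and outside it through integrals. *)
Lemma viscosity_off_null p q s1 s2 C : measurable_fun setT v ->
  viscosity_solution p q s1 s2 C u -> viscosity_solution p q s1 s2 C v.
Proof.
move=> mv [cu t1 t2 visc]; split; [|exact: tail_space_off_null|exact: tail_space_off_null|].
  apply: subspace_eq_continuous cu => x; rewrite inE => x2.
  by rewrite /from_subspace/= vu2.
move=> x0 r eta r0 sub c2 ex.
have in2 x : eball x0 r x -> ecball 0 2 x.
  by move=> /sub; rewrite /eball /ecball/= => /ltW.
have x0r : eball x0 r x0 by rewrite /eball/= subrr enorm0.
have opE : mixed_op p q s1 s2 (patch v (eball x0 r) eta) x0 =
    mixed_op p q s1 s2 (patch u (eball x0 r) eta) x0.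
  apply: mixed_op_off_null; first by rewrite /patch mem_set.
  by move=> y Ny; rewrite /patch; case: ifP => // _; exact: vuN.
have ex' : eta x0 = u x0 by rewrite ex vu2//; exact: in2.
have [h1 h2] := visc x0 r eta r0 sub c2 ex'.
by rewrite opE; split => h; [apply: h1|apply: h2] => x xr;
  rewrite -vu2 ?h//; exact: in2.
Qed.

End transfer.

Lemma viscosity_borel (p q s1 s2 C : R) (u : 'rV[R]_n -> R) :
  viscosity_solution p q s1 s2 C u -> exists v,
  [/\ viscosity_solution p q s1 s2 C v, measurable_fun setT v,
      forall x, ecball 0 2 x -> v x = u x, tail_integral p s1 v = tail_integral p s1 u &
      tail_integral q s2 v = tail_integral q s2 u].
Proof.
move=> vu; have [cu [[Lu _] _] _ _] := vu.
have mD : measurable (ecball 0 2 : set 'rV[R]_n).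
  rewrite -[ecball 0 2]setCK; apply: measurableC; apply: open_measurable_rV.
  by rewrite openC; exact: closed_ecball.
have muD := subspace_continuous_measurable_fun_rV mD cu.
have [v [N [mv mN N0 v2 vN]]] := borel_representative mD muD Lu.
exists v; split; [|exact: mv|exact: v2| |].
- exact: (viscosity_off_null mN N0 v2 vN mv vu).
- exact: (tail_integral_off_null mN N0 vN).
- exact: (tail_integral_off_null mN N0 vN).
Qed.

End reduction.

(** * Local estimates *)

Section local_estimates.
Context {R : realType} {n : nat}.
Implicit Types u v : 'rV[R]_n -> R.

Lemma hoelder_norm_le (A : set 'rV[R]_n) u (gam M K : R) :
  (forall x, A x -> `|u x| <= M) ->
  (forall x y, A x -> A y -> `|u x - u y| <= K * enorm (x - y) `^ gam) ->
  (hoelder_norm gam A u <= (M + K)%:E)%E.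
Proof.
move=> hM hK; rewrite /hoelder_norm EFinD; apply: leeD.
  by apply: ge_ereal_sup => _ [x Ax <-]; rewrite lee_fin hM.
apply: ge_ereal_sup => _ [[x y] /= [Ax Ay xy] <-].
rewrite lee_fin ler_pdivrMr; first exact: hK.
by rewrite powR_gt0// enorm_gt0 subr_eq0.
Qed.

Lemma hoelder_ball_norm_le u (gam M K r : R) :
  (forall x, enorm x < r -> `|u x| <= M) -> hoelder_ball u r gam K ->
  forall A : set 'rV[R]_n, A `<=` eball 0 r -> (hoelder_norm gam A u <= (M + K)%:E)%E.
Proof.
move=> hM hK A Ar.
have Ar' x : A x -> enorm x < r by move=> /Ar; rewrite /eball/= subr0.
by apply: hoelder_norm_le => [x /Ar'|x y /Ar' xr /Ar' yr]; [exact: hM|exact: hK].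
Qed.

(** Removes the Borel hypothesis from [uniform_hoelder]. *)
Lemma uniform_hoelder_all (p q s1 s2 C gam : R) : @uniform_hoelder R n p q s1 s2 C gam ->
  forall A0 r : R, 0 <= A0 -> 0 < r < 2 -> exists2 K, 0 <= K & forall u,
  viscosity_solution p q s1 s2 C u ->
  (tail_integral p s1 u <= A0%:E)%E -> (tail_integral q s2 u <= A0%:E)%E ->
  (forall x, enorm x < 2 -> `|u x| <= A0) -> hoelder_ball u r gam K.
Proof.
move=> uh A0 r A00 /[dup] r02 /andP[r0 r2]; have [K K0 hK] := uh A0 r A00 r02.
exists K => // u vu t1 t2 uA x y xr yr.
have [v [vv mv v2 vt1 vt2]] := viscosity_borel vu.
have in2 (z : 'rV[R]_n) : enorm z < 2 -> ecball 0 2 z by rewrite /ecball/= subr0 => /ltW.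
have xin : ecball 0 2 x by apply: in2; exact: lt_trans r2.
have yin : ecball 0 2 y by apply: in2; exact: lt_trans r2.
have vA (z : 'rV[R]_n) : enorm z < 2 -> `|v z| <= A0 by move=> z2; rewrite (v2 _ (in2 _ z2)); exact: uA.
rewrite -vt1 in t1; rewrite -vt2 in t2.
rewrite -(v2 _ xin) -(v2 _ yin); exact: (hK v vv mv t1 t2 vA x y xr yr).
Qed.

Lemma viscosity_bounds (p q s1 s2 C : R) u : viscosity_solution p q s1 s2 C u ->
  exists A0, [/\ 0 <= A0, (tail_integral p s1 u <= A0%:E)%E,
    (tail_integral q s2 u <= A0%:E)%E & forall x, enorm x < 2 -> `|u x| <= A0].
Proof.
move=> [cu [_ t1] [_ t2] _].
have cn : {within ecball 0 2, continuous (fun x => `|u x|)}.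
  apply/subspace_continuousP => x x2.
  exact: (cvg_norm ((subspace_continuousP _ u).1 cu x x2)).
have [z _ hz] : exists2 c, c \in ecball 0 2 & forall t, t \in ecball 0 2 -> `|u t| <= `|u c|.
  apply: compact_EVT_max cn; last exact: compact_ecball.
  by exists 0; rewrite /ecball/= subrr enorm0.
have tail_fin p' s' : (tail_integral p' s' u < +oo)%E ->
    exists2 T, 0 <= T & tail_integral p' s' u = T%:E.
  move=> t; have t0 : (0 <= tail_integral p' s' u)%E.
    apply: integral_ge0 => x _.
    by rewrite lee_fin mulr_ge0 ?invr_ge0 ?powR_ge0.
  exists (fine (tail_integral p' s' u)); first exact: fine_ge0.
  by rewrite fineK// ge0_fin_numE.
have [T1 T10 E1] := tail_fin _ _ t1; have [T2 T20 E2] := tail_fin _ _ t2.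
exists (`|u z| + T1 + T2); split.
- by rewrite !addr_ge0.
- by rewrite E1 lee_fin -addrA addrCA lerDl addr_ge0.
- by rewrite E2 lee_fin lerDr addr_ge0.
- move=> x x2; rewrite -addrA; apply: (@le_trans _ _ `|u z|).
    by apply: hz; rewrite inE /ecball/= subr0 ltW.
  by rewrite lerDl addr_ge0.
Qed.

Lemma uniform_hoelder_locally (p q s1 s2 C gam : R) u :
  @uniform_hoelder R n p q s1 s2 C gam -> viscosity_solution p q s1 s2 C u ->
  forall r (A : set 'rV[R]_n), 0 < r < 2 -> A `<=` eball 0 r -> hoelder_on gam A u.
Proof.
move=> uh vu r A /[dup] r02 /andP[r0 r2] Ar.
have [A0 [A00 t1 t2 uA]] := viscosity_bounds vu.
have [K K0 hK] := uniform_hoelder_all uh A00 r02.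
have uA' x : enorm x < r -> `|u x| <= A0 by move=> xr; apply: uA; exact: lt_trans r2.
apply: le_lt_trans (hoelder_ball_norm_le uA' (hK u vu t1 t2 uA) Ar) _.
exact: ltry.
Qed.

Lemma compact_sub_ball (A : set 'rV[R]_n) : compact A -> A `<=` eball 0 2 ->
  exists2 r : R, 0 < r < 2 & A `<=` eball 0 r.
Proof.
move=> cA A2; have [A0|/set0P A0] := eqVneq A set0.
  by exists 1; rewrite ?A0 ?ltr01 ?ltr1n.
have [z] := compact_EVT_max A0 cA (continuous_subspaceT (@continuous_enorm R n)).
rewrite inE => Az hz; have := A2 _ Az; rewrite /eball/= subr0 => z2.
exists ((enorm z + 2) / 2); first by have := enorm_ge0 z => z0; apply/andP; split; lra.
move=> x Ax; rewrite /eball/= subr0; apply: le_lt_trans (hz x _) _; first by rewrite inE.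
by move: z2; move: (enorm z) => y; lra.
Qed.

End local_estimates.


(** * The regularity theorem *)

Theorem theorem5p1 (R : realType) (n : nat) (p q s1 s2 C : R)
    (hn : (1 <= n)%N) (hp : 2 <= p) (hq : 2 <= q)
    (hs1 : 0 < s1 < 1) (hs2 : 0 < s2 < 1) (hC : 0 <= C) :
  let m := Num.max (s1 * p / (p - 1)) (s2 * q / (q - 1)) in
  let varpi := Num.min 1 m in
  [/\ forall u : 'rV[R]_n -> R, viscosity_solution p q s1 s2 C u ->
        forall gamma : R, 0 < gamma < varpi -> hoelder_on gamma (eball 0 1) u,
      forall gamma A0 : R, 0 < gamma < varpi ->
        exists K : R, forall u : 'rV[R]_n -> R,
          viscosity_solution p q s1 s2 C u ->
          (sup_norm (eball 0 2) u + tail_integral p s1 u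
             + tail_integral q s2 u <= A0%:E)%E ->
          (hoelder_norm gamma (eball 0 1) u <= K%:E)%E &
      m != 1 ->
      forall u : 'rV[R]_n -> R, viscosity_solution p q s1 s2 C u ->
        locally_hoelder_in varpi (eball 0 2) u].
Proof.
move=> m varpi.
have r102 : 0 < (1 : R) < 2 by rewrite ltr01 ltr1n.
have sub gamma : 0 < gamma < varpi -> @uniform_hoelder R n p q s1 s2 C gamma.
  rewrite /varpi lt_min => /and3P[g0 g1 gm].
  by apply: uniform_hoelder_lt1 => //; [rewrite g0|exact: ltW].
split.
- move=> u vu gamma g01.
  exact: (uniform_hoelder_locally (sub _ g01) vu r102 (fun x => id)).
- move=> gamma A0 g01; pose A1 := Num.max A0 0.
  have A10 : 0 <= A1 by rewrite le_max lexx orbT.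
  have [K K0 hK] := uniform_hoelder_all (sub _ g01) A10 r102.
  exists (A1 + K) => u vu hA.
  have t10 : (0 <= tail_integral p s1 u)%E.
    by apply: integral_ge0 => x _; rewrite lee_fin mulr_ge0 ?invr_ge0 ?powR_ge0.
  have t20 : (0 <= tail_integral q s2 u)%E.
    by apply: integral_ge0 => x _; rewrite lee_fin mulr_ge0 ?invr_ge0 ?powR_ge0.
  have usup x : enorm x < 2 -> (`|u x|%:E <= sup_norm (eball 0 2) u)%E.
    by move=> x2; apply: ereal_sup_ubound; exists x => //; rewrite /eball/= subr0.
  have s0 : (0 <= sup_norm (eball 0 2) u)%E.
    by apply: le_trans (usup 0 _); rewrite ?lee_fin ?enorm0.
  have hA1 : (sup_norm (eball 0 2) u + tail_integral p s1 u
             + tail_integral q s2 u <= A1%:E)%E.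
    by apply: le_trans hA _; rewrite lee_fin le_max lexx.
  have uA x : enorm x < 2 -> `|u x| <= A1.
    move=> x2; rewrite -lee_fin; apply: le_trans (usup x x2) (le_trans _ hA1).
    by rewrite -addeA; exact: (leeDl _ (adde_ge0 t10 t20)).
  have uA1 x : enorm x < 1 -> `|u x| <= A1.
    by move=> x1; apply: uA; apply: lt_trans x1 _; rewrite ltr1n.
  apply: (hoelder_ball_norm_le uA1) => //; apply: hK => //.
    by apply: le_trans _ hA1; rewrite -addeA addeCA; exact: (leeDl _ (adde_ge0 s0 t20)).
  by apply: le_trans _ hA1; exact: (leeDr _ (adde_ge0 s0 t10)).
- move=> m1 u vu A cA A2; have [r r02 Ar] := compact_sub_ball cA A2.
  have p10 : 0 < p - 1 by lra.
  have q10 : 0 < q - 1 by lra.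
  apply: (uniform_hoelder_locally _ vu r02 Ar).
  have [m_lt1|m_ge1] := ltP m 1.
    rewrite /varpi min_r ?(ltW m_lt1)//; apply: uniform_hoelder_lt1 => //.
    rewrite m_lt1 andbT lt_max; apply/orP; left; rewrite divr_gt0 ?mulr_gt0//; lra.
  rewrite /varpi min_l//; have : 1 < m by rewrite lt_neqAle eq_sym m1.
  rewrite lt_max !ltr_pdivlMr// !mul1r => /orP[sp|sq].
    exact: uniform_lipschitz_left.
  by apply: uniform_hoelder_sym; exact: uniform_lipschitz_left.
Qed.
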